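(* Let $\varphi\colon[-1,1]\to\mathbb{R}$ be convex and strictly convex at $0$ with $\varphi(0)=0$. For random vectors $(Y,\mathbf{X})$ with $Y$ real-valued and non-degenerate and $\mathbf{X}$ in $\mathbb{R}^p$ ($p\in\mathbb{N}$ arbitrary) define $$\xi_\varphi(Y,\mathbf{X})=\alpha_\varphi^{-1}\int_{\mathbb{R}^p}\int_{\mathbb{R}}\varphi\big(F_{Y|\mathbf{X}=\mathbf{x}}(y)-F_Y(y)\big)\,dP^Y(y)\,dP^{\mathbf{X}}(\mathbf{x}),$$ $$\Lambda_\varphi(Y,\mathbf{X})=\beta_\varphi^{-1}\int_{\mathbb{R}^{2p}}\int_{\mathbb{R}}\varphi\big(F_{Y|\mathbf{X}=\mathbf{x}_1}(y)-F_{Y|\mathbf{X}=\mathbf{x}_2}(y)\big)\,dP^Y(y)\,d(P^{\mathbf{X}}\otimes P^{\mathbf{X}})(\mathbf{x}_1,\mathbf{x}_2),$$ with $\alpha_\varphi=\int_{\mathbb{R}}\int_{\mathbb{R}}\varphi(\mathbf{1}_{\{y_1\le y\}}-F_Y(y))\,dP^Y(y)\,dP^Y(y_1)$ and $\beta_\varphi=\int_{\mathbb{R}^2}\int_{\mathbb{R}}\varphi(\mathbf{1}_{\{y_1\le y\}}-\mathbf{1}_{\{y_2\le y\}})\,dP^Y(y)\,d(P^Y\otimes P^Y)(y_1,y_2)$. Then $(Y,\mathbf{X})\preccurlyeq_{ccx}(Y',\mathbf{X}')$ implies $$\xi_\varphi(Y,\mathbf{X})\le\xi_\varphi(Y',\mathbf{X}')\quad\text{and}\quad\Lambda_\varphi(Y,\mathbf{X})\le\Lambda_\varphi(Y',\mathbf{X}').$$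 Further, the following statements hold true: (i) $\xi_\varphi$ and $\Lambda_\varphi$ attain values only in $[0,1]$. (ii) $\xi_\varphi$ and $\Lambda_\varphi$ have the zero-independence and max-functionality property. (iii) $\xi_\varphi$ and $\Lambda_\varphi$ satisfy information monotonicity, i.e. $\xi_\varphi(Y,\mathbf{X})\le\xi_\varphi(Y,(\mathbf{X},\mathbf{Z}))$ and $\Lambda_\varphi(Y,\mathbf{X})\le\Lambda_\varphi(Y,(\mathbf{X},\mathbf{Z}))$ for all random vectors $\mathbf{X},\mathbf{Z}$. (iv) If $\varphi$ is strictly convex on $[-1,1]$, then $\Lambda_\varphi(Y,\mathbf{X})=\Lambda_\varphi(Y,(\mathbf{X},\mathbf{Z}))$ if and only if $\xi_\varphi(Y,\mathbf{X})=\xi_\varphi(Y,(\mathbf{X},\mathbf{Z}))$ if and only if $Y$ and $\mathbf{Z}$ are conditionally independent given $\mathbf{X}$.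
   Context: Strictly convex at $0$ means $\varphi(0)<t\varphi(x)+(1-t)\varphi(y)$ whenever $x<0<y$ in the domain, $t\in(0,1)$ and $tx+(1-t)y=0$. $F_Y$ is the distribution function of $Y$, $F_{Y|\mathbf{X}=\mathbf{x}}$ the conditional distribution function, $P^Y$, $P^{\mathbf{X}}$ the laws of $Y$, $\mathbf{X}$. A functional $\kappa(Y,\mathbf{X})$ has the zero-independence property if $\kappa(Y,\mathbf{X})=0$ iff $Y$ and $\mathbf{X}$ are independent, and the max-functionality property if $\kappa(Y,\mathbf{X})=1$ iff $Y=f(\mathbf{X})$ almost surely for some measurable $f$. $q_Y(v)=\inf\{y\mid F_Y(y)\ge v\}$, $v\in(0,1)$. For bounded random variables, $S\le_{cx}T$ means $\mathbb{E}\psi(S)\le\mathbb{E}\psi(T)$ for all convex $\psi\colon\mathbb{R}\to\mathbb{R}$. Conditional convex order: $(Y,\mathbf{X})\preccurlyeq_{ccx}(Y',\mathbf{X}')$ means $P(Y\ge q_Y(v)\mid\mathbf{X})\le_{cx}P(Y'\ge q_{Y'}(v)\mid\mathbf{X}')$ for all $v\in(0,1)$ (the dimensions of $\mathbf{X},\mathbf{X}'$ may differ). *)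

(* Defs.v *)
From HB Require Import structures.
From mathcomp Require Import all_boot all_order all_algebra.
From mathcomp Require Import all_classical all_reals all_analysis.
Set Implicit Arguments.
Unset Strict Implicit.
Unset Printing Implicit Defensive.
Import Order.TTheory GRing.Theory Num.Theory.
Import numFieldNormedType.Exports.

Local Open Scope classical_set_scope.
Local Open Scope ring_scope.

(** Random vectors in R^p are random variables with values in [p.-tuple R],
    which carries the sigma-algebra generated by the coordinates. *)

Section convexity.
Context {R : realType}.

Definition strictly_convex_at0 (D : set R) (f : R -> R) :=
  forall x y t : R, D x -> D y -> x < 0 -> 0 < y -> 0 < t -> t < 1 ->
    t * x + (1 - t) * y = 0 -> f 0 < t * f x + (1 - t) * f y.

Definition strictly_convex (D : set R) (f : R -> R) :=
  forall x y t : R, D x -> D y -> x != y -> 0 < t -> t < 1 ->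
    f (t * x + (1 - t) * y) < t * f x + (1 - t) * f y.

End convexity.

Section random_vectors.
Context {d} {T : measurableType d} {R : realType} {P : probability T R}.

Lemma measurable_cat_tuple p q
    (X : {RV P >-> p.-tuple R}) (Z : {RV P >-> q.-tuple R}) :
  measurable_fun [set: T] (fun w => cat_tuple (X w) (Z w)).
Proof.
apply/measurable_fun_tnthP => i; rewrite -(splitK i).
case: (fintype.split i) => j /=.
- rewrite (_ : _ \o _ = (@tnth _ R ^~ j) \o X).
    exact: measurableT_comp (measurable_tnth j) _.
  by apply/funext => w /=; rewrite tnth_lshift.
- rewrite (_ : _ \o _ = (@tnth _ R ^~ j) \o Z).
    exact: measurableT_comp (measurable_tnth j) _.
  by apply/funext => w /=; rewrite tnth_rshift.
Qed.

Definition rv_cat p q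
    (X : {RV P >-> p.-tuple R}) (Z : {RV P >-> q.-tuple R}) :
    {RV P >-> (p + q).-tuple R} :=
  mfun_Sub (mem_set (measurable_cat_tuple X Z)).

Definition degenerate (Y : {RV P >-> R}) :=
  exists c : R, \forall w \ae P, Y w = c.

Definition Fcdf (Y : {RV P >-> R}) (y : R) : R := fine (cdf Y y).

Definition quantile (Y : {RV P >-> R}) (v : R) : R :=
  inf [set y | v <= Fcdf Y y].

End random_vectors.

Section conditional.
Context {d} {T : measurableType d} {R : realType} {P : probability T R}.
Context {d'} {T' : measurableType d'}.

(** [g] is a [0, 1]-valued version of [x |-> P (E | X = x)]. *)
Definition is_cond_prob (X : {RV P >-> T'}) (E : set T) (g : T' -> R) :=
  [/\ measurable_fun setT g,
      (forall x, 0 <= g x <= 1) &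
      forall B, measurable B ->
        (\int[distribution P X]_(x in B) (g x)%:E = P (E `&` X @^-1` B))%E].

(** A fixed version of [x |-> P (E | X = x)]; it exists for every measurable
    [E], so that the default value of [get] is never used. The random variable
    [P (E | X)] is [cond_prob X E \o X]. *)
Definition cond_prob (X : {RV P >-> T'}) (E : set T) : T' -> R :=
  get [set g | is_cond_prob X E g].

Definition is_cdf (G : R -> R) :=
  [/\ {homo G : x y / x <= y}, right_continuous G,
      G y @[y --> -oo] --> (0 : R) & G y @[y --> +oo] --> (1 : R)].

(** [F x y] is [F_{Y | X = x} (y)] for a regular version. *)
Definition is_cond_cdf (Y : {RV P >-> R}) (X : {RV P >-> T'})
    (F : T' -> R -> R) :=
  (forall x, is_cdf (F x)) /\
  (forall y, is_cond_prob X [set w | Y w <= y] (F ^~ y)).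

(** Since [Y] is real-valued a regular version exists, and two of them agree
    for almost every [x]; one is fixed here. *)
Definition cond_cdf (Y : {RV P >-> R}) (X : {RV P >-> T'}) : T' -> R -> R :=
  get [set F | is_cond_cdf Y X F].

Definition independent (Y : {RV P >-> R}) (X : {RV P >-> T'}) :=
  forall (A : set R) (B : set T'), measurable A -> measurable B ->
    P (Y @^-1` A `&` X @^-1` B) = (P (Y @^-1` A) * P (X @^-1` B))%E.

Definition function_of (Y : {RV P >-> R}) (X : {RV P >-> T'}) :=
  exists2 f : T' -> R, measurable_fun setT f & \forall w \ae P, Y w = f (X w).

Definition cond_independent {d''} {T'' : measurableType d''}
    (Y : {RV P >-> R}) (Z : {RV P >-> T''}) (X : {RV P >-> T'}) :=
  forall (A : set R) (B : set T''), measurable A -> measurable B ->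
    \forall w \ae P,
      cond_prob X (Y @^-1` A `&` Z @^-1` B) (X w)
      = cond_prob X (Y @^-1` A) (X w) * cond_prob X (Z @^-1` B) (X w).

End conditional.

Definition le_cx {R : realType}
    {d1} {T1 : measurableType d1} (P1 : probability T1 R) (S1 : T1 -> R)
    {d2} {T2 : measurableType d2} (P2 : probability T2 R) (S2 : T2 -> R) :=
  forall psi : R -> R, convex_function (setT : set R^o) psi ->
    ('E_P1[psi \o S1] <= 'E_P2[psi \o S2])%E.

Definition le_ccx {R : realType}
    {d1} {T1 : measurableType d1} {P1 : probability T1 R} {p1 : nat}
    {d2} {T2 : measurableType d2} {P2 : probability T2 R} {p2 : nat}
    (Y1 : {RV P1 >-> R}) (X1 : {RV P1 >-> p1.-tuple R})
    (Y2 : {RV P2 >-> R}) (X2 : {RV P2 >-> p2.-tuple R}) :=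
  forall v : R, 0 < v -> v < 1 ->
    le_cx P1 (cond_prob X1 [set w | quantile Y1 v <= Y1 w] \o X1)
          P2 (cond_prob X2 [set w | quantile Y2 v <= Y2 w] \o X2).

Section coefficients.
Context {R : realType} (phi : R -> R).
Context {d} {T : measurableType d} {P : probability T R}.

Definition alpha (Y : {RV P >-> R}) : R :=
  let PY := distribution P Y in
  \int[PY]_y1 \int[PY]_y phi ((y1 <= y)%R%:R - Fcdf Y y).

Definition beta (Y : {RV P >-> R}) : R :=
  let PY := distribution P Y in
  \int[(PY \x PY)%E]_u \int[PY]_y phi ((u.1 <= y)%R%:R - (u.2 <= y)%R%:R).

Definition xi {p} (Y : {RV P >-> R}) (X : {RV P >-> p.-tuple R}) : R :=
  (alpha Y)^-1 *
  \int[distribution P X]_x \int[distribution P Y]_y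
    phi (cond_cdf Y X x y - Fcdf Y y).

Definition Lambda {p} (Y : {RV P >-> R}) (X : {RV P >-> p.-tuple R}) : R :=
  let PX := distribution P X in
  (beta Y)^-1 *
  \int[(PX \x PX)%E]_u \int[distribution P Y]_y
    phi (cond_cdf Y X u.1 y - cond_cdf Y X u.2 y).

End coefficients.

(* Main.v *)
(**
  Write U_y = F_{Y|X}(y) and D_y = 1_{Y <= y}, both as random variables. For fixed y
  the inner integral of xi is E phi (U_y - F_Y y) and that of Lambda is
  E phi (U_y - U'_y) with U'_y an independent copy of U_y; replacing U_y by D_y gives
  the normalizing constants. Both integrals increase with U_y in the convex order
  (for Lambda, change the two copies one at a time).

  Conditional Jensen gives F_Y y <= U_y <= U_y(X, Z) <= D_y in the convex order, hence
  the range and information monotonicity. Equality in the integrals over y gives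
  equality for almost all y; strict convexity at 0 then forces U_y = F_Y y, or U_y in
  {0, 1}, whereas strict convexity forces U_y = U_y(X, Z). Every value F_Y y > 0 is
  approximated from below by values F_Y z with z in a given set of full measure, so
  these identities extend to all y.

  For the conditional convex order, integrate over y = q_Y(v), v uniform on (0, 1).
  Testing with +-id shows that P (Y < q_Y v) is the same for both pairs; up to countably
  many v this determines r = F_Y (q_Y v), and P (Y > q_Y v | X) is the L1-limit of
  P (Y >= q_Y v' | X) as v' decreases to r.
*)
Require Import Defs.
From HB Require Import structures.
From mathcomp Require Import all_boot all_order all_algebra.
From mathcomp Require Import all_classical all_reals all_analysis measurable_realfun.
From mathcomp Require Import ring lra.
Set Implicit Arguments.
Unset Strict Implicit.
Unset Printing Implicit Defensive.
Import Order.TTheory GRing.Theory Num.Theory.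
Import numFieldNormedType.Exports.

Local Open Scope classical_set_scope.
Local Open Scope ring_scope.

(** * Convex functions on an interval *)

(** Strictness at 0 alone settles both extreme values. For the value 0, a support line of phi at 0
    can touch phi on one side of 0 only, and a variable of mean 0 with values on one side vanishes.
    For the value 1, the chord of phi over [[-a, 1 - a]] lies strictly above phi inside this
    interval; here [a] is F_Y y for xi and a value of U_y for Lambda. Two mismatches shape the part
    on the conditional convex order. The order speaks of P (Y >= q | X), whereas the coefficients
    contain P (Y <= q | X), so that atoms of Y at q must be resolved by approaching from higher
    levels. And the order tests with finite convex functions on the line, which are continuous,
    whereas phi may jump at -1 and 1. The normalizing constants are compared by the same transfer to
    levels v: at q_Y v the indicator of Y <= y is a Bernoulli variable with parameter F_Y (q_Y v),
    which is the same for both pairs for almost every v. *)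

Section convex_on.
Context {R : realType}.
Implicit Types (a b x y z t u : R) (f : R -> R).

(** Convexity on the whole line is written [forall a b, convex_on a b f]. *)
Definition convex_on a b f := forall x y t,
  a <= x <= b -> a <= y <= b -> 0 <= t <= 1 ->
  f (t * x + (1 - t) * y) <= t * f x + (1 - t) * f y.

Definition slope f x y := (f y - f x) / (y - x).

(** The chord inequality cleared of denominators, so that [x = z] is included and [nra] can use
    it. *)
Lemma convex_on_chord a b f x y z : convex_on a b f ->
  a <= x -> z <= b -> x <= y -> y <= z ->
  f y * (z - x) <= f x * (z - y) + f z * (y - x).
Proof.
move=> cf ax zb xy yz; have [xz|xz] := eqVneq x z.
  have -> : y = x by lra.
  by rewrite -xz !subrr !mulr0 addr0.
have xz' : 0 < z - x by rewrite subr_gt0 lt_neqAle xz (le_trans xy).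
have := cf x z ((z - y) / (z - x)).
have -> : (z - y) / (z - x) * x + (1 - (z - y) / (z - x)) * z = y.
  by field; rewrite gt_eqF.
move=> H.
have : f y <= (z - y) / (z - x) * f x + (1 - (z - y) / (z - x)) * f z.
  apply: H; first lra; first lra.
  by rewrite divr_ge0 ?ler_pdivrMr//=; lra.
rewrite -(ler_pM2r xz') => /le_trans; apply.
by rewrite le_eqVlt; apply/orP; left; apply/eqP; field; rewrite gt_eqF.
Qed.

Lemma slope_monor a b f x y z : convex_on a b f ->
  a <= x -> z <= b -> x < y -> y <= z -> slope f x y <= slope f x z.
Proof.
move=> cf ax zb xy yz; rewrite /slope ler_pdivrMr ?subr_gt0// mulrAC.
rewrite ler_pdivlMr ?subr_gt0 ?(lt_le_trans xy)//.
have := convex_on_chord cf ax zb (ltW xy) yz; nra.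
Qed.

Lemma slope_monol a b f x y z : convex_on a b f ->
  a <= x -> z <= b -> x <= y -> y < z -> slope f x z <= slope f y z.
Proof.
move=> cf ax zb xy yz; rewrite /slope ler_pdivrMr ?subr_gt0 ?(le_lt_trans xy)//.
rewrite mulrAC ler_pdivlMr ?subr_gt0//.
have := convex_on_chord cf ax zb xy (ltW yz); nra.
Qed.

Lemma slope_mono a b f x y x' y' : convex_on a b f ->
  a <= x -> y' <= b -> x < y -> x' < y' -> x <= x' -> y <= y' ->
  slope f x y <= slope f x' y'.
Proof.
move=> cf ax yb xy xy' xx yy; apply: (@le_trans _ _ (slope f x y')).
  exact: (slope_monor cf).
exact: (slope_monol cf).
Qed.

Lemma slopeE f x y : x != y -> f y = f x + slope f x y * (y - x).
Proof. by move=> xy; rewrite /slope; field; rewrite subr_eq0 eq_sym. Qed.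

Lemma slopeC f x y : slope f x y = slope f y x.
Proof. by rewrite /slope -[y - x]opprB invrN mulrN -mulNr opprB. Qed.

Lemma convex_on_subset a b a' b' f : a <= a' -> b' <= b ->
  convex_on a b f -> convex_on a' b' f.
Proof. by move=> aa bb cf x y t xi yi ti; apply: cf => //; lra. Qed.

Lemma convex_on_ub a b f x : convex_on a b f -> a <= x <= b ->
  f x <= Num.max (f a) (f b).
Proof.
move=> cf /andP[ax xb]; have [ab|ab] := eqVneq a b.
  by rewrite (_ : x = a) ?le_max ?lexx//; lra.
have ab' : 0 < b - a by rewrite subr_gt0 lt_neqAle ab (le_trans ax).
rewrite -(ler_pM2r ab'); apply: le_trans (convex_on_chord cf _ _ ax xb) _ => //.
set m := Num.max _ _; have fam : f a <= m by rewrite le_max lexx.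
have fbm : f b <= m by rewrite le_max lexx orbT.
nra.
Qed.

(** The endpoints bound [f] from above by [m]. With [c] the midpoint of the interval, convexity
    between [x] and its reflection [a + b - x] gives [f x >= 2 f c - m]. *)
Lemma convex_on_bounded a b f : convex_on a b f ->
  exists M : R, forall x, a <= x <= b -> `|f x| <= M.
Proof.
move=> cf; pose m := Num.max (f a) (f b).
exists (`|m| + 2 * `|f ((a + b) / 2)|) => x abx.
have := convex_on_ub cf abx; rewrite -/m => fxm.
have abx' : a <= a + b - x <= b by lra.
have := convex_on_ub cf abx'; rewrite -/m => fxm'.
have := cf x (a + b - x) (1 / 2) abx abx' ltac:(lra).
have -> : 1 / 2 * x + (1 - 1 / 2) * (a + b - x) = (a + b) / 2 by field.
have := ler_norm m; have := ler_norm (- f ((a + b) / 2)); rewrite normrN.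
have := normr_ge0 (f ((a + b) / 2)); rewrite ler_norml; lra.
Qed.

(** The left derivative: slopes increase, so the supremum is their limit. Among the slopes of
    support lines this choice is monotone in [u], hence measurable. *)
Definition left_slope a f u := sup [set slope f x u | x in `[a, u[].

Lemma has_sup_left_slope a b f u z : convex_on a b f -> a < u -> u < z -> z <= b ->
  has_sup [set slope f x u | x in `[a, u[].
Proof.
move=> cf au uz zb; split.
  by exists (slope f a u), a => //=; rewrite in_itv/= lexx.
exists (slope f u z) => _ [x /= + <-]; rewrite in_itv/= => /andP[ax xu].
by apply: (slope_mono cf) => //; lra.
Qed.

Lemma slope_le_left_slope a b f u x : convex_on a b f -> a <= x -> x < u -> u < b ->
  slope f x u <= left_slope a f u.
Proof.
move=> cf ax xu ub; apply: ub_le_sup; last first.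
  by exists x => //=; rewrite in_itv/= ax.
by have [] := has_sup_left_slope cf (le_lt_trans ax xu) ub (lexx _).
Qed.

Lemma left_slope_le_slope a b f u z : convex_on a b f -> a < u -> u < z -> z <= b ->
  left_slope a f u <= slope f u z.
Proof.
move=> cf au uz zb; apply: ge_sup.
  by have [] := has_sup_left_slope cf au uz zb.
move=> _ [x /= + <-]; rewrite in_itv/= => /andP[ax xu].
by apply: (slope_mono cf) => //; lra.
Qed.

Lemma left_slope_support a b f u x : convex_on a b f -> a < u -> u < b ->
  a <= x <= b -> f u + left_slope a f u * (x - u) <= f x.
Proof.
move=> cf au ub /andP[ax xb]; have [xu|ux|->] := ltgtP x u; last first.
- by rewrite subrr mulr0 addr0.
- rewrite [leRHS](@slopeE _ u) ?(lt_eqF ux)// lerD2l ler_pM2r ?subr_gt0//.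
  exact: (left_slope_le_slope cf).
- rewrite [leRHS](@slopeE _ u) ?gt_eqF// lerD2l ler_nM2r ?subr_lt0// slopeC.
  exact: (slope_le_left_slope cf).
Qed.

Lemma left_slope_mono a b f u u' : convex_on a b f -> a < u -> u <= u' -> u' < b ->
  left_slope a f u <= left_slope a f u'.
Proof.
move=> cf au; rewrite [u <= u']le_eqVlt => /predU1P[-> //|uu] ub.
apply: (@le_trans _ _ (slope f u u')).
  by apply: (left_slope_le_slope cf) => //; lra.
by apply: (slope_le_left_slope cf) => //; lra.
Qed.

(** For a function glued from pieces, a support line at each point is easier to exhibit than the
    convexity inequality, whose three points may lie in different pieces. *)
Lemma support_convex f : (forall z, exists m, forall y, f z + m * (y - z) <= f y) ->
  forall a b, convex_on a b f.
Proof.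
move=> sf a b x y t _ _ /andP[t0 t1].
have [m mf] := sf (t * x + (1 - t) * y).
have := mf x; have := mf y; move: (f (t * x + _)) (f x) (f y) => fz fx fy hy hx.
have : 0 <= t * (fx - (fz + m * (x - (t * x + (1 - t) * y)))).
  by rewrite mulr_ge0// subr_ge0.
have : 0 <= (1 - t) * (fy - (fz + m * (y - (t * x + (1 - t) * y)))).
  by rewrite mulr_ge0// subr_ge0.
lra.
Qed.

(* A convex function on [0, 1] may jump at the endpoints; replacing it by its
   chords over [0, e] and [1 - e, 1] extends it to a finite convex function on
   the line. *)
Lemma convex_on01_approx f (e : R) : convex_on 0 1 f -> 0 < e -> e < 1 / 2 ->
  exists g, [/\ forall a b, convex_on a b g,
    forall x, e <= x <= 1 - e -> g x = f x, g 0 = f 0, g 1 = f 1 &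
    forall x, 0 <= x <= 1 -> f x <= g x].
Proof.
move=> cf e0 e1.
pose s1 := slope f 0 e; pose s2 := slope f (1 - e) 1.
pose l1 x := f 0 + s1 * x; pose l2 x := f 1 + s2 * (x - 1).
pose g x := if x < e then l1 x else if 1 - e < x then l2 x else f x.
have l1e : l1 e = f e.
  by rewrite (@slopeE f 0 e) ?subr0// eq_sym gt_eqF.
have l2e : l2 (1 - e) = f (1 - e).
  have h : 1 - e < 1 by lra.
  by rewrite /l2 [f 1](@slopeE f (1 - e) 1) ?lt_eqF// -/s2; ring.
have s12 : s1 <= s2 by apply: (slope_mono cf); lra.
have l1f x : e <= x -> x <= 1 -> l1 x <= f x.
  move=> ex x1; have x0 : 0 < x by lra.
  rewrite [leRHS](@slopeE f 0 x) ?lt_eqF// subr0 lerD2l ler_wpM2r// ?(ltW x0)//.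
  by apply: (slope_mono cf); lra.
have l2f x : 0 <= x -> x <= 1 - e -> l2 x <= f x.
  move=> x0 xe; have x1 : x < 1 by lra.
  rewrite [leRHS](@slopeE f 1 x) ?gt_eqF// lerD2l ler_wnM2r//; first lra.
  by rewrite slopeC; apply: (slope_mono cf); lra.
have fl1 x : 0 <= x -> x <= e -> f x <= l1 x.
  move=> x0 xe; have := convex_on_chord cf (lexx 0) (_ : e <= 1) x0 xe.
  rewrite -l1e /l1 => H; rewrite -(ler_pM2r e0).
  by have := H ltac:(lra); nra.
have fl2 x : 1 - e <= x -> x <= 1 -> f x <= l2 x.
  move=> x0 xe; have := convex_on_chord cf (_ : 0 <= 1 - e) (lexx 1) x0 xe.
  rewrite -l2e /l2 => H; rewrite -(ler_pM2r e0).
  by have := H ltac:(lra); nra.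
have ge1 x : x <= e -> g x = l1 x.
  rewrite /g le_eqVlt => /predU1P[->|->//].
  by rewrite ltxx l1e ifF//; apply/negbTE; rewrite -leNgt; lra.
have ge2 x : 1 - e <= x -> g x = l2 x.
  move=> ex; rewrite /g ifF; last by apply/negbTE; rewrite -leNgt; lra.
  case: ifPn => //; rewrite -leNgt => xe.
  by have -> : x = 1 - e by lra.
have gm x : e <= x -> x <= 1 - e -> g x = f x.
  by move=> h1 h2; rewrite /g ltNge h1/= ltNge h2.
exists g; split.
- apply: support_convex => z.
  (* The support line at [z] is [l1] on the left, [l2] on the right, and in between the one given by
     the left slope, which lies between [s1] and [s2] and therefore stays below both outer
     chords. *)
  have [ze|ez] := leP z e; last have [ez'|ze] := leP (1 - e) z.
  + exists s1 => y; rewrite (ge1 _ ze).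
    have -> : l1 z + s1 * (y - z) = l1 y by rewrite /l1; ring.
    have [ye|ey] := leP y e; first by rewrite ge1.
    have [ye|ey'] := leP y (1 - e).
      by rewrite gm//; [apply: l1f; lra|lra].
    rewrite ge2//; last lra.
    have := l1f (1 - e); rewrite -l2e /l1 /l2 => H.
    have := H ltac:(lra) ltac:(lra).
    have : 0 <= (s2 - s1) * (y - (1 - e)) by rewrite mulr_ge0; lra.
    lra.
  + exists s2 => y; rewrite (ge2 _ ez').
    have -> : l2 z + s2 * (y - z) = l2 y by rewrite /l2; ring.
    have [ey|ye] := leP (1 - e) y; first by rewrite ge2.
    have [ey'|ye'] := leP e y.
      by rewrite gm//; [apply: l2f; lra|lra].
    rewrite ge1//; last lra.
    have := l2f e; rewrite -l1e /l1 /l2 => H.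
    have := H ltac:(lra) ltac:(lra).
    have : 0 <= (s2 - s1) * (e - y) by rewrite mulr_ge0; lra.
    lra.
  + exists (left_slope 0 f z) => y; rewrite [g z]gm; [|lra|lra].
    set m := left_slope 0 f z.
    have sup w : 0 <= w <= 1 -> f z + m * (w - z) <= f w.
      by apply: left_slope_support; rewrite //; lra.
    have s1m : s1 <= m.
      apply: (@le_trans _ _ (slope f 0 z)); last by apply: (slope_le_left_slope cf); lra.
      by apply: (slope_mono cf); lra.
    have ms2 : m <= s2.
      apply: (@le_trans _ _ (slope f z 1)); first by apply: (left_slope_le_slope cf); lra.
      by apply: (slope_mono cf); lra.
    have [ye|ey] := leP y e.
      rewrite ge1//; have := sup e ltac:(lra); rewrite -l1e /l1.
      have : 0 <= (m - s1) * (e - y) by rewrite mulr_ge0; lra.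
      lra.
    have [ey'|ye'] := leP (1 - e) y.
      rewrite ge2//; have := sup (1 - e) ltac:(lra); rewrite -l2e /l2.
      have : 0 <= (s2 - m) * (y - (1 - e)) by rewrite mulr_ge0; lra.
      lra.
    by rewrite gm; [apply: sup|..]; lra.
- by move=> x /andP[]; exact: gm.
- by rewrite ge1 /l1 ?mulr0 ?addr0// ltW.
- by rewrite ge2 /l2 ?subrr ?mulr0 ?addr0//; lra.
- move=> x /andP[x0 x1]; have [xe|ex] := leP x e; first by rewrite ge1// fl1.
  have [ex'|xe'] := leP (1 - e) x; first by rewrite ge2// fl2.
  by rewrite gm//; lra.
Qed.

(** Slopes between points of [0, 1] lie between the slopes over [-1, 0] and [1, 2]. *)
Lemma convex_lipschitz01 f : (forall a b, convex_on a b f) ->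
  exists2 L, 0 <= L & forall x y, 0 <= x <= 1 -> 0 <= y <= 1 -> `|f x - f y| <= L * `|x - y|.
Proof.
move=> cf; pose s0 := slope f (-1) 0; pose s1 := slope f 1 2.
exists (`|s0| + `|s1|) => [|x y]; first by rewrite addr_ge0.
wlog xy : x y / x <= y.
  move=> H hx hy; have [/H|/ltW/H] := leP x y; first exact.
  by rewrite distrC [`|x - y|]distrC; apply.
move=> /andP[x0 x1] /andP[y0 y1].
move: xy; rewrite [x <= y]le_eqVlt => /predU1P[->|xy].
  by rewrite !subrr normr0 mulr0.
rewrite [f y](@slopeE f x y) ?lt_eqF// opprD addrA subrr add0r normrN normrM.
rewrite [`|x - y|]distrC ler_wpM2r// ler_norml.
have h0 : s0 <= slope f x y by apply: (slope_mono (cf (-1) 2)); lra.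
have h1 : slope f x y <= s1 by apply: (slope_mono (cf (-1) 2)); lra.
have := ler_norm s1; have := ler_norm (- s0); rewrite normrN.
have := normr_ge0 s0; have := normr_ge0 s1; lra.
Qed.

(** By [convex_on_ub] the sublevel sets are intervals, also when [f] jumps at [a] or [b]. *)
Lemma convex_on_measurable a b f : convex_on a b f -> measurable_fun `[a, b] f.
Proof.
move=> cf; apply: (measurability _ (RGenOInfty.measurableE R)) => //.
move=> _ [_ [r ->] <-].
rewrite [X in measurable X](_ : _ = `[a, b] `\` ([set` `[a, b]] `&` [set x | f x <= r])).
  apply: measurableD => //; apply: is_interval_measurable.
  move=> x z [/= xab fx] [/= zab fz] y /andP[xy yz].
  move: xab zab; rewrite !in_itv/= => /andP[ax xb] /andP[az zb]; split => /=.
    by lra.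
  have xyz : x <= y <= z by rewrite xy.
  apply: le_trans (convex_on_ub (convex_on_subset ax zb cf) xyz) _.
  by rewrite ge_max fx.
apply/seteqP; split => x; rewrite /= !in_itv/= andbT.
  by case=> xab rf; split => // -[_]; rewrite leNgt rf.
by case=> xab /not_andP[//|/negP]; rewrite -ltNge.
Qed.

End convex_on.

(** * Strictness at 0: support lines and chords *)

Section strictness_at_0.
Context {R : realType} (phi : R -> R).
Hypothesis cphi : convex_on (-1) 1 phi.
Hypothesis sphi : strictly_convex_at0 `[-1, 1]%classic phi.
Hypothesis phi0 : phi 0 = 0.

(** If a line through the origin met phi on both sides of 0, the chord between the two contact
    points would pass through the origin, against strictness. The weight of [x] that produces 0 is
    [y / (y - x)]. *)
Lemma touch_one_sided (m x y : R) : -1 <= x <= 1 -> -1 <= y <= 1 -> x < 0 -> 0 < y ->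
  phi x = m * x -> phi y = m * y -> False.
Proof.
move=> hx hy x0 y0 ex ey.
have yx : 0 < y - x by lra.
have := sphi (t := y / (y - x)) (x := x) (y := y).
rewrite /= !in_itv/= phi0 ex ey => /(_ hx hy x0 y0).
rewrite divr_gt0// ltr_pdivrMr// mul1r ltrDl oppr_gt0 => /(_ isT x0).
have h : y / (y - x) * x + (1 - y / (y - x)) * y = 0 by field; rewrite gt_eqF.
move=> /(_ h).
have -> : y / (y - x) * (m * x) + (1 - y / (y - x)) * (m * y) =
  m * (y / (y - x) * x + (1 - y / (y - x)) * y) by ring.
by rewrite h mulr0 ltxx.
Qed.

Lemma chord_gt0 (a : R) : 0 < a < 1 -> 0 < a * phi (1 - a) + (1 - a) * phi (- a).
Proof.
move=> /andP[a0 a1]; have := sphi (x := - a) (y := 1 - a) (t := 1 - a).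
rewrite /= !in_itv/= phi0 subKr => H; rewrite addrC; apply: H; lra.
Qed.

(** At 0 the strictness is [chord_gt0]. Elsewhere [u - a] lies between 0 and one of the ends [-a],
    [1 - a]. There phi is below the chord from 0 to that end, which meets the long chord at the end
    and starts strictly below it at 0. *)
Lemma chord_strict (a u : R) : 0 < a < 1 -> 0 < u < 1 ->
  phi (u - a) < u * phi (1 - a) + (1 - u) * phi (- a).
Proof.
move=> ai ui; have c0 := chord_gt0 ai.
case/andP: ai => a0 a1; case/andP: ui => u0 u1.
have [ua|au|->] := ltgtP u a; last by rewrite subrr phi0.
- have h := convex_on_chord cphi (_ : -1 <= - a) (_ : 0 <= 1) (_ : - a <= u - a) (_ : u - a <= 0).
  have {h} := h ltac:(lra) ltac:(lra) ltac:(lra) ltac:(lra).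
  rewrite phi0 mul0r addr0 => h.
  have {c0} : 0 < u * (a * phi (1 - a) + (1 - a) * phi (- a)) by rewrite mulr_gt0.
  move: (phi (u - a)) (phi (1 - a)) (phi (- a)) h => p q r h c0.
  by rewrite -(ltr_pM2r a0); lra.
- have h := convex_on_chord cphi (_ : -1 <= 0) (_ : 1 - a <= 1) (_ : 0 <= u - a) (_ : u - a <= 1 - a).
  have {h} := h ltac:(lra) ltac:(lra) ltac:(lra) ltac:(lra).
  rewrite phi0 mul0r add0r subr0 => h.
  have {c0} : 0 < (1 - u) * (a * phi (1 - a) + (1 - a) * phi (- a)).
    by rewrite mulr_gt0// subr_gt0.
  move: (phi (u - a)) (phi (1 - a)) (phi (- a)) h => p q r h c0.
  rewrite -(ltr_pM2r (_ : 0 < 1 - a)); [lra|lra].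
Qed.

End strictness_at_0.

(** * Bounded measurable functions and their integrals *)

(** All integrands below are of this kind. Under a probability measure the class consists of
    integrable functions and is closed under the operations in use, so it replaces all integrability
    side conditions. *)
Definition bounded_measurable d (T : measurableType d) (R : realType) (f : T -> R) :=
  measurable_fun setT f /\ exists M : R, forall x, `|f x| <= M.

Section bounded_measurable.
Context d (T : measurableType d) (R : realType).
Implicit Types (f g : T -> R) (A : set T).

Lemma bounded_measurable_cst (c : R) : bounded_measurable (fun _ : T => c).
Proof. by split=> //; exists `|c|. Qed.

Lemma bounded_measurableD f g : bounded_measurable f -> bounded_measurable g ->
  bounded_measurable (fun x => f x + g x).
Proof.
move=> [mf [M fM]] [mg [N gN]]; split; first exact: measurable_funD.
by exists (M + N) => x; rewrite (le_trans (ler_normD _ _))// lerD.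
Qed.

Lemma bounded_measurableN f : bounded_measurable f ->
  bounded_measurable (fun x => - f x).
Proof.
move=> [mf [M fM]]; split; first exact: measurable_funN.
by exists M => x; rewrite normrN.
Qed.

Lemma bounded_measurableB f g : bounded_measurable f -> bounded_measurable g ->
  bounded_measurable (fun x => f x - g x).
Proof. by move=> hf hg; exact/bounded_measurableD/bounded_measurableN. Qed.

Lemma bounded_measurableM f g : bounded_measurable f -> bounded_measurable g ->
  bounded_measurable (fun x => f x * g x).
Proof.
move=> [mf [M fM]] [mg [N gN]]; split; first exact: measurable_funM.
by exists (M * N) => x; rewrite normrM ler_pM.
Qed.

Lemma bounded_measurable_indic A : measurable A -> bounded_measurable (\1_A : T -> R).
Proof.
move=> mA; split; first exact: measurable_indic.
by exists 1 => x; rewrite indicE; case: (_ \in _); rewrite ?normr1 ?normr0.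
Qed.

Lemma bounded_measurable_comp d' (T' : measurableType d') (X : T' -> T) f :
  measurable_fun setT X -> bounded_measurable f ->
  bounded_measurable (fun x => f (X x)).
Proof.
by move=> mX [mf [M fM]]; split; [exact: measurableT_comp|exists M].
Qed.

Lemma bounded_measurable_itv f a b : measurable_fun setT f ->
  (forall x, a <= f x <= b) -> bounded_measurable f.
Proof.
move=> mf fab; split => //; exists (`|a| + `|b|) => x.
have := fab x; have := ler_norm b; have := ler_norm (- a); rewrite normrN.
have := normr_ge0 a; have := normr_ge0 b.
by rewrite ler_norml; lra.
Qed.

Lemma bounded_measurable_convex (psi : R -> R) a b f : convex_on a b psi ->
  measurable_fun setT f -> (forall x, a <= f x <= b) ->
  bounded_measurable (fun x => psi (f x)).
Proof.
move=> cpsi mf fab; have [M psiM] := convex_on_bounded cpsi.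
split; last by exists M => x; exact: psiM.
apply: (measurable_comp _ _ (convex_on_measurable cpsi)) => //.
by move=> _ [x _ <-] /=; rewrite in_itv/=.
Qed.

End bounded_measurable.

Section expectation.
Context d (T : measurableType d) (R : realType) (P : probability T R).
Implicit Types (f g : T -> R) (A : set T).
Local Notation bm := bounded_measurable.

Lemma bounded_measurable_integrable f : bm f -> P.-integrable setT (EFin \o f).
Proof.
move=> [mf [M fM]]; apply: measurable_bounded_integrable => //.
  by rewrite [ltLHS]probability_setT ltry.
by exists M; split; rewrite ?num_real// => N MN x _; exact: le_trans (fM x) (ltW MN).
Qed.

Lemma expD f g : bm f -> bm g ->
  \int[P]_x (f x + g x) = \int[P]_x f x + \int[P]_x g x.
Proof. by move=> *; rewrite RintegralD//; exact: bounded_measurable_integrable. Qed.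

Lemma expB f g : bm f -> bm g ->
  \int[P]_x (f x - g x) = \int[P]_x f x - \int[P]_x g x.
Proof. by move=> *; rewrite RintegralB//; exact: bounded_measurable_integrable. Qed.

Lemma expZ f c : bm f -> \int[P]_x (c * f x) = c * \int[P]_x f x.
Proof. by move=> *; rewrite RintegralZl//; exact: bounded_measurable_integrable. Qed.

Lemma exp_cst c : \int[P]_x c = c.
Proof. by rewrite Rintegral_cst// [X in fine X]probability_setT mulr1. Qed.

Lemma exp_le f g : bm f -> bm g -> (forall x, f x <= g x) ->
  \int[P]_x f x <= \int[P]_x g x.
Proof.
by move=> *; apply: le_Rintegral => //; exact: bounded_measurable_integrable.
Qed.

Lemma exp_ge0 f : (forall x, 0 <= f x) -> 0 <= \int[P]_x f x.
Proof. by move=> f0; exact: Rintegral_ge0. Qed.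

Lemma exp_EFin f : bm f -> (\int[P]_x (f x)%:E = (\int[P]_x f x)%:E)%E.
Proof.
move=> bf; rewrite /Rintegral fineK//; apply: integrable_fin_num => //.
exact: bounded_measurable_integrable.
Qed.

Lemma exp_norm f : bm f -> `|\int[P]_x f x| <= \int[P]_x `|f x|.
Proof.
by move=> *; apply: le_normr_Rintegral => //; exact: bounded_measurable_integrable.
Qed.

Lemma exp_ae_eq f g : bm f -> bm g -> (\forall x \ae P, f x = g x) ->
  \int[P]_x f x = \int[P]_x g x.
Proof.
move=> [mf _] [mg _] fg; congr fine; apply: ae_eq_integral => //.
- exact/measurable_EFinP.
- exact/measurable_EFinP.
- by apply: filterS fg => x -> _.
Qed.

Lemma exp_ae_le f g : bm f -> bm g -> (\forall x \ae P, f x <= g x) ->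
  \int[P]_x f x <= \int[P]_x g x.
Proof.
move=> bf bg fg; pose h x := Num.min (f x) (g x).
have bh : bm h.
  case: (bf) (bg) => mf [M fM] [mg [N gN]]; split; first exact: measurable_minr.
  exists (M + N) => x; rewrite /h; have M0 := le_trans (normr_ge0 _) (fM x).
  have N0 := le_trans (normr_ge0 _) (gN x).
  case: (leP (f x) (g x)) => _; first by apply: le_trans (fM x) _; rewrite lerDl.
  by apply: le_trans (gN x) _; rewrite lerDr.
rewrite (@exp_ae_eq f h)//; first by apply: exp_le => // x; rewrite ge_min lexx orbT.
by apply: filterS fg => x; rewrite /h; case: (leP (f x) (g x)).
Qed.

Lemma exp_indic A : measurable A -> \int[P]_x \1_A x = fine (P A).
Proof. by move=> mA; rewrite /Rintegral integral_indic// setIT. Qed.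

Lemma exp_eq0 f : bm f -> (forall x, 0 <= f x) -> \int[P]_x f x = 0 ->
  \forall x \ae P, f x = 0.
Proof.
move=> bf f0 If; have /measurable_EFinP mf : measurable_fun setT f by case: bf.
have : (\int[P]_x `|(f x)%:E| = 0)%E.
  under eq_integral do rewrite gee0_abs ?lee_fin//.
  by rewrite exp_EFin// If.
move/(ae_eq_integral_abs P measurableT mf); apply: filterS => x /(_ I).
by move=> [].
Qed.

Lemma exp_sqr_eq0 f g : bm f -> bm g -> \int[P]_x (f x - g x) ^+ 2 = 0 ->
  \forall x \ae P, f x = g x.
Proof.
move=> bf bg /exp_eq0 h; have bfg := bounded_measurableB bf bg.
have := h (bounded_measurableM bfg bfg) (fun x => sqr_ge0 _).
by apply: filterS => x /eqP; rewrite sqrf_eq0 subr_eq0 => /eqP.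
Qed.

Lemma exp_le_eq f g : bm f -> bm g -> (forall x, f x <= g x) ->
  \int[P]_x f x = \int[P]_x g x -> \forall x \ae P, f x = g x.
Proof.
move=> bf bg fg fgE.
have gf0 x : 0 <= g x - f x by rewrite subr_ge0.
have := exp_eq0 (bounded_measurableB bg bf) gf0.
rewrite expB// fgE subrr => /(_ erefl).
by apply: filterS => x /eqP; rewrite subr_eq0 => /eqP.
Qed.


End expectation.

Section fubini.
Context d1 d2 (T1 : measurableType d1) (T2 : measurableType d2) (R : realType).
Context (P1 : probability T1 R) (P2 : probability T2 R).
Variable f : T1 * T2 -> R.
Hypothesis bf : bounded_measurable f.

Lemma bounded_measurable_section1 x : bounded_measurable (fun y => f (x, y)).
Proof. exact: (bounded_measurable_comp (pair1_measurable x) bf). Qed.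

Lemma bounded_measurable_section2 y : bounded_measurable (fun x => f (x, y)).
Proof. exact: (bounded_measurable_comp (pair2_measurable y) bf). Qed.

Let integrable_f : (P1 \x P2)%E.-integrable setT (EFin \o f).
Proof. exact: bounded_measurable_integrable. Qed.

Let Fy x : (\int[P2]_y (f (x, y))%:E = (\int[P2]_y f (x, y))%:E)%E.
Proof. by rewrite exp_EFin//; exact: bounded_measurable_section1. Qed.

Let Fx y : (\int[P1]_x (f (x, y))%:E = (\int[P1]_x f (x, y))%:E)%E.
Proof. by rewrite exp_EFin//; exact: bounded_measurable_section2. Qed.

Let exp_bound d (T : measurableType d) (P : probability T R) (g : T -> R) (M : R) :
  bounded_measurable g -> (forall x, `|g x| <= M) -> `|\int[P]_x g x| <= M.
Proof.
move=> bg gM; have Mg x : g x <= M by rewrite (le_trans (ler_norm _)).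
have MgN x : - M <= g x by rewrite lerNl (le_trans _ (gM x))// -normrN ler_norm.
rewrite ler_norml -{1}(exp_cst P (- M)) -{2}(exp_cst P M).
by apply/andP; split; apply: exp_le => //; exact: bounded_measurable_cst.
Qed.

Lemma bounded_measurable_exp1 : bounded_measurable (fun x => \int[P2]_y f (x, y)).
Proof.
split; last first.
  case: (bf) => _ [M fM]; exists M => x.
  by apply: exp_bound => //; exact: bounded_measurable_section1.
have /(_ _ _ _ _ _ P1 P2 _ integrable_f) := @measurable_fubini_F.
rewrite /fubini_F => h; apply/measurable_EFinP; move: h; congr (measurable_fun _ _).
by apply/funext => x /=; rewrite Fy.
Qed.

Lemma bounded_measurable_exp2 : bounded_measurable (fun y => \int[P1]_x f (x, y)).
Proof.
split; last first.
  case: (bf) => _ [M fM]; exists M => x.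
  by apply: exp_bound => //; exact: bounded_measurable_section2.
have /(_ _ _ _ _ _ P1 P2 _ integrable_f) := @measurable_fubini_G.
rewrite /fubini_G => h; apply/measurable_EFinP; move: h; congr (measurable_fun _ _).
by apply/funext => x /=; rewrite Fx.
Qed.

Lemma exp_product : \int[(P1 \x P2)%E]_z f z = \int[P1]_x \int[P2]_y f (x, y).
Proof.
apply: etrans (esym (congr1 fine (integral12_prod_meas1 integrable_f))) _.
by congr fine; apply: eq_integral => x _; rewrite /fubini_F/= Fy.
Qed.

Lemma exp_fubini : \int[P1]_x \int[P2]_y f (x, y) = \int[P2]_y \int[P1]_x f (x, y).
Proof.
rewrite -exp_product.
apply: etrans (esym (congr1 fine (integral21_prod_meas1 integrable_f))) _.
by congr fine; apply: eq_integral => x _; rewrite /fubini_G/= Fx.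
Qed.


End fubini.

Section distribution.
Context d d' (T : measurableType d) (T' : measurableType d') (R : realType).
Context (P : probability T R).

Lemma exp_distribution (X : {RV P >-> T'}) (f : T' -> R) : bounded_measurable f ->
  \int[distribution P X]_x f x = \int[P]_w f (X w).
Proof.
move=> bf; congr fine; apply: integral_distribution.
  by apply/measurable_EFinP; case: bf.
apply: (@bounded_measurable_integrable _ _ _ P (f \o X)).
exact: bounded_measurable_comp.
Qed.

End distribution.

(** * From generating sets to bounded test functions *)

Section pi_system.
Context d1 d2 d' (T1 : measurableType d1) (T2 : measurableType d2) (T' : measurableType d').
Context (R : realType) (P1 : probability T1 R) (P2 : probability T2 R).
Context (Z1 : T1 -> T') (Z2 : T2 -> T').
Hypotheses (mZ1 : measurable_fun setT Z1) (mZ2 : measurable_fun setT Z2).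
Context (f : T1 -> R) (g : T2 -> R).
Hypotheses (bf : bounded_measurable f) (bg : bounded_measurable g).
Hypotheses (f0 : forall x, 0 <= f x) (g0 : forall x, 0 <= g x).

Let indM d (T : measurableType d) (P : probability T R) (Z : T -> T') h A :
  \int[P]_x (\1_A (Z x) * h x) = fine (\int[P]_(x in Z @^-1` A) (h x)%:E)%E.
Proof.
rewrite integral_mkcond; congr fine; apply: eq_integral => x _.
rewrite patchE indicE.
have -> : (x \in Z @^-1` A) = (Z x \in A) by apply/idP/idP; rewrite !inE.
by case: (Z x \in A); rewrite ?mul1r ?mul0r.
Qed.

(** Uniqueness of finite measures, for the images of [f P1] under [Z1] and of [g P2] under [Z2]. Two
    spaces are allowed because the quantile transform compares the law of [Y] with a uniform
    variable; conditional probabilities take both spaces equal. *)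
Lemma exp_pi_system_eq (G : set (set T')) : @measurable _ T' = <<s G >> ->
  setI_closed G -> \int[P1]_x f x = \int[P2]_x g x ->
  (forall A, G A -> \int[P1]_x (\1_A (Z1 x) * f x) = \int[P2]_x (\1_A (Z2 x) * g x)) ->
  forall A, measurable A ->
    \int[P1]_x (\1_A (Z1 x) * f x) = \int[P2]_x (\1_A (Z2 x) * g x).
Proof.
move=> GE GI fgT fgG A mA; have sA : <<s G >> A by rewrite -GE.
have indT d (T : measurableType d) (P : probability T R) (Z : T -> T') h :
    \int[P]_x (\1_setT (Z x) * h x) = \int[P]_x h x.
  by congr fine; apply: eq_integral => x _; rewrite indicT mul1r.
have bind d (T : measurableType d) (P : probability T R) (Z : T -> T') h S :
    measurable_fun setT Z -> measurable S -> bounded_measurable h ->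
    bounded_measurable (fun x => \1_S (Z x) * h x).
  move=> mZ mS bh; apply: bounded_measurableM => //.
  exact/(bounded_measurable_comp mZ)/bounded_measurable_indic.
apply: (dynkin_induction GE GI _ fgG _ _ sA); first by rewrite !indT.
- have indC d (T : measurableType d) (P : probability T R) (Z : T -> T') h S :
      measurable_fun setT Z -> measurable S -> bounded_measurable h ->
      \int[P]_x (\1_(~` S) (Z x) * h x) = \int[P]_x h x - \int[P]_x (\1_S (Z x) * h x).
    move=> mZ mS bh; rewrite -expB//; last exact: bind.
    congr fine; apply: eq_integral => x _; rewrite !indicE in_setC.
    by case: (_ \in _) => /=; rewrite ?mul1r ?mul0r ?subrr ?subr0.
  by move=> S mS SE; rewrite !indC// fgT SE.
- move=> F mF tF FE; rewrite !indM; congr fine.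
  have cup d (T : measurableType d) (P : probability T R) (Z : T -> T') h :
      measurable_fun setT Z -> bounded_measurable h -> (forall x, 0 <= h x) ->
      (\int[P]_(x in Z @^-1` (\bigcup_k F k)) (h x)%:E =
       \sum_(i <oo) (\int[P]_x (\1_(F i) (Z x) * h x))%:E)%E.
    move=> mZ bh h0; rewrite preimage_bigcup ge0_integral_bigcup//.
    - apply: eq_eseriesr => i _; rewrite indM fineK//.
      apply: integrable_fin_num; first by rewrite -[X in measurable X]setTI; exact: mZ.
      apply: (integrableS measurableT) => //.
        by rewrite -[X in measurable X]setTI; exact: mZ.
      exact: bounded_measurable_integrable.
    - by move=> k; rewrite -[X in measurable X]setTI; exact: mZ.
    - by apply: measurable_funTS; apply/measurable_EFinP; case: bh.
    - by move=> x _; rewrite lee_fin.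
    - apply/trivIsetP => i j _ _ ij; rewrite -preimage_setI.
      by move/trivIsetP: tF => ->//; rewrite preimage_set0.
  by rewrite !cup//; apply: eq_eseriesr => i _; rewrite FE.
Qed.

End pi_system.

Section pull_out.
Context d1 d2 d' (T1 : measurableType d1) (T2 : measurableType d2) (T' : measurableType d').
Context (R : realType) (P1 : probability T1 R) (P2 : probability T2 R).
Context (Z1 : T1 -> T') (Z2 : T2 -> T').
Hypotheses (mZ1 : measurable_fun setT Z1) (mZ2 : measurable_fun setT Z2).
Context (f : T1 -> R) (g : T2 -> R).
Hypotheses (bf : bounded_measurable f) (bg : bounded_measurable g).
Hypothesis fg : forall A, measurable A ->
  \int[P1]_x (\1_A (Z1 x) * f x) = \int[P2]_x (\1_A (Z2 x) * g x).

(** The sum counts the integers 1, ..., n up to [x], so it is the integer part of [x]. *)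
Let floor_sum (n : nat) (x : R) : 0 <= x <= n%:R ->
  x - 1 <= \sum_(k < n) (k.+1%:R <= x)%R%:R <= x.
Proof.
elim: n x => [|n IHn] x /andP[x0 xn].
  by rewrite big_ord0 x0 andbT subr_le0 (le_trans xn).
rewrite big_ord_recl/=; have [x1|x1] := leP 1 x.
  have -> : \sum_(k < n) ((bump 0 k).+1%:R <= x)%R%:R =
            \sum_(k < n) (k.+1%:R <= x - 1)%R%:R :> R.
    by apply: eq_bigr => k _; rewrite lerBrDr natr1.
  have /IHn : 0 <= x - 1 <= n%:R by rewrite subr_ge0 x1/= lerBlDr natr1.
  rewrite -[true%:R]/(1%:R : R); lra.
rewrite big1 ?addr0; first by rewrite mulr0n x0 andbT subr_le0 ltW.
move=> i _; rewrite (_ : (_ <= x) = false)//; apply/negbTE; rewrite -ltNge.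
by rewrite (lt_le_trans x1)// ler1n.
Qed.

(** [n h] is within 1 of the sum of indicators [s n n], to which [fg] applies. Hence [n |D|] is at
    most E |f| + E |g| for every [n], where [D] is the difference of the two sides. *)
Let pull_out01 (h : T' -> R) : measurable_fun setT h -> (forall x, 0 <= h x <= 1) ->
  \int[P1]_x (h (Z1 x) * f x) = \int[P2]_x (h (Z2 x) * g x).
Proof.
move=> mh h01; have bh := bounded_measurable_itv mh h01.
pose A (n k : nat) := [set z | k.+1%:R <= n%:R * h z].
have mA n k : measurable (A n k).
  rewrite -[X in measurable X]setTI; apply: measurable_fun_ler => //.
  exact: measurable_funM.
pose s n m z : R := \sum_(k < m) \1_(A n k) z.
have sE n z : n%:R * h z - 1 <= s n n z <= n%:R * h z.
  have /floor_sum : 0 <= n%:R * h z <= n%:R.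
    by case/andP: (h01 z) => ? ?; rewrite mulr_ge0//= ler_piMr.
  rewrite (_ : s n n z = \sum_(k < n) (k.+1%:R <= n%:R * h z)%R%:R)//.
  by apply: eq_bigr => k _; rewrite indicE mem_setE.
have bs n m : bounded_measurable (s n m).
  elim: m => [|m IHm].
    rewrite (_ : s n 0%N = cst 0); first exact: bounded_measurable_cst.
    by apply/funext => z; rewrite /s big_ord0.
  rewrite (_ : s n m.+1 = fun z => s n m z + \1_(A n m) z).
    exact/bounded_measurableD/bounded_measurable_indic.
  by apply/funext => z; rewrite /s big_ord_recr.
have bsZ d (T : measurableType d) (Z : T -> T') (u : T' -> R) (q : T -> R) : measurable_fun setT Z ->
    bounded_measurable q -> bounded_measurable u ->
    bounded_measurable (fun x => u (Z x) * q x).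
  by move=> mZ bq bu; apply/bounded_measurableM => //; exact: bounded_measurable_comp.
have sfg n m : \int[P1]_x (s n m (Z1 x) * f x) = \int[P2]_x (s n m (Z2 x) * g x).
  have sS d (T : measurableType d) (P : probability T R) (Z : T -> T') (q : T -> R) m' :
      measurable_fun setT Z -> bounded_measurable q ->
      \int[P]_x (s n m'.+1 (Z x) * q x) =
      \int[P]_x (s n m' (Z x) * q x) + \int[P]_x (\1_(A n m') (Z x) * q x).
    move=> mZ bq; rewrite -expD; [|exact: bsZ|by apply: bsZ => //; exact: bounded_measurable_indic].
    by apply: eq_Rintegral => x _; rewrite -mulrDl /s big_ord_recr.
  have s0 d (T : measurableType d) (P : probability T R) (Z : T -> T') (q : T -> R) :
      \int[P]_x (s n 0%N (Z x) * q x) = 0.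
    rewrite -[RHS](exp_cst P); apply: eq_Rintegral => x _.
    by rewrite /s big_ord0 mul0r.
  by elim: m => [|m IHm]; [rewrite !s0|rewrite !sS// IHm fg].
have approx d (T : measurableType d) (P : probability T R) (Z : T -> T') (q : T -> R) n :
    measurable_fun setT Z -> bounded_measurable q ->
    `|n%:R * \int[P]_x (h (Z x) * q x) - \int[P]_x (s n n (Z x) * q x)| <=
    \int[P]_x `|q x|.
  move=> mZ bq; rewrite -expZ; last exact: bsZ.
  rewrite -expB; [|exact/bounded_measurableM/bsZ/bh/bq/mZ/bounded_measurable_cst|exact: bsZ].
  have bd := bounded_measurableB (bounded_measurableM (bounded_measurable_cst T n%:R)
     (bsZ _ _ _ _ _ mZ bq bh)) (bsZ _ _ _ _ _ mZ bq (bs n n)).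
  have bN d0 (T0 : measurableType d0) (u : T0 -> R) : bounded_measurable u ->
      bounded_measurable (fun x => `|u x|).
    move=> [mu [M uM]]; split; first exact: measurableT_comp.
    by exists M => x; rewrite normr_id.
  apply: le_trans (exp_norm P bd) _; apply: exp_le; [exact: bN|exact: bN|move=> x].
  rewrite mulrA -mulrBl normrM ler_piMl//; have := sE n (Z x).
  by rewrite ler_norml; lra.
pose D := \int[P1]_x (h (Z1 x) * f x) - \int[P2]_x (h (Z2 x) * g x).
pose C := \int[P1]_x `|f x| + \int[P2]_x `|g x|.
have DC n : n%:R * `|D| <= C.
  have := approx _ _ P1 _ _ n mZ1 bf; have := approx _ _ P2 _ _ n mZ2 bg.
  rewrite sfg distrC => h2 h1; have := lerD h1 h2.
  move/(le_trans (ler_normD _ _)); rewrite addrA subrK -mulrBr normrM.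
  by rewrite ger0_norm.
apply/eqP; rewrite -subr_eq0 -/D -normr_eq0; apply: contraT => D0.
have {}D0 : 0 < `|D| by rewrite lt0r D0 normr_ge0.
have := DC (Num.truncn (C / `|D|)).+1; rewrite leNgt -ltr_pdivrMr//.
by rewrite truncnS_gt.
Qed.

Lemma pull_out (h : T' -> R) : bounded_measurable h ->
  \int[P1]_x (h (Z1 x) * f x) = \int[P2]_x (h (Z2 x) * g x).
Proof.
(* Rescaling by [N] moves the values of [h] into [0, 1]; the [+ 1] keeps the divisor positive. The
   constant left over is integrated as the indicator of [setT], so that [fg] covers it. *)
move=> [mh [M hM]]; pose N := `|M| + 1.
have N0 : 0 < N by rewrite ltr_pwDr.
pose u z := (h z + N) / (2 * N).
have mu : measurable_fun setT u by apply: measurable_funM => //; exact: measurable_funD.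
have u01 z : 0 <= u z <= 1.
  have := hM z; rewrite ler_norml => /andP[h1 h2]; have := ler_norm M => M1.
  rewrite /u; apply/andP; split; first by apply: divr_ge0; rewrite /N; lra.
  by rewrite ler_pdivrMr /N; lra.
have bZ d (T : measurableType d) (Z : T -> T') (v : T' -> R) (q : T -> R) : measurable_fun setT Z ->
    bounded_measurable q -> bounded_measurable v ->
    bounded_measurable (fun x => v (Z x) * q x).
  by move=> mZ bq bu; apply/bounded_measurableM => //; exact: bounded_measurable_comp.
have hu d (T : measurableType d) (P : probability T R) (Z : T -> T') (q : T -> R) :
    measurable_fun setT Z -> bounded_measurable q ->
    \int[P]_x (h (Z x) * q x) =
    2 * N * \int[P]_x (u (Z x) * q x) - N * \int[P]_x (\1_setT (Z x) * q x).
  move=> mZ bq; have b1 : bounded_measurable (fun x => u (Z x) * q x).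
    by apply: bZ => //; exact: bounded_measurable_itv u01.
  have b2 : bounded_measurable (fun x => \1_setT (Z x) * q x).
    by apply: bZ => //; exact: bounded_measurable_indic.
  rewrite -!expZ// -expB; first last.
  - by apply: bounded_measurableM => //; exact: bounded_measurable_cst.
  - by apply: bounded_measurableM => //; exact: bounded_measurable_cst.
  apply: eq_Rintegral => x _; rewrite indicT /u/=; field.
  by rewrite gt_eqF.
by rewrite !hu// (pull_out01 mu u01) fg.
Qed.


End pull_out.

(** * Conditional probabilities and distribution functions *)

Lemma ae_forall_countable d (T : measurableType d) (R : realType)
    (mu : {measure set T -> \bar R}) (I : countType) (Q : I -> T -> Prop) :
  (forall i, \forall x \ae mu, Q i x) -> \forall x \ae mu, forall i, Q i x.
Proof.
move=> aeQ; pose Q' n x := if @unpickle I n is Some i then Q i x else True.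
have : \forall x \ae mu, forall n, Q' n x.
  apply/ae_foralln => n; rewrite /Q'; case: unpickle => [i|]; first exact: aeQ.
  exact: aeW.
by apply: filterS => x Q'x i; have := Q' (pickle i) x; have := Q'x (pickle i);
   rewrite /Q' pickleK.
Qed.

Lemma measurable_fun_lt_rays d (T : measurableType d) (R : realType) (f : T -> R) :
  (forall a, measurable [set x | f x < a]) -> measurable_fun setT f.
Proof.
move=> mf; apply: (measurability _ (RGenInftyO.measurableE R)) => //.
move=> _ [_ [a ->] <-]; rewrite setTI.
rewrite (_ : _ @^-1` _ = [set x | f x < a]); first exact: mf.
by apply/seteqP; split => x; rewrite /= in_itv.
Qed.

Section cond_prob_existence.
Context d d' (T : measurableType d) (T' : measurableType d') (R : realType).
Context (P : probability T R) (X : {RV P >-> T'}).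

(** The proof [mE] is an argument so that the measure structure, which depends on it, can be
    attached to this constant. *)
Definition joint_content (E : set T) (mE : measurable E) (B : set T') : \bar R :=
  P (E `&` X @^-1` B).

Section joint_measure.
Variables (E : set T) (mE : measurable E).
Local Notation nu := (joint_content mE).

Let nu0 : nu set0 = 0%E.
Proof. by rewrite /joint_content preimage_set0 setI0 measure0. Qed.

Let nu_ge0 B : (0 <= nu B)%E. Proof. exact: measure_ge0. Qed.

Let nu_sigma_additive : semi_sigma_additive nu.
Proof.
move=> F mF tF mUF; rewrite /joint_content preimage_bigcup setI_bigcupr.
apply: measure_semi_sigma_additive.
- by move=> n; apply: measurableI => //; exact: measurable_funPTI.
- apply/trivIsetP => i j _ _ ij; rewrite setIACA setIid -preimage_setI.
  by move/trivIsetP : tF => ->//; rewrite preimage_set0 setI0.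
- rewrite -setI_bigcupr -preimage_bigcup; apply: measurableI => //.
  exact: measurable_funPTI.
Qed.

HB.instance Definition _ := isMeasure.Build _ _ _ nu nu0 nu_ge0 nu_sigma_additive.

Let nu_fin : fin_num_fun nu.
Proof.
move=> B mB; apply: fin_num_measure; apply: measurableI => //.
exact: measurable_funPTI.
Qed.

HB.instance Definition _ := Measure_isFinite.Build _ _ _ nu nu_fin.

End joint_measure.

Lemma cond_prob_exists E : measurable E -> exists g, is_cond_prob X E g.
Proof.
move=> mE; pose nu := joint_content mE; pose mu := distribution P X.
have numu B : measurable B -> (nu B <= mu B)%E.
  move=> mB; apply: le_measure; rewrite ?inE.
  - by apply: measurableI => //; exact: measurable_funPTI.
  - exact: measurable_funPTI.
  - by move=> x [].
have dom : nu `<< mu.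
  apply/null_content_dominatesP => B mB muB.
  by apply/eqP; rewrite -measure_le0 -muB numu.
pose f := Radon_Nikodym_SigmaFinite.f nu mu.
have f0 x : (0 <= f x)%E by exact: Radon_Nikodym_SigmaFinite.f_ge0.
have ffin x : f x \is a fin_num by exact: Radon_Nikodym_SigmaFinite.f_fin_num.
have intf : mu.-integrable setT f by exact: Radon_Nikodym_SigmaFinite.f_integrable.
have nuE B : measurable B -> nu B = (\int[mu]_(x in B) f x)%E.
  exact: Radon_Nikodym_SigmaFinite.f_integral.
have mf : measurable_fun setT f by exact: measurable_int intf.
(* The density [f] is determined only almost everywhere; truncation bounds it by 1 at every point.
   It changes [f] on a null set only: for [B] inside [A], the integral of [f] over [B] is
   [nu B <= mu B], while [f > 1] there. *)
pose g x := Num.min 1 (fine (f x)).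
have mg : measurable_fun setT g.
  by apply: measurable_minr => //; exact: measurableT_comp.
pose A := [set x | (1 < f x)%E].
have mA : measurable A.
  by rewrite -[A]setTI; exact: emeasurable_fun_o_infty.
have fA : ae_eq mu A f (cst 1%E).
  apply: integral_ae_eq => //; first exact: integrableS intf.
  move=> B BA mB; apply/eqP; rewrite eq_le; apply/andP; split.
    by rewrite -nuE// (le_trans (numu _ mB))// integral_cst// mul1e.
  apply: ge0_le_integral => //; first exact: measurable_funTS.
  by move=> x /BA/ltW.
have fg : ae_eq mu setT (EFin \o g) f.
  apply: filterS fA => x fA _; rewrite /g/= EFin_min fineK//.
  have [f1|f1] := leP (f x) 1%E; first by [].
  by have := fA f1; move: f1 => /[swap] ->; rewrite ltxx.
exists g; split => //.
  by move=> x; rewrite /g le_min ler01 fine_ge0//= ge_min lexx.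
move=> B mB; rewrite -[RHS]/(nu B) nuE//; apply: ae_eq_integral => //.
- by apply: measurable_funTS; exact/measurable_EFinP.
- exact: measurable_funTS.
- by apply: filterS fg => x /(_ I) + _.
Qed.

Lemma cond_probP E : measurable E -> is_cond_prob X E (cond_prob X E).
Proof. by move=> /cond_prob_exists; exact: getPex. Qed.



Lemma exp_indicI (E : set T) (B : set T') : measurable E -> measurable B ->
  \int[P]_w (\1_B (X w) * \1_E w) = fine (P (E `&` X @^-1` B)).
Proof.
move=> mE mB; rewrite -exp_indic; last first.
  by apply: measurableI => //; exact: measurable_funPTI.
apply: eq_Rintegral => w _; rewrite indicI mulrC /= !indicE.
by rewrite (_ : (w \in X @^-1` B) = (X w \in B))//; apply/idP/idP; rewrite !inE.
Qed.

(** The defining identity moved from the law of [X] to the sample space, in the shape that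
    [pull_out] consumes. *)
Lemma is_cond_probP E (g : T' -> R) : measurable E -> measurable_fun setT g ->
  (forall x, 0 <= g x <= 1) ->
  is_cond_prob X E g <-> forall B, measurable B ->
    \int[P]_w (\1_B (X w) * \1_E w) = \int[P]_w (\1_B (X w) * g (X w)).
Proof.
move=> mE mg g01; have bg := bounded_measurable_itv mg g01.
have gE B : measurable B -> (\int[distribution P X]_(x in B) (g x)%:E)%E =
    (\int[P]_w (\1_B (X w) * g (X w)))%:E.
  move=> mB; have b1 : bounded_measurable (fun x => \1_B x * g x).
    exact/bounded_measurableM/bg/bounded_measurable_indic.
  have <- : \int[distribution P X]_x (\1_B x * g x) = \int[P]_w (\1_B (X w) * g (X w)).
    exact: exp_distribution.
  rewrite -exp_EFin// integral_mkcond.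
  apply: eq_integral => x _; rewrite patchE indicE.
  by case: (x \in B); rewrite ?mul1r ?mul0r.
have fP B : measurable B -> P (E `&` X @^-1` B) =
    (\int[P]_w (\1_B (X w) * \1_E w))%:E.
  move=> mB; rewrite exp_indicI// fineK// fin_num_measure//.
  by apply: measurableI => //; exact: measurable_funPTI.
split=> [[_ _ h] B mB|h]; last by split=> // B mB; rewrite gE// fP// h.
by have := h B mB; rewrite gE// fP// => -[].
Qed.

Lemma cond_prob_exp E (g : T' -> R) : measurable E -> is_cond_prob X E g ->
  forall h : T' -> R, bounded_measurable h ->
  \int[P]_w (h (X w) * \1_E w) = \int[P]_w (h (X w) * g (X w)).
Proof.
move=> mE gP h bh; have [mg g01 _] := gP.
apply: pull_out => //.
- exact: bounded_measurable_indic.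
- exact/(bounded_measurable_comp (measurable_funPT X))/bounded_measurable_itv/g01.
- by move/is_cond_probP: gP; apply.
Qed.

(** Tested on the set [A] where the inequality fails: there [g - g'] is positive, but its integral
    is P (E, X in A) - P (E', X in A), which is at most 0. *)
Lemma cond_prob_mono E E' g g' : measurable E -> measurable E' -> E `<=` E' ->
  is_cond_prob X E g -> is_cond_prob X E' g' ->
  \forall x \ae distribution P X, g x <= g' x.
Proof.
move=> mE mE' EE' gP g'P; have [mg g01 _] := gP; have [mg' g'01 _] := g'P.
have bg := bounded_measurable_itv mg g01.
have bg' := bounded_measurable_itv mg' g'01.
pose A := [set x | g' x < g x].
have mA : measurable A by rewrite -[A]setTI; exact: measurable_fun_ltr.
have b1 := bounded_measurable_indic R mA.
have bd := bounded_measurableB bg bg'.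
have b2 := bounded_measurableM b1 bd.
have h0 x : 0 <= \1_A x * (g x - g' x).
  rewrite indicE; have [/set_mem/= gx|] := boolP (x \in A).
    by rewrite mul1r subr_ge0 ltW.
  by rewrite mul0r.
have : \int[distribution P X]_x (\1_A x * (g x - g' x)) = 0.
  apply/eqP; rewrite eq_le exp_ge0// andbT exp_distribution//.
  under eq_Rintegral do rewrite mulrBr.
  rewrite expB; last 2 first.
  - exact: (bounded_measurable_comp (measurable_funPT X) (bounded_measurableM b1 bg)).
  - exact: (bounded_measurable_comp (measurable_funPT X) (bounded_measurableM b1 bg')).
  rewrite -(cond_prob_exp mE gP)// -(cond_prob_exp mE' g'P)// subr_le0.
  have b3 := bounded_measurable_comp (measurable_funPT X) b1.
  apply: exp_le.
  - exact/(bounded_measurableM b3)/bounded_measurable_indic.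
  - exact/(bounded_measurableM b3)/bounded_measurable_indic.
  - move=> w; rewrite ler_wpM2l// !indicE ler_nat.
    case: (boolP (w \in E)) => // /set_mem/EE' wE'.
    by rewrite mem_set.
move/(exp_eq0 b2 h0); apply: filterS => x.
have [//|gx] := leP (g x) (g' x).
rewrite indicE mem_set// mul1r => /eqP; rewrite subr_eq0 => /eqP gE.
by rewrite gE ltxx in gx.
Qed.

Lemma cond_prob_unique E g g' : measurable E ->
  is_cond_prob X E g -> is_cond_prob X E g' ->
  \forall x \ae distribution P X, g x = g' x.
Proof.
move=> mE gP g'P; have h1 := cond_prob_mono mE mE (@subset_refl _ E) gP g'P.
have := cond_prob_mono mE mE (@subset_refl _ E) g'P gP.
by apply: filterS2 h1 => x ? ?; apply/le_anti/andP.
Qed.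

Lemma ae_distribution (Q : T' -> Prop) : (\forall x \ae distribution P X, Q x) ->
  \forall w \ae P, Q (X w).
Proof.
move=> [N [mN N0 QN]]; exists (X @^-1` N); split => //.
  exact: measurable_funPTI.
by move=> w /= nQ; apply: QN.
Qed.

End cond_prob_existence.

(** * Distribution functions and right-continuous envelopes *)

Section is_cdf.
Context {R : realType}.
Implicit Types (G : R -> R).

Lemma is_cdf_right G x (e : R) : is_cdf G -> 0 < e -> exists2 z, x < z & G z < G x + e.
Proof.
move=> [_ rG _ _] e0.
have near_lt : \forall z \near x^'+, G z < G x + e.
  have /cvgrPdist_lt /(_ e e0) := rG x; apply: filterS => z.
  by rewrite ltr_norml; lra.
have : \forall z \near x^'+, x < z /\ G z < G x + e.
  by apply: filterS2 (nbhs_right_gt x) near_lt.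
by move/filter_ex => [z []]; exists z.
Qed.

Lemma is_cdf_left G (e : R) : is_cdf G -> 0 < e -> exists z, G z < e.
Proof.
move=> [_ _ /cvgrPdist_lt G0 _] e0; have := G0 e e0.
by move/filter_ex => [z]; rewrite sub0r normrN => ze; exists z;
   rewrite (le_lt_trans (ler_norm _)).
Qed.

Lemma is_cdf_top G (e : R) : is_cdf G -> 0 < e -> exists z, 1 - e < G z.
Proof.
move=> [_ _ _ /cvgrPdist_lt G1] e0; have := G1 e e0.
by move/filter_ex => [z]; rewrite ltr_norml => ze; exists z; lra.
Qed.

Lemma is_cdf_01 G x : is_cdf G -> 0 <= G x <= 1.
Proof.
move=> [nG _ /cvgrPdist_lt G0 /cvgrPdist_lt G1].
rewrite leNgt [G x <= 1]leNgt; apply/andP; split; apply/negP => xlt.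
- have e0 : 0 < - G x by rewrite oppr_gt0.
  have /filter_ex [z [zx]] : \forall z \near -oo, z <= x /\ `|0 - G z| < - G x.
    by near=> z; split; near: z; [exact: (nbhs_ninfty_le (num_real x))|exact: G0].
  by rewrite sub0r normrN ltr_norml opprK ltNge (nG _ _ zx).
- have e0 : 0 < G x - 1 by rewrite subr_gt0.
  have /filter_ex [z [zx]] : \forall z \near +oo, x <= z /\ `|1 - G z| < G x - 1.
    by near=> z; split; near: z; [exact: (nbhs_pinfty_ge (num_real x))|exact: G1].
  by have := nG _ _ zx; rewrite ltr_norml; lra.
Unshelve. all: by end_near. Qed.

(** By monotonicity a single witness for each [e] controls a whole neighbourhood of the limit
    point. *)
Lemma is_cdf_criterion G : {homo G : x y / x <= y} -> (forall x, 0 <= G x <= 1) ->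
  (forall x e : R, 0 < e -> exists2 z, x < z & G z < G x + e) ->
  (forall e : R, 0 < e -> exists z, G z < e) ->
  (forall e : R, 0 < e -> exists z, 1 - e < G z) -> is_cdf G.
Proof.
move=> nG G01 rG G0 G1; split => //.
- move=> x; apply/cvgrPdist_lt => e e0; have [z xz Gz] := rG x e e0.
  near=> t; have xt : x < t by near: t; exact: nbhs_right_gt.
  have tz : t < z by near: t; exact: nbhs_right_lt.
  by have := nG _ _ (ltW xt); have := nG _ _ (ltW tz); rewrite ltr_norml; lra.
- apply/cvgrPdist_lt => e e0; have [z Gz] := G0 e e0.
  near=> t; have tz : t <= z by near: t; apply: nbhs_ninfty_le; exact: num_real.
  by have := nG _ _ tz; have := G01 t; rewrite ltr_norml; lra.
- apply/cvgrPdist_lt => e e0; have [z Gz] := G1 e e0.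
  near=> t; have tz : z <= t by near: t; apply: nbhs_pinfty_ge; exact: num_real.
  by have := nG _ _ tz; have := G01 t; rewrite ltr_norml; lra.
Unshelve. all: by end_near. Qed.

Section rational_envelope.
Variable g : rat -> R.
Hypotheses (ng : forall r s : rat, r <= s -> g r <= g s) (g01 : forall r, 0 <= g r <= 1).
Hypotheses (g0 : forall e : R, 0 < e -> exists r, g r < e)
           (g1 : forall e : R, 0 < e -> exists r, 1 - e < g r).

(** The strict inequality [y < ratr r] makes the envelope right-continuous; at a rational point it
    may differ from [g]. *)
Definition rat_envelope (y : R) := inf [set g r | r in [set r : rat | y < (ratr r : R)]].

Let has_inf_envelope y : has_inf [set g r | r in [set r : rat | y < (ratr r : R)]].
Proof.
split; last by exists 0 => _ [r _ <-]; case/andP: (g01 r).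
have /rat_in_itvoo[r /itvP ry] : y < y + 1 by rewrite ltrDl.
by exists (g r), r => //=; rewrite ry.
Qed.

Lemma rat_envelope_lt y a : (rat_envelope y < a) <-> exists2 r, y < ratr r & g r < a.
Proof.
split=> [/inf_lt|[r yr ga]].
  by move=> /(_ (has_inf_envelope y).1)[_ [r /= yr <-] ga]; exists r.
apply: le_lt_trans ga; apply: ge_inf; first exact: (has_inf_envelope y).2.
by exists r.
Qed.

Lemma rat_envelope_le y r : y < ratr r -> rat_envelope y <= g r.
Proof.
move=> yr; apply: ge_inf; first exact: (has_inf_envelope y).2.
by exists r.
Qed.

Lemma rat_envelope_ge y a : (forall r, y < ratr r -> a <= g r) -> a <= rat_envelope y.
Proof.
move=> ag; apply: lb_le_inf; first exact: (has_inf_envelope y).1.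
by move=> _ [r /= yr <-]; exact: ag.
Qed.

Lemma rat_envelope_is_cdf : is_cdf rat_envelope.
Proof.
have e01 y : 0 <= rat_envelope y <= 1.
  apply/andP; split; first by apply: rat_envelope_ge => r _; case/andP: (g01 r).
  have [_ [r /= yr _]] := (has_inf_envelope y).1.
  by apply: le_trans (rat_envelope_le yr) _; case/andP: (g01 r).
apply: is_cdf_criterion => //.
- move=> x y xy; apply: rat_envelope_ge => r yr.
  exact/rat_envelope_le/(le_lt_trans xy).
- move=> x e e0; have /rat_envelope_lt[r xr gr] : rat_envelope x < rat_envelope x + e.
    by rewrite ltrDl.
  have /rat_in_itvoo[s /itvP sr] := xr; exists (ratr s); first by rewrite sr.
  by apply: le_lt_trans gr; apply: rat_envelope_le; rewrite sr.
- move=> e /g0[r gr]; exists (ratr r - 1); apply: le_lt_trans gr.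
  by apply: rat_envelope_le; rewrite ltrBlDr ltrDl.
- move=> e /g1[r gr]; exists (ratr r); apply: lt_le_trans gr _.
  by apply: rat_envelope_ge => s rs; apply: ng; rewrite -(ler_rat R) ltW.
Qed.

End rational_envelope.
End is_cdf.

Section Fcdf.
Context d (T : measurableType d) (R : realType) (P : probability T R).
Variable Y : {RV P >-> R}.

Lemma measurable_le y : measurable [set w | Y w <= y].
Proof. by rewrite -[X in measurable X]setTI; exact: measurable_fun_ler. Qed.

Lemma FcdfE y : Fcdf Y y = fine (P [set w | Y w <= y]).
Proof.
rewrite /Fcdf /cdf /distribution /pushforward; congr (fine (P _)).
Qed.

Lemma indic_le y w : \1_[set w | Y w <= y] w = (Y w <= y)%R%:R :> R.
Proof. by rewrite indicE mem_setE. Qed.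

Lemma bounded_measurable_le y : bounded_measurable (fun w => (Y w <= y)%R%:R : R).
Proof.
rewrite (_ : (fun w => _) = \1_[set w | Y w <= y]).
  exact/bounded_measurable_indic/measurable_le.
by apply/funext => w; rewrite indic_le.
Qed.

Lemma exp_le_Fcdf y : \int[P]_w ((Y w <= y)%R%:R) = Fcdf Y y.
Proof.
rewrite FcdfE -exp_indic; last exact: measurable_le.
by apply: eq_Rintegral => w _; rewrite indic_le.
Qed.

Lemma Fcdf_is_cdf : is_cdf (Fcdf Y).
Proof.
split.
- by move=> x y xy; rewrite /Fcdf fine_le ?fin_num_measure// cdf_nondecreasing.
- move=> a; apply: fine_cvg.
  by rewrite fineK ?fin_num_measure//; exact: cdf_right_continuous.
- exact/fine_cvg/cvg_cdfNy0.
- exact/fine_cvg/cvg_cdfy1.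
Qed.

Lemma Fcdf_mono x y : x <= y -> Fcdf Y x <= Fcdf Y y.
Proof. by have [h _ _ _] := Fcdf_is_cdf; exact: h. Qed.

Lemma Fcdf01 y : 0 <= Fcdf Y y <= 1.
Proof. exact: is_cdf_01 Fcdf_is_cdf. Qed.

Lemma measurable_Fcdf : measurable_fun setT (Fcdf Y).
Proof. by apply: nondecreasing_measurable => // x y; exact: Fcdf_mono. Qed.

End Fcdf.

Section cond_cdf.
Context d d' (T : measurableType d) (T' : measurableType d') (R : realType).
Context (P : probability T R) (Y : {RV P >-> R}) (X : {RV P >-> T'}).
Let mu := distribution P X.

Let g (r : rat) : T' -> R := cond_prob X [set w | Y w <= ratr r].

Let gP r : is_cond_prob X [set w | Y w <= ratr r] (g r).
Proof. exact/cond_probP/measurable_le. Qed.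

Let bg r : bounded_measurable (g r).
Proof. by have [mg g01 _] := gP r; exact: bounded_measurable_itv mg g01. Qed.

Let expg r : \int[mu]_x g r x = Fcdf Y (ratr r).
Proof.
rewrite exp_distribution// -exp_le_Fcdf.
have /(_ _ (bounded_measurable_cst T' 1)) := cond_prob_exp (measurable_le Y (ratr r)) (gP r).
under [X in X = _ -> _]eq_Rintegral do rewrite mul1r indic_le.
by under [X in _ = X -> _]eq_Rintegral do rewrite mul1r.
Qed.

Let ng : \forall x \ae mu, forall r s : rat, r <= s -> g r x <= g s x.
Proof.
apply: ae_forall_countable => r; apply: ae_forall_countable => s.
have [rs|] := leP r s; last by move=> _; exact: aeW.
have sub : [set w | Y w <= ratr r] `<=` [set w | Y w <= ratr s].
  by move=> w /= /le_trans; apply; rewrite ler_rat.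
have := cond_prob_mono (measurable_le Y _) (measurable_le Y _) sub (gP r) (gP s).
exact: filterS.
Qed.

(** A Markov bound. On the exceptional set [A] every [g r] is at least [e], so [e mu(A)] is at most
    E (g r) = F_Y r, which is small for [r] near minus infinity. The limit 1 is handled in the same
    way with [1 - g r]. *)
Let g0 : \forall x \ae mu, forall n : nat, exists r, g r x < n.+1%:R^-1.
Proof.
apply/ae_foralln => n; pose e : R := n.+1%:R^-1.
have e0 : 0 < e by rewrite invr_gt0.
pose A := [set x | forall r, e <= g r x].
have mA : measurable A.
  have -> : A = ~` \bigcup_r [set x | g r x < e].
    apply/seteqP; split => x /= h; first by move=> [r _ /=]; rewrite ltNge h.
    by move=> r; rewrite leNgt; apply/negP => gr; apply: h; exists r.
  apply: measurableC; apply: bigcupT_measurable_rat => r.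
  by rewrite -[X in measurable X]setTI; apply: measurable_fun_ltr => //; case: (bg r).
exists A; split => //; last by move=> x /forallNP h r; rewrite leNgt; apply/negP/h.
apply/eqP; rewrite -measure_le0; rewrite -[X in (X <= _)%E]fineK ?fin_num_measure//.
rewrite lee_fin; apply/ler_addgt0Pr => eps eps0; rewrite add0r.
have [z Gz] := is_cdf_left (Fcdf_is_cdf Y) (mulr_gt0 e0 eps0).
have /rat_in_itvoo[r /itvP rz] : z - 1 < z by rewrite ltrBlDr ltrDl.
have : e * fine (mu A) <= e * eps.
  apply: (@le_trans _ _ (\int[mu]_x g r x)).
    rewrite -exp_indic// -expZ; last exact: bounded_measurable_indic.
    apply: exp_le => //; first exact/bounded_measurableM/bounded_measurable_indic/mA/bounded_measurable_cst.
    move=> x; rewrite indicE; have [/set_mem/(_ r)|_] := boolP (x \in A).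
      by rewrite mulr1.
    by rewrite mulr0; have [_ /(_ x)/andP[]] := gP r.
  rewrite expg (le_trans _ (ltW Gz))// Fcdf_mono//.
  by rewrite rz.
by rewrite ler_pM2l.
Qed.

Let g1 : \forall x \ae mu, forall n : nat, exists r, 1 - n.+1%:R^-1 < g r x.
Proof.
apply/ae_foralln => n; pose e : R := n.+1%:R^-1.
have e0 : 0 < e by rewrite invr_gt0.
pose A := [set x | forall r, g r x <= 1 - e].
have mA : measurable A.
  have -> : A = ~` \bigcup_r [set x | 1 - e < g r x].
    apply/seteqP; split => x /= h; first by move=> [r _ /=]; rewrite ltNge h.
    by move=> r; rewrite leNgt; apply/negP => gr; apply: h; exists r.
  apply: measurableC; apply: bigcupT_measurable_rat => r.
  by rewrite -[X in measurable X]setTI; apply: measurable_fun_ltr => //; case: (bg r).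
exists A; split => //; last by move=> x /forallNP h r; rewrite leNgt; apply/negP/h.
apply/eqP; rewrite -measure_le0; rewrite -[X in (X <= _)%E]fineK ?fin_num_measure//.
rewrite lee_fin; apply/ler_addgt0Pr => eps eps0; rewrite add0r.
have [z Gz] := is_cdf_top (Fcdf_is_cdf Y) (mulr_gt0 e0 eps0).
have /rat_in_itvoo[r /itvP rz] : z < z + 1 by rewrite ltrDl.
have : e * fine (mu A) <= e * eps.
  apply: (@le_trans _ _ (\int[mu]_x (1 - g r x))).
    rewrite -exp_indic// -expZ; last exact: bounded_measurable_indic.
    apply: exp_le => //; first exact/bounded_measurableM/bounded_measurable_indic/mA/bounded_measurable_cst.
      exact/bounded_measurableB/bg/bounded_measurable_cst.
    move=> x; rewrite indicE; have [/set_mem/(_ r)|_] := boolP (x \in A).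
      by rewrite mulr1; lra.
    by rewrite mulr0 subr_ge0; have [_ /(_ x)/andP[]] := gP r.
  rewrite expB//; last exact: bounded_measurable_cst.
  rewrite exp_cst expg.
  have : Fcdf Y z <= Fcdf Y (ratr r) by rewrite Fcdf_mono// rz.
  by lra.
by rewrite ler_pM2l.
Qed.

(** Versions of P (Y <= r | X = x) at rational [r] are monotone with the right limits for almost
    every [x], and [F x] is their right-continuous envelope. That [F] is a version at every real [y]
    follows by squeezing it between the version at [y] and those at rationals above [y]. *)
Lemma cond_cdf_exists : exists F, is_cond_cdf Y X F.
Proof.
have [N [mN N0 NP]] : \forall x \ae mu, (forall r s : rat, r <= s -> g r x <= g s x) /\
   ((forall n : nat, exists r, g r x < n.+1%:R^-1) /\
    (forall n : nat, exists r, 1 - n.+1%:R^-1 < g r x)).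
  by apply: filterS2 ng (filterI g0 g1) => x ? [].
(* On the null set the point mass at 0 serves as default, so that [F x] is a distribution function
   for every [x]. *)
pose F x y := if x \in N then (0 <= y)%R%:R else rat_envelope (g ^~ x) y.
have g01 x r : 0 <= g r x <= 1 by have [_ /(_ x)] := gP r.
have small e : 0 < e -> exists n : nat, n.+1%:R^-1 < e :> R.
  move=> e0; exists (Num.truncn e^-1); rewrite invf_plt ?posrE//.
  exact: truncnS_gt.
have goodP x : x \notin N -> [/\ forall r s : rat, r <= s -> g r x <= g s x,
    forall e : R, 0 < e -> exists r, g r x < e &
    forall e : R, 0 < e -> exists r, 1 - e < g r x].
  move=> xN; have [h1 [h2 h3]] : (forall r s : rat, r <= s -> g r x <= g s x) /\
   ((forall n : nat, exists r, g r x < n.+1%:R^-1) /\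
    (forall n : nat, exists r, 1 - n.+1%:R^-1 < g r x)).
    by apply: contrapT => /NP; move/negP: xN; rewrite inE.
  split=> // e /small[n ne].
    by have [r gr] := h2 n; exists r; exact: lt_trans ne.
  by have [r gr] := h3 n; exists r; apply: le_lt_trans gr; rewrite lerD2l lerN2 ltW.
exists F; split.
- move=> x; rewrite /F; case: (boolP (x \in N)) => [_|/goodP[h1 h2 h3]].
    apply: is_cdf_criterion.
    + by move=> y z yz; rewrite ler_nat; case: (leP 0 y) => // /le_trans-> .
    + by move=> y; case: (0 <= y); rewrite /= ?lexx ler01.
    + move=> y e e0; have [y0|y0] := leP 0 y.
        by exists (y + 1); rewrite ?ltrDl//; case: (0 <= _); rewrite ?mulr1n ?mulr0n; lra.
      exists (y / 2); first by lra.
      by rewrite leNgt (_ : y / 2 < 0) ?mulr0n; lra.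
    + by move=> e e0; exists (-1); rewrite oppr_ge0 ler10.
    + by move=> e e0; exists 0; rewrite lexx ltrBlDr ltrDl.
  exact: rat_envelope_is_cdf.
move=> y.
have mF : measurable_fun setT (F ^~ y).
  apply: measurable_fun_lt_rays => a.
  rewrite (_ : [set x | F x y < a] = (N `&` [set x | (0 <= y)%R%:R < a]) `|`
    (~` N `&` \bigcup_(r in setT) ([set x | y < ratr r /\ g r x < a]))).
    apply: measurableU.
      apply: measurableI => //; have [ya|ya] := boolP ((0 <= y)%R%:R < a).
        rewrite (_ : [set x | _] = setT)//.
        by apply/seteqP; split.
      by rewrite (_ : [set x | _] = set0)//; apply/seteqP; split => // x /=; rewrite (negbTE ya).
    apply: measurableI; first exact: measurableC.
    apply: bigcupT_measurable_rat => r; have [yr|yr] := ltP y (ratr r).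
      rewrite (_ : [set x | _] = [set x | g r x < a]); last first.
        by apply/seteqP; split => x /=; [case|].
      by rewrite -[X in measurable X]setTI; apply: measurable_fun_ltr => //; case: (bg r).
    rewrite (_ : [set x | _] = set0)//; apply/seteqP; split => // x /=.
    by case.
  apply/seteqP; split => x; rewrite /F/=; have [xN|xN] := boolP (x \in N).
  - by move=> h; left; split => //; exact/set_mem.
  - move=> /(rat_envelope_lt (g01 x))[r yr gr]; right; split.
      by move/negP: xN; rewrite inE.
    by exists r.
  - by case=> [[_]//|[]]; rewrite -[~ N x]/((~` N) x) => /mem_set; rewrite in_setC xN.
  - case=> [[/mem_set]|[_ [r _ [yr gr]]]]; first by rewrite (negbTE xN).
    by apply/(rat_envelope_lt (g01 x)); exists r.
have F01 x : 0 <= F x y <= 1.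
  rewrite /F; case: (boolP (x \in N)) => [_|/goodP[h1 h2 h3]].
    by case: (0 <= y); rewrite /= ?lexx ler01.
  by apply: is_cdf_01; exact: rat_envelope_is_cdf.
apply/is_cond_probP => //; first exact: measurable_le.
move=> B mB; set E := [set w | Y w <= y].
have b1 : bounded_measurable (fun w => \1_B (X w) : R).
  exact/(bounded_measurable_comp (measurable_funPT X))/bounded_measurable_indic.
have bF := bounded_measurable_itv mF F01.
have bFX := bounded_measurable_comp (measurable_funPT X) bF.
have notN : \forall w \ae P, X w \notin N.
  apply: (@ae_distribution _ _ _ _ _ _ X (fun x => x \notin N)).
  by exists N; split => // x /= /negP; rewrite negbK inE.
have upper (r : rat) : y < ratr r -> \int[P]_w (\1_B (X w) * F (X w) y) <=
    \int[P]_w (\1_B (X w) * \1_[set w | Y w <= ratr r] w).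
  move=> yr; rewrite (cond_prob_exp (measurable_le Y _) (gP r)); last exact: bounded_measurable_indic.
  apply: exp_ae_le.
  - exact: bounded_measurableM b1 bFX.
  - exact/(bounded_measurableM b1)/(bounded_measurable_comp (measurable_funPT X)).
  apply: filterS notN => w wN; rewrite ler_wpM2l// /F (negbTE wN).
  exact: rat_envelope_le.
have lower : \int[P]_w (\1_B (X w) * \1_E w) <= \int[P]_w (\1_B (X w) * F (X w) y).
  have hP := cond_probP X (measurable_le Y y); have [mh h01 _] := hP.
  rewrite (cond_prob_exp (measurable_le Y _) hP); last exact: bounded_measurable_indic.
  have hg : \forall x \ae mu, forall r : rat, y < ratr r -> cond_prob X E x <= g r x.
    apply: ae_forall_countable => r; have [yr|] := ltP y (ratr r); last by move=> _; exact: aeW.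
    have sub : E `<=` [set w | Y w <= ratr r].
      by move=> w /= /le_trans; apply; exact: ltW.
    have := cond_prob_mono (measurable_le Y _) (measurable_le Y _) sub hP (gP r).
    exact: filterS.
  apply: exp_ae_le.
  - apply/(bounded_measurableM b1)/(bounded_measurable_comp (measurable_funPT X)).
    exact: bounded_measurable_itv mh h01.
  - exact: bounded_measurableM b1 bFX.
  apply: filterS2 notN (ae_distribution hg) => w wN hgw.
  rewrite ler_wpM2l// /F (negbTE wN); exact: rat_envelope_ge.
(* For the other inequality, [r] is taken so close to [y] that the excess P (y < Y <= r) is at most
   [e]. *)
apply/le_anti; rewrite lower/=; apply/ler_addgt0Pr => e e0.
have [z yz Fz] := is_cdf_right y (Fcdf_is_cdf Y) e0.
have /rat_in_itvoo[r /itvP rz] := yz.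
apply: le_trans (upper r _) _; first by rewrite rz.
rewrite -lerBlDl -expB; last 2 first.
- exact/(bounded_measurableM b1)/bounded_measurable_indic/measurable_le.
- exact/(bounded_measurableM b1)/bounded_measurable_indic/measurable_le.
apply: (@le_trans _ _ (\int[P]_w ((Y w <= ratr r)%R%:R - (Y w <= y)%R%:R))).
  apply: exp_le.
  - by apply: bounded_measurableB; exact/(bounded_measurableM b1)/bounded_measurable_indic/measurable_le.
  - by apply: bounded_measurableB; exact: bounded_measurable_le.
  move=> w; rewrite /E !indic_le indicE -mulrBr.
  have : (Y w <= y)%R%:R <= (Y w <= ratr r)%R%:R :> R.
    rewrite ler_nat; case: (leP (Y w) y) => // Yy.
    by rewrite (le_trans Yy)// rz.
  by case: (_ \in B); rewrite ?mul1r// mul0r subr_ge0.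
rewrite expB; [|exact: bounded_measurable_le|exact: bounded_measurable_le].
rewrite !exp_le_Fcdf; have : Fcdf Y (ratr r) <= Fcdf Y z by rewrite Fcdf_mono// rz.
lra.
Qed.

Lemma cond_cdfP : is_cond_cdf Y X (cond_cdf Y X).
Proof. exact: getPex cond_cdf_exists. Qed.

End cond_cdf.

(** * Conditional Jensen inequality *)

Section limit.
Context d (T : measurableType d) (R : realType) (P : probability T R).

(** Dominated convergence for sequences that at each point are eventually equal to the limit, as
    happens for truncations to growing sets and for approximations that are exact away from the
    endpoints. *)
Lemma exp_ge_lim (f_ : nat -> T -> R) (f : T -> R) (M c : R) :
  (forall n, measurable_fun setT (f_ n)) -> (forall n x, `|f_ n x| <= M) ->
  measurable_fun setT f ->
  (forall x, exists N, forall n, (N <= n)%N -> f_ n x = f x) ->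
  (forall n, c <= \int[P]_x f_ n x) -> c <= \int[P]_x f x.
Proof.
move=> mf_ fM mf f_f cf.
have fM' x : `|f x| <= M.
  by have [N fN] := f_f x; rewrite -(fN N).
have bf : bounded_measurable f by split; last exists M.
have bf_ n : bounded_measurable (f_ n) by split; last exists M.
have h : (fun n => (\int[P]_x f_ n x)%:E) @ \oo --> (\int[P]_x f x)%:E.
  have H := @dominated_convergence _ _ _ P setT measurableT
    (fun n x => (f_ n x)%:E) (fun x => (f x)%:E) (fun=> M%:E).
  have [| | | | |_ _] := H.
  - by move=> n; exact/measurable_EFinP.
  - exact/measurable_EFinP.
  - apply: aeW => x _; have [N fN] := f_f x.
    by apply: cvg_near_cst; exists N => // n /= Nn; rewrite fN.
  - exact: (bounded_measurable_integrable P (bounded_measurable_cst T M)).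
  - by apply: aeW => x n _; rewrite lee_fin.
  rewrite exp_EFin// (_ : [sequence _]_n = fun n => (\int[P]_x f_ n x)%:E)//.
  by apply/funext => n /=; rewrite exp_EFin.
rewrite -lee_fin; apply: (cvge_ge _ h); apply: nearW => n; by rewrite lee_fin.
Qed.

End limit.

(** g (X) = E (S | X). The variable [S] need not be an indicator: it is also taken to be the
    conditional distribution function given a finer variable. *)
Definition is_cond_exp d d' (T : measurableType d) (T' : measurableType d') (R : realType)
    (P : probability T R) (X : T -> T') (S : T -> R) (g : T' -> R) :=
  forall B, measurable B ->
    \int[P]_w (\1_B (X w) * S w) = \int[P]_w (\1_B (X w) * g (X w)).

Section jensen.
Context d d' (T : measurableType d) (T' : measurableType d') (R : realType).
Context (P : probability T R) (X : T -> T') (S : T -> R) (g : T' -> R) (psi : R -> R).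
Hypotheses (mX : measurable_fun setT X) (mS : measurable_fun setT S).
Hypotheses (mg : measurable_fun setT g).
Hypotheses (S01 : forall w, 0 <= S w <= 1) (g01 : forall x, 0 <= g x <= 1).
Hypothesis gS : is_cond_exp P X S g.
Hypothesis cpsi : convex_on 0 1 psi.

Let bS : bounded_measurable S := bounded_measurable_itv mS S01.
Let bg : bounded_measurable g := bounded_measurable_itv mg g01.
Let bgX := bounded_measurable_comp mX bg.
Let bpsiS : bounded_measurable (psi \o S).
Proof. exact: (bounded_measurable_convex cpsi). Qed.
Let bpsig : bounded_measurable (psi \o g \o X).
Proof.
by apply: (bounded_measurable_convex cpsi) => //; exact: measurableT_comp.
Qed.
Let bindX J : measurable J -> bounded_measurable (fun w => \1_J (X w) : R).
Proof. by move=> mJ; exact/(bounded_measurable_comp mX)/bounded_measurable_indic. Qed.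

Lemma cond_exp_pull_out (h : T' -> R) : bounded_measurable h ->
  \int[P]_w (h (X w) * S w) = \int[P]_w (h (X w) * g (X w)).
Proof. exact: pull_out. Qed.

(** Where g (X) = 0 the nonnegative [S] has integral 0, and where g (X) = 1 the same holds for
    [1 - S]. This disposes of the endpoints, where [psi] may have no support line. *)
Lemma cond_exp_extreme : \forall w \ae P, (0 < g (X w) < 1) \/ S w = g (X w).
Proof.
pose A0 := [set x | g x <= 0]; pose A1 := [set x | 1 <= g x].
have mA0 : measurable A0.
  by rewrite -[A0]setTI; exact: measurable_fun_ler.
have mA1 : measurable A1.
  by rewrite -[A1]setTI; exact: measurable_fun_ler.
have b0 := bindX mA0; have b1 := bindX mA1.
have h0 : \forall w \ae P, \1_A0 (X w) * S w = 0.
  apply: exp_eq0; first exact: bounded_measurableM.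
    by move=> w; rewrite mulr_ge0//; case/andP: (S01 w).
  rewrite gS// -[RHS](exp_cst P 0); apply: eq_Rintegral => w _.
  rewrite indicE; have [/set_mem|] := boolP (_ \in A0); last by rewrite mul0r.
  by rewrite /A0/= mul1r => gw; apply/le_anti; rewrite gw; case/andP: (g01 (X w)).
have h1 : \forall w \ae P, \1_A1 (X w) * (1 - S w) = 0.
  have b2 : bounded_measurable (fun w => 1 - S w).
    exact/bounded_measurableB/bS/bounded_measurable_cst.
  apply: exp_eq0; first exact: bounded_measurableM.
    by move=> w; rewrite mulr_ge0// subr_ge0; case/andP: (S01 w).
  under eq_Rintegral do rewrite mulrBr mulr1.
  rewrite expB//; last exact: bounded_measurableM.
  rewrite gS// -expB//; last exact: bounded_measurableM.
  rewrite -[RHS](exp_cst P 0); apply: eq_Rintegral => w _.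
  rewrite indicE; have [/set_mem|] := boolP (_ \in A1); last by rewrite mul0r subrr.
  rewrite /A1/= mul1r => gw; apply/eqP; rewrite subr_eq0 eq_le gw.
  by case/andP: (g01 (X w)).
apply: filterS2 h0 h1 => w h0 h1.
have [/andP[g0 g1]] := g01 (X w); rewrite le_eqVlt in g0.
case/predU1P: g0 => [g0|g0].
  by right; move: h0; rewrite indicE mem_set ?mul1r ?g0//= /A0/= -g0.
rewrite le_eqVlt in g1; case/predU1P: g1 => [g1|g1]; last by left; rewrite g0.
right; move: h1; rewrite indicE mem_set ?mul1r /A1/= ?g1// => /eqP.
by rewrite subr_eq0 => /eqP.
Qed.

(* The slope of a support line at g x may be unbounded as g x tends to 0 or 1, hence the
   truncation to a_ n <= g x <= 1 - a_ n. *)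
Let a_ n : R := n.+3%:R^-1.

Let a_gt0 n : 0 < a_ n. Proof. by rewrite invr_gt0. Qed.

Let a_lt n : a_ n < 1 / 2.
Proof. by rewrite div1r ltf_pV2 ?posrE// ltr_nat. Qed.

(** Clamping the argument keeps the slope a monotone function on the whole line, hence bounded and
    measurable along [g]. *)
Let slope_n n (u : R) := left_slope 0 psi (Num.max (a_ n) (Num.min u (1 - a_ n))).

Let In n := [set x | a_ n <= g x <= 1 - a_ n].

Let mIn n : measurable (In n).
Proof.
rewrite (_ : In n = [set x | a_ n <= g x] `&` [set x | g x <= 1 - a_ n]).
  by apply: measurableI; rewrite -[X in measurable X]setTI; exact: measurable_fun_ler.
by apply/seteqP; split => x; rewrite /In /= => /andP.
Qed.

Let clamp_in n u : a_ n <= Num.max (a_ n) (Num.min u (1 - a_ n)) <= 1 - a_ n.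
Proof.
have := a_lt n; have := a_gt0 n; move: (a_ n) => a a0 a1.
by rewrite le_max lexx/= ge_max ge_min lexx orbT andbT; lra.
Qed.

Let slope_n_mono n : {homo slope_n n : u v / u <= v}.
Proof.
move=> u v uv; have /andP[h1 h2] := clamp_in n u; have /andP[h3 h4] := clamp_in n v.
have a0 := a_gt0 n.
apply: (left_slope_mono cpsi); first exact: lt_le_trans h1.
  by rewrite ge_max !le_max lexx/= le_min !ge_min uv lexx !orbT.
by apply: le_lt_trans h4 _; rewrite ltrBlDr ltrDl.
Qed.

Let bslope n : bounded_measurable (fun x => slope_n n (g x)).
Proof.
apply: (@bounded_measurable_itv _ _ _ _ (slope_n n 0) (slope_n n 1)).
  apply: measurableT_comp => //; apply: nondecreasing_measurable => //.
by move=> x; have /andP[g0 g1] := g01 x; rewrite !slope_n_mono.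
Qed.

Let slope_nE n x : In n x -> slope_n n (g x) = left_slope 0 psi (g x).
Proof.
by move=> /andP[h1 h2]; rewrite /slope_n min_l// max_r.
Qed.

Let In_itv n x : In n x -> 0 < g x < 1.
Proof.
move=> /andP[h1 h2]; rewrite (lt_le_trans (a_gt0 n) h1)/=.
by apply: le_lt_trans h2 _; rewrite ltrBlDr ltrDl.
Qed.

Let gap n w := psi (S w) - psi (g (X w)) - slope_n n (g (X w)) * (S w - g (X w)).

Let bgap n : bounded_measurable (gap n).
Proof.
apply: bounded_measurableB; first exact: bounded_measurableB.
apply: bounded_measurableM; last exact: bounded_measurableB.
exact: (bounded_measurable_comp mX (bslope n)).
Qed.

Let gap_ge0 n w : 0 <= \1_(In n) (X w) * gap n w.
Proof.
rewrite indicE; have [/set_mem XI|_] := boolP (_ \in _); last by rewrite mul0r.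
rewrite mul1r /gap slope_nE// subr_ge0 lerBrDl.
have /andP[g0 g1] := In_itv XI.
exact: (left_slope_support cpsi g0 g1 (S01 w)).
Qed.

(** The linear term of the support line is a bounded function of [X] times [S - g (X)], so it
    integrates to 0. *)
Let exp_gap J n : measurable J ->
  \int[P]_w (\1_(J `&` In n) (X w) * (psi (S w) - psi (g (X w)))) =
  \int[P]_w (\1_(J `&` In n) (X w) * gap n w).
Proof.
move=> mJ; have mJI := measurableI _ _ mJ (mIn n); have bJ := bindX mJI.
pose h x := \1_(J `&` In n) x * slope_n n (g x).
have bh : bounded_measurable h.
  by apply: bounded_measurableM => //; exact: bounded_measurable_indic.
have bhX := bounded_measurable_comp mX bh.
rewrite [RHS](_ : _ = \int[P]_w (\1_(J `&` In n) (X w) * (psi (S w) - psi (g (X w))) -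
    (h (X w) * S w - h (X w) * g (X w)))); last first.
  by apply: eq_Rintegral => w _; rewrite /gap /h; ring.
rewrite [RHS]expB; first last.
- by apply: bounded_measurableB; exact: bounded_measurableM.
- by apply: bounded_measurableM => //; exact: bounded_measurableB.
rewrite [X in _ = _ - X]expB; [|exact: bounded_measurableM..].
by rewrite cond_exp_pull_out// subrr subr0.
Qed.

(** Localization to [X] in [J] is what the equality case requires: a gain on one set of values of
    [X] cannot be offset on its complement. *)
Lemma jensen_local J : measurable J ->
  0 <= \int[P]_w (\1_J (X w) * (psi (S w) - psi (g (X w)))).
Proof.
move=> mJ; pose G := [set x | 0 < g x < 1].
have mG : measurable G.
  rewrite (_ : G = [set x | 0 < g x] `&` [set x | g x < 1]).
    by apply: measurableI; rewrite -[X in measurable X]setTI; exact: measurable_fun_ltr.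
  by apply/seteqP; split => x; rewrite /G /= => /andP.
have bD : bounded_measurable (fun w => psi (S w) - psi (g (X w))).
  exact: bounded_measurableB.
rewrite (@exp_ae_eq _ _ _ _ _ (fun w => \1_(J `&` G) (X w) * (psi (S w) - psi (g (X w))))).
- have [_ [M DM]] := bD.
  apply: (@exp_ge_lim _ _ _ _
    (fun n w => \1_(J `&` In n) (X w) * (psi (S w) - psi (g (X w)))) _ M).
  + move=> n; apply: measurable_funM; last by case: bD.
    by have [] := bindX (measurableI _ _ mJ (mIn n)).
  + move=> n w; rewrite normrM indicE; case: (_ \in _); rewrite ?normr1 ?mul1r//.
    by rewrite normr0 mul0r (le_trans _ (DM w)).
  + apply: measurable_funM; last by case: bD.
    by have [] := bindX (measurableI _ _ mJ mG).
  + move=> w; have [[g0 g1]|ng] := pselect (0 < g (X w) /\ g (X w) < 1); last first.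
      exists 0%N => n _; rewrite !indicI /= [\1_G _]indicE memNset; last by move=> /andP.
      rewrite [\1_(In n) _]indicE memNset; last by move=> /In_itv/andP.
      by [].
    exists (Num.truncn (Num.min (g (X w)) (1 - g (X w)))^-1) => n Nn.
    rewrite !indicI /= [\1_G _]indicE mem_set; last by rewrite /G /= g0.
    rewrite [\1_(In n) _]indicE mem_set//.
    set m := Num.min _ _ in Nn; have m0 : 0 < m by rewrite lt_min g0 subr_gt0.
    have am : a_ n < m.
      rewrite /a_ invf_plt ?posrE//; apply: lt_le_trans (truncnS_gt _) _.
      by rewrite ler_nat ltnS (leq_trans Nn)// leqW// leqW.
    by move: am; rewrite lt_min => /andP[h1 h2]; rewrite /In/= (ltW h1) lerBrDr -lerBrDl ltW.
  + by move=> n; rewrite exp_gap//; apply: exp_ge0 => w; rewrite indicI /= -mulrA mulr_ge0.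
- exact: bounded_measurableM (bindX mJ) bD.
- exact: bounded_measurableM (bindX (measurableI _ _ mJ mG)) bD.
apply: filterS cond_exp_extreme => w [gi|->]; last by rewrite subrr !mulr0.
by rewrite indicI /= [\1_G _]indicE mem_set// mulr1.
Qed.

Lemma jensen : \int[P]_w psi (g (X w)) <= \int[P]_w psi (S w).
Proof.
rewrite -subr_ge0 -expB//; have := jensen_local measurableT.
by under eq_Rintegral do rewrite indicT mul1r.
Qed.

(** Equality of the total integrals and [jensen_local] on [In n] and on its complement give equality
    on each [In n], so [S w] lies on the support line at [u = g (X w)]. If [S w != u], strict
    convexity puts psi at their midpoint below that line. *)
Lemma jensen_strict : strictly_convex `[0, 1] psi ->
  \int[P]_w psi (g (X w)) = \int[P]_w psi (S w) ->
  \forall w \ae P, S w = g (X w).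
Proof.
move=> spsi psiE.
have bD : bounded_measurable (fun w => psi (S w) - psi (g (X w))).
  exact: bounded_measurableB.
have local0 n : \int[P]_w (\1_(In n) (X w) * (psi (S w) - psi (g (X w)))) = 0.
  apply/le_anti; rewrite (jensen_local (mIn n)) andbT.
  have := jensen_local (measurableC (mIn n)).
  rewrite (_ : \int[P]_w _ = \int[P]_w ((psi (S w) - psi (g (X w))) -
      \1_(In n) (X w) * (psi (S w) - psi (g (X w))))); last first.
    apply: eq_Rintegral => w _; rewrite !indicE in_setC.
    by case: (_ \in _) => /=; rewrite ?mul1r ?mul0r ?subrr ?subr0.
  rewrite expB//; last exact: bounded_measurableM (bindX (mIn n)) bD.
  by rewrite expB// psiE subrr sub0r oppr_ge0.
have gap0 n : \forall w \ae P, \1_(In n) (X w) * gap n w = 0.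
  apply: exp_eq0 => //; first exact: bounded_measurableM (bindX (mIn n)) (bgap n).
  have := exp_gap n measurableT; rewrite setTI => <-; exact: local0.
have {}gap0 : \forall w \ae P, forall n, \1_(In n) (X w) * gap n w = 0.
  exact/ae_foralln.
apply: filterS2 cond_exp_extreme gap0 => w [/andP[g0 g1]|//] gap0.
pose u := g (X w); pose m := Num.min u (1 - u).
have m0 : 0 < m by rewrite lt_min g0 subr_gt0.
have [n am] : exists n, a_ n < m.
  exists (Num.truncn m^-1); rewrite /a_ invf_plt ?posrE//.
  by apply: lt_le_trans (truncnS_gt _) _; rewrite ler_nat ltnS leqW// leqW.
have XIn : In n (X w).
  by move: am; rewrite lt_min => /andP[h1 h2]; rewrite /In/= (ltW h1) lerBrDr -lerBrDl ltW.
have := gap0 n; rewrite indicE mem_set// mul1r /gap slope_nE// -/u => gapE.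
apply/eqP; apply: contraT => Su.
have [/andP[s0 s1] /andP[u0 u1]] := (S01 w, g01 (X w)).
have := left_slope_support cpsi g0 g1 (_ : 0 <= 1 / 2 * S w + (1 - 1 / 2) * u <= 1).
rewrite -/u => /(_ ltac:(rewrite /u; lra)).
have := spsi (S w) u (1 / 2); rewrite /= !in_itv /= => /(_ (S01 w) (g01 (X w)) Su).
move=> /(_ ltac:(lra) ltac:(lra)).
by move: (left_slope 0 psi u) (psi _) gapE => l p gapE; lra.
Qed.

End jensen.

(** * Convex order on the unit interval *)

(* For S1 and S2 with values in [0, 1]; unlike in [le_cx], psi may be discontinuous at
   0 and 1, as phi may be at -1 and 1. *)
Definition cx01 d1 (T1 : measurableType d1) d2 (T2 : measurableType d2) (R : realType)
    (P1 : probability T1 R) (S1 : T1 -> R) (P2 : probability T2 R) (S2 : T2 -> R) :=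
  forall psi : R -> R, convex_on 0 1 psi ->
    \int[P1]_w psi (S1 w) <= \int[P2]_w psi (S2 w).

Section double_expectation.
Context {R : realType} (phi : R -> R).
Hypothesis cphi : convex_on (-1) 1 phi.

Lemma convex_shift a : 0 <= a <= 1 -> convex_on 0 1 (fun s => phi (s - a)).
Proof.
move=> a01 x y t x01 y01 t01.
have -> : t * x + (1 - t) * y - a = t * (x - a) + (1 - t) * (y - a) by ring.
by apply: cphi => //; lra.
Qed.

Lemma convex_shiftN a : 0 <= a <= 1 -> convex_on 0 1 (fun s => phi (a - s)).
Proof.
move=> a01 x y t x01 y01 t01.
have -> : a - (t * x + (1 - t) * y) = t * (a - x) + (1 - t) * (a - y) by ring.
by apply: cphi => //; lra.
Qed.

(** E phi (S1 - S2) for independent [S1] and [S2]; the iterated integral avoids constructing an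
    independent copy. *)
Definition exp2 d1 (T1 : measurableType d1) d2 (T2 : measurableType d2)
    (P1 : probability T1 R) (S1 : T1 -> R) (P2 : probability T2 R) (S2 : T2 -> R) :=
  \int[P1]_w1 \int[P2]_w2 phi (S1 w1 - S2 w2).

Section fixed.
Context d1 (T1 : measurableType d1) d2 (T2 : measurableType d2).
Context (P1 : probability T1 R) (S1 : T1 -> R) (P2 : probability T2 R) (S2 : T2 -> R).
Hypotheses (mS1 : measurable_fun setT S1) (S101 : forall w, 0 <= S1 w <= 1).
Hypotheses (mS2 : measurable_fun setT S2) (S201 : forall w, 0 <= S2 w <= 1).

Lemma bounded_measurable_phi2 :
  bounded_measurable (fun z : T1 * T2 => phi (S1 z.1 - S2 z.2)).
Proof.
apply: (bounded_measurable_convex cphi); first by apply: measurable_funB; exact: measurableT_comp.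
by move=> z; have := S101 z.1; have := S201 z.2; lra.
Qed.

Lemma bounded_measurable_exp2l : bounded_measurable (fun w1 => \int[P2]_w2 phi (S1 w1 - S2 w2)).
Proof. exact: (bounded_measurable_exp1 P1 P2 bounded_measurable_phi2). Qed.

Lemma exp2_swap : exp2 P1 S1 P2 S2 = \int[P2]_w2 \int[P1]_w1 phi (S1 w1 - S2 w2).
Proof. exact: (exp_fubini P1 P2 bounded_measurable_phi2). Qed.

Lemma bounded_measurable_exp2r : bounded_measurable (fun w2 => \int[P1]_w1 phi (S1 w1 - S2 w2)).
Proof. exact: (bounded_measurable_exp2 P1 P2 bounded_measurable_phi2). Qed.

End fixed.

Section mono.
Context d1 (T1 : measurableType d1) d1' (T1' : measurableType d1') d2 (T2 : measurableType d2).
Context (P1 : probability T1 R) (S1 : T1 -> R) (P1' : probability T1' R) (S1' : T1' -> R).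
Context (P2 : probability T2 R) (S2 : T2 -> R).
Hypotheses (mS1 : measurable_fun setT S1) (S101 : forall w, 0 <= S1 w <= 1).
Hypotheses (mS1' : measurable_fun setT S1') (S1'01 : forall w, 0 <= S1' w <= 1).
Hypotheses (mS2 : measurable_fun setT S2) (S201 : forall w, 0 <= S2 w <= 1).
Hypothesis cx : cx01 P1 S1 P1' S1'.

Lemma exp2_lel : exp2 P1 S1 P2 S2 <= exp2 P1' S1' P2 S2.
Proof.
rewrite !exp2_swap//; apply: exp_le; [exact: bounded_measurable_exp2r..|].
by move=> w; apply: (cx (convex_shift (S201 w))).
Qed.

Lemma exp2_ler : exp2 P2 S2 P1 S1 <= exp2 P2 S2 P1' S1'.
Proof.
apply: exp_le; [exact: bounded_measurable_exp2l..|].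
by move=> w; apply: (cx (convex_shiftN (S201 w))).
Qed.

Lemma exp2_lel_eq : exp2 P1 S1 P2 S2 = exp2 P1' S1' P2 S2 ->
  \forall w2 \ae P2, \int[P1]_w1 phi (S1 w1 - S2 w2) = \int[P1']_w1 phi (S1' w1 - S2 w2).
Proof.
rewrite !exp2_swap//; apply: exp_le_eq; [exact: bounded_measurable_exp2r..|].
by move=> w; apply: (cx (convex_shift (S201 w))).
Qed.

End mono.

Lemma exp2_le d1 (T1 : measurableType d1) d2 (T2 : measurableType d2)
    (P1 : probability T1 R) (S1 : T1 -> R) (P2 : probability T2 R) (S2 : T2 -> R) :
  measurable_fun setT S1 -> (forall w, 0 <= S1 w <= 1) ->
  measurable_fun setT S2 -> (forall w, 0 <= S2 w <= 1) ->
  cx01 P1 S1 P2 S2 -> exp2 P1 S1 P1 S1 <= exp2 P2 S2 P2 S2.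
Proof.
move=> mS1 S101 mS2 S201 cx; apply: (@le_trans _ _ (exp2 P2 S2 P1 S1)).
  exact: exp2_lel.
exact: exp2_ler.
Qed.

End double_expectation.

(** * Random distribution functions with mean F_Y *)

Section random_cdf.
Context d (T : measurableType d) (R : realType) (P : probability T R).

(** The common frame for F_Y, F_{Y|X} and the indicator of Y <= y. Regularity in [y] yields joint
    measurability, and the mean condition lets identities pass from almost all [y] to all [y]. *)
Definition random_cdf (Y : {RV P >-> R}) (S : T -> R -> R) :=
  [/\ forall w, is_cdf (S w), forall y, measurable_fun setT (S ^~ y) &
      forall y, \int[P]_w S w y = Fcdf Y y].

(** By monotonicity and right-continuity, [S w y < a] holds exactly if [S w r < a] for some rational
    [r > y]. *)
Lemma measurable_random_cdf d' (T' : measurableType d') (S : T' -> R -> R) :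
  (forall w, is_cdf (S w)) -> (forall y, measurable_fun setT (S ^~ y)) ->
  measurable_fun setT (fun z : T' * R => S z.1 z.2).
Proof.
move=> cS mS; apply: measurable_fun_lt_rays => a.
rewrite (_ : [set z | _] = \bigcup_(r in setT)
   ([set w | S w (ratr r) < a] `*` [set y | y < ratr r])).
  apply: bigcupT_measurable_rat => r; apply: measurableX.
    by rewrite -[X in measurable X]setTI; exact: measurable_fun_ltr.
  by rewrite -[X in measurable X]setTI; exact: measurable_fun_ltr.
apply/seteqP; split => -[w y] /=.
- move=> Sa; have e0 : 0 < a - S w y by rewrite subr_gt0.
  have [z yz Sz] := is_cdf_right y (cS w) e0.
  have /rat_in_itvoo[r /itvP rz] := yz; exists r => //=; split; last by rewrite rz.
  have [hS _ _ _] := cS w; apply: le_lt_trans (hS _ z _) _; first by rewrite rz.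
  by move: Sz; rewrite addrC subrK.
- move=> [r _ /= [Sr yr]]; apply: le_lt_trans Sr; have [hS _ _ _] := cS w.
  by apply: hS; exact: ltW.
Qed.

Lemma random_cdf01 Y S : random_cdf Y S -> forall y w, 0 <= S w y <= 1.
Proof. by move=> [cS _ _] y w; exact: is_cdf_01. Qed.

Lemma random_cdf_const (Y : {RV P >-> R}) : random_cdf Y (fun _ => Fcdf Y).
Proof.
by split=> [_|y|y]; [exact: Fcdf_is_cdf|exact: measurable_cst|exact: exp_cst].
Qed.

Lemma step_is_cdf (y0 : R) : is_cdf (fun y => (y0 <= y)%R%:R : R).
Proof.
apply: is_cdf_criterion.
- by move=> y z yz; rewrite ler_nat; case: (leP y0 y) => // /le_trans->.
- by move=> y; case: (y0 <= y); rewrite /= ?lexx ler01.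
- move=> y e e0; have [y0y|y0y] := leP y0 y.
    by exists (y + 1); rewrite ?ltrDl//; case: (y0 <= _); rewrite ?mulr1n ?mulr0n; lra.
  exists ((y + y0) / 2); first by lra.
  by rewrite leNgt (_ : (y + y0) / 2 < y0) ?mulr0n; lra.
- by move=> e e0; exists (y0 - 1); rewrite leNgt ltrBlDr ltrDl ltr01.
- by move=> e e0; exists y0; rewrite lexx ltrBlDr ltrDl.
Qed.

Lemma random_cdf_full (Y : {RV P >-> R}) : random_cdf Y (fun w y => (Y w <= y)%R%:R).
Proof.
split=> [w|y|y]; first exact: step_is_cdf; last exact: exp_le_Fcdf.
by have [] := bounded_measurable_le Y y.
Qed.

Section cond.
Context d' (T' : measurableType d') (Y : {RV P >-> R}) (X : {RV P >-> T'}).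

Definition cond_S w y := cond_cdf Y X (X w) y.

Lemma random_cdf_cond : random_cdf Y cond_S.
Proof.
have [cF FP] := cond_cdfP Y X; split=> [w|y|y]; first exact: cF.
  by have [mF _ _] := FP y; exact: (measurableT_comp mF (measurable_funPT X)).
have /(_ _ (bounded_measurable_cst T' 1)) := cond_prob_exp (measurable_le Y y) (FP y).
under eq_Rintegral do rewrite mul1r indic_le.
rewrite exp_le_Fcdf => ->.
by apply: eq_Rintegral => w _; rewrite mul1r.
Qed.

Lemma cond_S_exp y B : measurable B ->
  \int[P]_w (\1_B (X w) * (Y w <= y)%R%:R) = \int[P]_w (\1_B (X w) * cond_S w y).
Proof.
move=> mB; have [_ FP] := cond_cdfP Y X.
have := cond_prob_exp (measurable_le Y y) (FP y) (bounded_measurable_indic R mB).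
by under eq_Rintegral do rewrite indic_le.
Qed.

End cond.
End random_cdf.

(** * Quantiles *)

Section cdf_quantile.
Context {R : realType}.
Implicit Types (G : R -> R) (v y : R).

Definition cdf_quantile G v := inf [set y | v <= G y].

Lemma has_inf_cdf_quantile G v : is_cdf G -> 0 < v -> v < 1 ->
  has_inf [set y | v <= G y].
Proof.
move=> cG v0 v1; have [nG _ _ _] := cG; split.
  have v1' : 0 < 1 - v by lra.
  by have [z Gz] := is_cdf_top cG v1'; exists z => /=; move: Gz; lra.
have [z Gz] := is_cdf_left cG v0; exists z => y /= vy.
by rewrite leNgt; apply/negP => /ltW/nG/(le_trans vy); rewrite leNgt Gz.
Qed.

(** The Galois connection between a distribution function and its quantile function;
    right-continuity places the infimum in the set. *)
Lemma cdf_quantile_le G v y : is_cdf G -> 0 < v -> v < 1 ->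
  (cdf_quantile G v <= y) = (v <= G y).
Proof.
move=> cG v0 v1; have [nG _ _ _] := cG; have hi := has_inf_cdf_quantile cG v0 v1.
apply/idP/idP => [qy|vy]; last by apply: ge_inf => //; case: hi.
rewrite leNgt; apply/negP => Gy; have e0 : 0 < v - G y by rewrite subr_gt0.
have [z yz Gz] := is_cdf_right y cG e0.
have /inf_lt : cdf_quantile G v < z by exact: le_lt_trans yz.
move=> /(_ hi.1)[x /= vx xz]; have := nG _ _ (ltW xz).
by move: Gz vx; rewrite addrC subrK => h1 h2 h3; have := le_lt_trans (le_trans h2 h3) h1;
   rewrite ltxx.
Qed.

Lemma cdf_quantile_ge G v : is_cdf G -> 0 < v -> v < 1 -> v <= G (cdf_quantile G v).
Proof. by move=> cG v0 v1; rewrite -cdf_quantile_le. Qed.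

Lemma cdf_quantile_lt G v z : is_cdf G -> 0 < v -> v < 1 ->
  z < cdf_quantile G v -> G z < v.
Proof. by move=> cG v0 v1; rewrite !ltNge cdf_quantile_le. Qed.

End cdf_quantile.

Lemma measurable_fun_le_rays d (T : measurableType d) (R : realType) (f : T -> R) :
  (forall a, measurable [set x | f x <= a]) -> measurable_fun setT f.
Proof.
move=> mf; apply: (measurability _ (RGenOInfty.measurableE R)) => //.
move=> _ [_ [a ->] <-]; rewrite setTI.
rewrite (_ : _ @^-1` _ = ~` [set x | f x <= a]); first exact/measurableC/mf.
by apply/seteqP; split => x; rewrite /= in_itv/= andbT ltNge => /negP.
Qed.

Section half_lines.
Context d1 d2 (T1 : measurableType d1) (T2 : measurableType d2).
Context (R : realType) (P1 : probability T1 R) (P2 : probability T2 R).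
Context (Z1 : T1 -> R) (Z2 : T2 -> R) (f : T1 -> R) (g : T2 -> R).
Hypotheses (mZ1 : measurable_fun setT Z1) (mZ2 : measurable_fun setT Z2).
Hypotheses (bf : bounded_measurable f) (bg : bounded_measurable g).
Hypotheses (f0 : forall x, 0 <= f x) (g0 : forall x, 0 <= g x).

Lemma exp_half_lines_eq : \int[P1]_x f x = \int[P2]_x g x ->
  (forall y, \int[P1]_x ((Z1 x <= y)%R%:R * f x) = \int[P2]_x ((Z2 x <= y)%R%:R * g x)) ->
  forall A, measurable A ->
    \int[P1]_x (\1_A (Z1 x) * f x) = \int[P2]_x (\1_A (Z2 x) * g x).
Proof.
move=> fg hfg; apply: (exp_pi_system_eq mZ1 mZ2 bf bg f0 g0 (RGenOInfty.measurableE R)) => //.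
- move=> _ _ [x ->] [y ->]; exists (Num.max x y).
  by apply/seteqP; split => z; rewrite /= !in_itv/= !andbT gt_max => /andP.
- have ray d (T : measurableType d) (P : probability T R) (Z : T -> R) (h : T -> R) y :
      measurable_fun setT Z -> bounded_measurable h ->
      \int[P]_x (\1_(`]y, +oo[) (Z x) * h x) =
      \int[P]_x h x - \int[P]_x ((Z x <= y)%R%:R * h x).
    move=> mZ bh; rewrite -expB//; last first.
      apply: bounded_measurableM => //.
      rewrite (_ : (fun x => _) = \1_[set x | Z x <= y]).
        apply: bounded_measurable_indic.
        by rewrite -[X in measurable X]setTI; exact: measurable_fun_ler.
      by apply/funext => x; rewrite indicE mem_setE.
    apply: eq_Rintegral => x _; rewrite indicE mem_setE in_itv/= andbT ltNge.
    by case: (Z x <= y); rewrite ?mul0r ?mul1r ?subrr ?subr0.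
  by move=> _ [y ->]; rewrite !ray// fg hfg.
Qed.

End half_lines.

Section cdf_points.
Context d (T : measurableType d) (R : realType) (P : probability T R).
Variable Y : {RV P >-> R}.

Lemma quantileE v : quantile Y v = cdf_quantile (Fcdf Y) v.
Proof. by []. Qed.

Lemma bounded_measurable_lt y : bounded_measurable (fun w => (Y w < y)%R%:R : R).
Proof.
rewrite (_ : (fun w => _) = \1_[set w | Y w < y]).
  apply: bounded_measurable_indic.
  by rewrite -[X in measurable X]setTI; exact: measurable_fun_ltr.
by apply/funext => w; rewrite indicE mem_setE.
Qed.

Lemma exp_lt_le q c : (forall z, z < q -> Fcdf Y z <= c) ->
  \int[P]_w ((Y w < q)%R%:R) <= c.
Proof.
(* The sign is reversed because [exp_ge_lim] passes lower bounds to the limit; the events Y <= q -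
   1/(n+1) increase to Y < q. *)
move=> Fc; rewrite -lerN2 -[leRHS]mulN1r -expZ; last exact: bounded_measurable_lt.
apply: (@exp_ge_lim _ _ _ _ (fun n w => -1 * (Y w <= q - n.+1%:R^-1)%R%:R) _ 1).
- by move=> n; apply: measurable_funM => //; have [] := bounded_measurable_le Y (q - n.+1%:R^-1).
- by move=> n w; rewrite mulN1r normrN; case: (Y w <= _); rewrite ?normr1 ?normr0.
- by apply: measurable_funM => //; have [] := bounded_measurable_lt q.
- move=> w; have [Yq|qY] := ltP (Y w) q; last first.
    exists 0%N => n _; rewrite (_ : (Y w <= _) = false)//; apply/negbTE.
    by rewrite -ltNge; apply: lt_le_trans qY; rewrite ltrBlDr ltrDl.
  have d0 : 0 < q - Y w by rewrite subr_gt0.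
  exists (Num.truncn (q - Y w)^-1) => n Nn; rewrite (_ : (Y w <= _) = true)//.
  rewrite lerBrDr -lerBrDl ltW// invf_plt ?posrE//.
  by apply: lt_le_trans (truncnS_gt _) _; rewrite ler_nat.
- move=> n; rewrite expZ; last exact: bounded_measurable_le.
  rewrite exp_le_Fcdf mulN1r lerN2; apply: Fc.
  by rewrite ltrBlDr ltrDl.
Qed.

Lemma exp_lt_quantile v : 0 < v -> v < 1 -> \int[P]_w ((Y w < quantile Y v)%R%:R) <= v.
Proof.
move=> v0 v1; apply: exp_lt_le => z zq; apply/ltW.
exact: (cdf_quantile_lt (Fcdf_is_cdf Y)).
Qed.

(** With [q] the quantile at level [v] slightly below F_Y y, a value of [Y] in [[q, y]] that
    satisfies [D] is such a point. If there were none, almost surely Y <= y would imply Y < q, so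
    F_Y y <= P (Y < q) <= v. The cap by F_Y y / 2 keeps [v] positive. *)
Lemma cdf_point_near (D : R -> Prop) y e : (\forall z \ae distribution P Y, D z) ->
  0 < Fcdf Y y -> 0 < e -> exists z, [/\ D z, z <= y & Fcdf Y y - Fcdf Y z <= e].
Proof.
move=> aeD Fy0 e0; pose e' := Num.min e (Fcdf Y y / 2).
have e'0 : 0 < e' by rewrite lt_min e0 divr_gt0.
have e'e : e' <= e by rewrite ge_min lexx.
have e'F : e' <= Fcdf Y y / 2 by rewrite ge_min lexx orbT.
pose v := Fcdf Y y - e'; have /andP[F0 F1] := Fcdf01 Y y.
have v0 : 0 < v by rewrite /v; lra.
have v1 : v < 1 by rewrite /v; lra.
pose q := quantile Y v.
apply: contrapT => /forallNP nz.
have : \forall w \ae P, (Y w <= y)%R%:R <= (Y w < q)%R%:R :> R.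
  apply: filterS (ae_distribution aeD) => w Dw.
  have [Yy|//] := leP (Y w) y; have [//|qY] := ltP (Y w) q.
  exfalso; apply: (nz (Y w)); split => //.
  have : v <= Fcdf Y (Y w) by rewrite -(cdf_quantile_le _ (Fcdf_is_cdf Y)).
  by rewrite /v; lra.
move/(exp_ae_le (bounded_measurable_le Y y) (bounded_measurable_lt q)).
rewrite exp_le_Fcdf => /le_trans/(_ (exp_lt_quantile v0 v1)).
by rewrite /v; lra.
Qed.

(* E |S_y - S_z| = F_Y y - F_Y z for z <= y and S = S1, S2. *)
Lemma random_cdf_ae_eq S1 S2 : random_cdf Y S1 -> random_cdf Y S2 ->
  (\forall y \ae distribution P Y, \forall w \ae P, S1 w y = S2 w y) ->
  forall y, \forall w \ae P, S1 w y = S2 w y.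
Proof.
move=> rS1 rS2 aeS y; have [c1 m1 e1] := rS1; have [c2 m2 e2] := rS2.
have S101 := random_cdf01 rS1; have S201 := random_cdf01 rS2.
have b1 z : bounded_measurable (S1 ^~ z) := bounded_measurable_itv (m1 z) (S101 z).
have b2 z : bounded_measurable (S2 ^~ z) := bounded_measurable_itv (m2 z) (S201 z).
have bd z : bounded_measurable (fun w => `|S1 w z - S2 w z|).
  apply: (@bounded_measurable_itv _ _ _ _ 0 1).
    by apply: measurableT_comp => //; exact: measurable_funB.
  by move=> w; rewrite normr_ge0 ler_norml; have := S101 z w; have := S201 z w; lra.
suff : \int[P]_w `|S1 w y - S2 w y| = 0.
  move/(exp_eq0 (bd y) (fun w => normr_ge0 _)); apply: filterS => w.
  by move/eqP; rewrite normr_eq0 subr_eq0 => /eqP.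
apply/le_anti; rewrite exp_ge0// andbT; apply/ler_addgt0Pr => e e0; rewrite add0r.
have [Fy0|Fy0] := leP (Fcdf Y y) 0.
  apply: (@le_trans _ _ (\int[P]_w (S1 w y + S2 w y))).
    apply: exp_le => // [|w]; first exact: bounded_measurableD.
    by rewrite ler_norml; have := S101 y w; have := S201 y w; lra.
  by rewrite expD// e1 e2; lra.
have e2' : 0 < e / 2 by rewrite divr_gt0.
have [z [Sz zy Fz]] := cdf_point_near aeS Fy0 e2'.
apply: (@le_trans _ _ (\int[P]_w ((S1 w y - S1 w z) + (S2 w y - S2 w z)))).
  apply: exp_ae_le => //; first by apply: bounded_measurableD; exact: bounded_measurableB.
  apply: filterS Sz => w Sz; have [h1 _ _ _] := c1 w; have [h2 _ _ _] := c2 w.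
  by have := h1 _ _ zy; have := h2 _ _ zy; rewrite Sz ler_norml; lra.
rewrite expD ?expB//; try exact: bounded_measurableB.
by rewrite !e1 !e2; lra.
Qed.

End cdf_points.

(** * Comparison of conditional distribution functions *)

Section cx_relations.
Context d (T : measurableType d) (R : realType) (P : probability T R).
Variable Y : {RV P >-> R}.
Local Notation full := (fun w y => (Y w <= y)%R%:R : R).

Lemma cx01_ae_eq (S1 S2 : T -> R) : measurable_fun setT S1 -> measurable_fun setT S2 ->
  (forall w, 0 <= S1 w <= 1) -> (forall w, 0 <= S2 w <= 1) ->
  (\forall w \ae P, S1 w = S2 w) -> cx01 P S1 P S2.
Proof.
move=> mS1 mS2 S101 S201 S12 psi cpsi; rewrite (exp_ae_eq (f := psi \o S1) (g := psi \o S2))//.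
- exact: bounded_measurable_convex cpsi mS1 S101.
- exact: bounded_measurable_convex cpsi mS2 S201.
- by apply: filterS S12 => w /= ->.
Qed.

(** Jensen's inequality for conditioning on a constant, here the map to [tt]. *)
Lemma cx01_const S y : random_cdf Y S -> cx01 P (fun=> Fcdf Y y) P (S ^~ y).
Proof.
move=> rS psi cpsi; have [_ mS eS] := rS.
apply: (@jensen _ _ _ _ _ P (fun=> tt) (S ^~ y) (fun=> Fcdf Y y) psi) => //.
- by move=> w; exact: (random_cdf01 rS).
- by move=> _; exact: Fcdf01.
- move=> B mB; rewrite !expZ//.
  + by rewrite eS exp_cst.
  + exact: bounded_measurable_cst.
  + exact: bounded_measurable_itv (mS y) (random_cdf01 rS y).
Qed.

Section cond.
Context d' (T' : measurableType d') (X : {RV P >-> T'}).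

Lemma cond_cdf_is_cond_exp S y : random_cdf Y S ->
  (forall B, measurable B ->
    \int[P]_w (\1_B (X w) * (Y w <= y)%R%:R) = \int[P]_w (\1_B (X w) * S w y)) ->
  is_cond_exp P X (S ^~ y) (cond_cdf Y X ^~ y).
Proof. by move=> rS SE B mB; rewrite -SE// cond_S_exp. Qed.

Lemma measurable_cond_cdf y : measurable_fun setT (cond_cdf Y X ^~ y).
Proof. by have [_ /(_ y)[]] := cond_cdfP Y X. Qed.

Lemma cond_cdf01 y x : 0 <= cond_cdf Y X x y <= 1.
Proof. by have [/(_ x)/is_cdf_01] := cond_cdfP Y X. Qed.

Lemma cx01_cond_full y : cx01 P (cond_S Y X ^~ y) P (full ^~ y).
Proof.
move=> psi cpsi; have rS := random_cdf_full Y; have [_ mS _] := rS.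
apply: (@jensen _ _ _ _ _ P X (full ^~ y) (cond_cdf Y X ^~ y) psi) => //.
- exact: measurable_cond_cdf.
- by move=> w; exact: (random_cdf01 rS).
- by move=> x; exact: cond_cdf01.
- exact: (cond_cdf_is_cond_exp rS).
Qed.

Section finer.
Context d'' (T'' : measurableType d'') (X' : {RV P >-> T''}) (h : T'' -> T').
Hypotheses (mh : measurable_fun setT h) (hX : forall w, h (X' w) = X w).

(** The tower property. The finer variable is any [X'] of which [X] is a measurable function, which
    keeps tuples out of the argument. *)
Lemma finer_is_cond_exp y :
  is_cond_exp P X (cond_S Y X' ^~ y) (cond_cdf Y X ^~ y).
Proof.
apply: cond_cdf_is_cond_exp; first exact: random_cdf_cond.
move=> B mB; have := cond_S_exp Y X' y (_ : measurable (h @^-1` B)).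
rewrite -[X in measurable X]setTI => /(_ (mh measurableT mB)) E.
have ind w : \1_(h @^-1` B) (X' w) = \1_B (X w) :> R.
  by rewrite !indicE -hX; congr (_%:R); apply/idP/idP; rewrite !inE.
have eqi (u : T -> R) : \int[P]_w (\1_(h @^-1` B) (X' w) * u w) =
    \int[P]_w (\1_B (X w) * u w) by apply: eq_Rintegral => w _; rewrite ind.
by rewrite -!eqi.
Qed.

Lemma cx01_finer y : cx01 P (cond_S Y X ^~ y) P (cond_S Y X' ^~ y).
Proof.
move=> psi cpsi; have rS := random_cdf_cond Y X'; have [_ mS _] := rS.
apply: (@jensen _ _ _ _ _ P X (cond_S Y X' ^~ y) (cond_cdf Y X ^~ y) psi) => //.
- exact: measurable_cond_cdf.
- by move=> w; exact: (random_cdf01 rS).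
- by move=> x; exact: cond_cdf01.
- exact: finer_is_cond_exp.
Qed.

Lemma finer_strict (psi : R -> R) y : convex_on 0 1 psi -> strictly_convex `[0, 1] psi ->
  \int[P]_w psi (cond_S Y X w y) = \int[P]_w psi (cond_S Y X' w y) ->
  \forall w \ae P, cond_S Y X w y = cond_S Y X' w y.
Proof.
move=> cpsi spsi psiE; have rS := random_cdf_cond Y X'; have [_ mS _] := rS.
have := @jensen_strict _ _ _ _ _ P X (cond_S Y X' ^~ y) (cond_cdf Y X ^~ y) psi.
move=> /(_ (measurable_funPT X) (mS y) (measurable_cond_cdf y) (random_cdf01 rS y)).
move=> /(_ (cond_cdf01 y) (finer_is_cond_exp y) cpsi spsi psiE).
exact: filterS.
Qed.

End finer.

(** With [I] the indicator of Y <= y, pulling out gives E (S I) = E S^2, and S^2 = S has mean F_Y y.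
    Expanding the square then yields E (S - I)^2 = 0. *)
Lemma cond_S_extreme y : (\forall w \ae P, cond_S Y X w y = 0 \/ cond_S Y X w y = 1) ->
  \forall w \ae P, cond_S Y X w y = (Y w <= y)%R%:R.
Proof.
move=> ext; pose S w := cond_S Y X w y.
have rS := random_cdf_cond Y X; have [_ mS eS] := rS.
have bS : bounded_measurable S := bounded_measurable_itv (mS y) (random_cdf01 rS y).
have bF := bounded_measurable_le Y y.
have bc : bounded_measurable (cond_cdf Y X ^~ y).
  exact: bounded_measurable_itv (measurable_cond_cdf y) (cond_cdf01 y).
have pull : \int[P]_w (S w * (Y w <= y)%R%:R) = \int[P]_w (S w * S w).
  have rF := random_cdf_full Y; have [_ mF _] := rF.
  have cE : is_cond_exp P X (full ^~ y) (cond_cdf Y X ^~ y).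
    exact: (cond_cdf_is_cond_exp rF).
  exact: (cond_exp_pull_out (measurable_funPT X) (mF y) (measurable_cond_cdf y)
    (random_cdf01 rF y) (cond_cdf01 y) cE bc).
have SS : \int[P]_w (S w * S w) = Fcdf Y y.
  rewrite -(eS y); apply: exp_ae_eq => //; first exact: bounded_measurableM.
  by apply: filterS ext => w; rewrite /S => -[|] ->; rewrite ?mulr0 ?mulr1.
apply: (exp_sqr_eq0 bS bF).
have -> : \int[P]_w (S w - (Y w <= y)%R%:R) ^+ 2 =
  \int[P]_w ((S w * S w + (Y w <= y)%R%:R) - 2 * (S w * (Y w <= y)%R%:R)).
  apply: eq_Rintegral => w _; case: (Y w <= y); rewrite ?mulr1n ?mulr0n; ring.
have bSS := bounded_measurableM bS bS; have bSF := bounded_measurableM bS bF.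
have b2 := bounded_measurableM (bounded_measurable_cst T 2) bSF.
rewrite expB//; last exact: bounded_measurableD.
rewrite expD// expZ//.
by rewrite exp_le_Fcdf pull SS; ring.
Qed.

End cond.
End cx_relations.

(** * Equality cases for a fixed y *)

Section equality_cases.
Context d (T : measurableType d) (R : realType) (P : probability T R) (phi : R -> R).
Hypothesis cphi : convex_on (-1) 1 phi.
Hypothesis sphi : strictly_convex_at0 `[-1, 1]%classic phi.
Hypothesis phi0 : phi 0 = 0.

(** The support line at 0 has mean 0 along [D], so [phi (D)] coincides with it almost surely. By
    [touch_one_sided] this happens on one side of 0 only, and a variable of constant sign with mean
    0 vanishes. *)
Lemma exp_phi_le0 (D : T -> R) : measurable_fun setT D -> (forall w, -1 <= D w <= 1) ->
  \int[P]_w D w = 0 -> \int[P]_w phi (D w) <= 0 -> \forall w \ae P, D w = 0.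
Proof.
move=> mD D11 ED EphiD; pose m := left_slope (-1) phi 0.
have bD := bounded_measurable_itv mD D11.
have bphi : bounded_measurable (fun w => phi (D w)).
  exact: bounded_measurable_convex cphi mD D11.
have bmD : bounded_measurable (fun w => m * D w).
  exact/bounded_measurableM/bD/bounded_measurable_cst.
have touch : \forall w \ae P, phi (D w) = m * D w.
  have ge w : m * D w <= phi (D w).
    have := left_slope_support cphi (ltrN10 R) (ltr01 : 0 < 1 :> R) (D11 w).
    by rewrite phi0 add0r subr0.
  have : \forall w \ae P, m * D w = phi (D w).
    apply: exp_le_eq => //; apply/le_anti; rewrite exp_le//=.
    by rewrite expZ// ED mulr0.
  by apply: filterS => w ->.
have [[x [x1 x0 xE]]|neg] := pselect (exists x, [/\ -1 <= x <= 1, x < 0 & phi x = m * x]).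
  have le0 : \forall w \ae P, D w <= 0.
    apply: filterS touch => w Dw; rewrite leNgt; apply/negP => D0.
    exact: (touch_one_sided sphi phi0 x1 (D11 w) x0 D0 xE Dw).
  have : \int[P]_w `|D w| = 0.
    rewrite (@exp_ae_eq _ _ _ _ _ (fun w => 0 - D w)).
    - by rewrite expB ?exp_cst ?ED ?subr0//; exact: bounded_measurable_cst.
    - split; first by apply: measurableT_comp.
      by have [_ [M DM]] := bD; exists M => w; rewrite normr_id.
    - exact/bounded_measurableB/bD/bounded_measurable_cst.
    - by apply: filterS le0 => w Dw; rewrite ler0_norm// sub0r.
  move/exp_eq0 => h; have {}h := h _ (fun w => normr_ge0 (D w)).
  have /h : bounded_measurable (fun w => `|D w|).
    split; first by apply: measurableT_comp.
    by have [_ [M DM]] := bD; exists M => w; rewrite normr_id.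
  by apply: filterS => w /eqP; rewrite normr_eq0 => /eqP.
have ge0 : \forall w \ae P, D w = `|D w|.
  apply: filterS touch => w Dw; rewrite ger0_norm// leNgt; apply/negP => D0.
  by apply: neg; exists (D w).
have bn : bounded_measurable (fun w => `|D w|).
  split; first by apply: measurableT_comp.
  by have [_ [M DM]] := bD; exists M => w; rewrite normr_id.
have : \int[P]_w `|D w| = 0 by rewrite -ED; apply: exp_ae_eq => //; apply: filterS ge0 => w <-.
move/(exp_eq0 bn (fun w => normr_ge0 (D w))).
by apply: filterS => w /eqP; rewrite normr_eq0 => /eqP.
Qed.

(** The chord [c] is affine and agrees with phi (u - a) at u = 0, 1, hence E c(S) = c(E S) = c(E I)
    = E phi (I - a). Equality with E phi (S - a) puts [S] on the chord, which [chord_strict] allows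
    only at 0 and 1. *)
Lemma exp_chord_eq (S I : T -> R) a : 0 < a < 1 -> measurable_fun setT S ->
  (forall w, 0 <= S w <= 1) -> measurable_fun setT I -> (forall w, I w = 0 \/ I w = 1) ->
  \int[P]_w S w = \int[P]_w I w ->
  \int[P]_w phi (S w - a) = \int[P]_w phi (I w - a) ->
  \forall w \ae P, S w = 0 \/ S w = 1.
Proof.
move=> a01 mS S01 mI I01 SI phiE; pose c u := u * phi (1 - a) + (1 - u) * phi (- a).
have I01' w : 0 <= I w <= 1 by case: (I01 w) => ->; rewrite lexx ler01.
have bS := bounded_measurable_itv mS S01; have bI := bounded_measurable_itv mI I01'.
have Ec (u : T -> R) : bounded_measurable u ->
    bounded_measurable (fun w => c (u w)) /\ \int[P]_w c (u w) = c (\int[P]_w u w).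
  move=> bu; have cE w : c (u w) = (phi (1 - a) - phi (- a)) * u w + phi (- a).
    by rewrite /c; ring.
  have b1 : bounded_measurable (fun w => (phi (1 - a) - phi (- a)) * u w).
    exact/bounded_measurableM/bu/bounded_measurable_cst.
  have b2 := bounded_measurable_cst T (phi (- a)).
  have -> : (fun w => c (u w)) = fun w => (phi (1 - a) - phi (- a)) * u w + phi (- a).
    exact/funext.
  by split; [exact: bounded_measurableD|rewrite expD// expZ// exp_cst /c; ring].
have phic u : 0 <= u <= 1 -> phi (u - a) <= c u.
  move=> /andP[u0 u1]; have [->|u0'] := eqVneq u 0; first by rewrite /c sub0r; lra.
  have [->|u1'] := eqVneq u 1; first by rewrite /c; lra.
  apply/ltW; apply: (chord_strict cphi sphi phi0) => //.
  by rewrite !lt_neqAle eq_sym u0' u0 u1' u1.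
have bphiS : bounded_measurable (fun w => phi (S w - a)).
  have a01' : 0 <= a <= 1 by lra.
  exact: (bounded_measurable_convex (convex_shift cphi a01') mS S01).
have [bcS ES] := Ec _ bS; have [_ EI] := Ec _ bI.
have : \forall w \ae P, phi (S w - a) = c (S w).
  apply: exp_le_eq => // [w|]; first exact: phic.
  rewrite phiE ES SI -EI; apply: eq_Rintegral => w _.
  by rewrite /c; case: (I01 w) => ->; [rewrite sub0r|]; lra.
apply: filterS => w phicE; have /andP[s0 s1] := S01 w.
rewrite le_eqVlt in s0; case/predU1P: s0 => [<-|s0]; first by left.
rewrite le_eqVlt in s1; case/predU1P: s1 => [->|s1]; first by right.
have s01 : 0 < S w < 1 by rewrite s0.
by have := chord_strict cphi sphi phi0 a01 s01; rewrite phicE ltxx.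
Qed.

End equality_cases.

(** * The numerators of the coefficients *)

Lemma ae_exists d (T : measurableType d) (R : realType) (P : probability T R)
    (Q : T -> Prop) : (\forall w \ae P, Q w) -> exists w, Q w.
Proof.
move=> [N [mN N0 QN]]; apply: contrapT => /forallNP nQ.
have NT : N = setT by apply/seteqP; split => // w _; apply: QN; exact: nQ.
have := probability_setT P; rewrite -NT [X in X = _]N0 => /esym/eqP.
by rewrite onee_eq0.
Qed.

Section coefficients.
Context {R : realType} (phi : R -> R).
Hypothesis cphi : convex_on (-1) 1 phi.
Context d (T : measurableType d) (P : probability T R) (Y : {RV P >-> R}).
Local Notation PY := (distribution P Y).
Local Notation F := (Fcdf Y).
Local Notation full := (fun w y => (Y w <= y)%R%:R : R).

Definition xi_int (S : T -> R -> R) := \int[PY]_y \int[P]_w phi (S w y - F y).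

Definition Lambda_int (S : T -> R -> R) := \int[PY]_y exp2 phi P (S ^~ y) P (S ^~ y).

Section swap.
Context d' (T' : measurableType d') (G : T' -> R -> R).
Hypotheses (cG : forall x, is_cdf (G x)) (mG : forall y, measurable_fun setT (G ^~ y)).

Let mG2 : measurable_fun setT (fun z : T' * R => G z.1 z.2).
Proof. exact: measurable_random_cdf. Qed.

Lemma bounded_measurable_xi_integrand :
  bounded_measurable (fun z : T' * R => phi (G z.1 z.2 - F z.2)).
Proof.
apply: (bounded_measurable_convex cphi).
  apply: measurable_funB => //; apply: measurableT_comp => //; exact: measurable_Fcdf.
by move=> z; have := is_cdf_01 z.2 (cG z.1); have := Fcdf01 Y z.2; lra.
Qed.

Lemma bounded_measurable_Lambda_integrand :
  bounded_measurable (fun z : (T' * T') * R => phi (G z.1.1 z.2 - G z.1.2 z.2)).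
Proof.
apply: (bounded_measurable_convex cphi).
  apply: measurable_funB.
    apply: (measurableT_comp mG2 (_ : measurable_fun setT (fun z : (T' * T') * R => (z.1.1, z.2)))).
    by apply: measurable_fun_pair => //; exact: measurableT_comp.
  apply: (measurableT_comp mG2 (_ : measurable_fun setT (fun z : (T' * T') * R => (z.1.2, z.2)))).
  by apply: measurable_fun_pair => //; exact: measurableT_comp.
by move=> z; have := is_cdf_01 z.2 (cG z.1.1); have := is_cdf_01 z.2 (cG z.1.2); lra.
Qed.

Lemma xi_int_swap (X : {RV P >-> T'}) :
  \int[distribution P X]_x \int[PY]_y phi (G x y - F y) = xi_int (G \o X).
Proof.
have bf := bounded_measurable_xi_integrand.
rewrite (exp_fubini (distribution P X) PY bf); apply: eq_Rintegral => y _.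
by rewrite (exp_distribution X (bounded_measurable_section2 bf y)).
Qed.

Lemma Lambda_int_swap (X : {RV P >-> T'}) (PX := distribution P X) :
  \int[(PX \x PX)%E]_u \int[PY]_y phi (G u.1 y - G u.2 y) = Lambda_int (G \o X).
Proof.
have bf := bounded_measurable_Lambda_integrand.
rewrite (exp_fubini (PX \x PX)%E PY bf); apply: eq_Rintegral => y _.
have by2 := bounded_measurable_section2 bf y.
rewrite (exp_product PX PX by2)/=.
have b1 := bounded_measurable_exp1 PX PX by2.
rewrite (exp_distribution X b1) /exp2; apply: eq_Rintegral => w _.
by rewrite (exp_distribution X (bounded_measurable_section1 by2 (X w))).
Qed.

End swap.

Lemma measurable_step y : measurable_fun setT (fun y1 : R => (y1 <= y)%R%:R : R).
Proof.
rewrite (_ : (fun y1 => _) = \1_[set y1 : R | y1 <= y]).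
  by apply: measurable_indic; rewrite -[X in measurable X]setTI; exact: measurable_fun_ler.
by apply/funext => y1; rewrite indicE mem_setE.
Qed.

(** The normalizing constant is the numerator for X = Y, whose conditional distribution function is
    a unit step at the value of [Y]. *)
Lemma alphaE : alpha phi Y = xi_int full.
Proof. exact: (xi_int_swap (@step_is_cdf R) measurable_step Y). Qed.

Lemma betaE : beta phi Y = Lambda_int full.
Proof. exact: (Lambda_int_swap (@step_is_cdf R) measurable_step Y). Qed.

Lemma xiE p (X : {RV P >-> p.-tuple R}) :
  xi phi Y X = (xi_int full)^-1 * xi_int (cond_S Y X).
Proof.
rewrite /xi alphaE; congr (_ * _); apply: xi_int_swap.
  by have [] := cond_cdfP Y X.
exact: measurable_cond_cdf.
Qed.

Lemma LambdaE p (X : {RV P >-> p.-tuple R}) :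
  Lambda phi Y X = (Lambda_int full)^-1 * Lambda_int (cond_S Y X).
Proof.
rewrite /Lambda betaE; congr (_ * _); apply: Lambda_int_swap.
  by have [] := cond_cdfP Y X.
exact: measurable_cond_cdf.
Qed.

Section random_cdf.
Variable S : T -> R -> R.
Hypothesis rS : random_cdf Y S.

Lemma bounded_measurable_xi_y : bounded_measurable (fun y => \int[P]_w phi (S w y - F y)).
Proof.
have [cS mS _] := rS.
exact: (bounded_measurable_exp2 P PY (bounded_measurable_xi_integrand cS mS)).
Qed.

Lemma bounded_measurable_Lambda_y : bounded_measurable (fun y => exp2 phi P (S ^~ y) P (S ^~ y)).
Proof.
have [cS mS _] := rS; have bf := bounded_measurable_Lambda_integrand cS mS.
have := bounded_measurable_exp2 (P \x P)%E PY bf.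
congr bounded_measurable; apply/funext => y.
exact: (exp_product P P (bounded_measurable_section2 bf y)).
Qed.

End random_cdf.

Section compare.
Variables S1 S2 : T -> R -> R.
Hypotheses (rS1 : random_cdf Y S1) (rS2 : random_cdf Y S2).
Hypothesis cx : forall y, cx01 P (S1 ^~ y) P (S2 ^~ y).

Let S101 := random_cdf01 rS1.
Let S201 := random_cdf01 rS2.

Lemma xi_le_y y : \int[P]_w phi (S1 w y - F y) <= \int[P]_w phi (S2 w y - F y).
Proof. exact: (cx y (convex_shift cphi (Fcdf01 Y y))). Qed.

Lemma Lambda_le_y y : exp2 phi P (S1 ^~ y) P (S1 ^~ y) <= exp2 phi P (S2 ^~ y) P (S2 ^~ y).
Proof. by have [_ m1 _] := rS1; have [_ m2 _] := rS2; exact: exp2_le. Qed.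

Lemma xi_int_le : xi_int S1 <= xi_int S2.
Proof. by apply: exp_le; [exact: bounded_measurable_xi_y..|exact: xi_le_y]. Qed.

Lemma Lambda_int_le : Lambda_int S1 <= Lambda_int S2.
Proof. by apply: exp_le; [exact: bounded_measurable_Lambda_y..|exact: Lambda_le_y]. Qed.

Lemma xi_int_eq : xi_int S1 = xi_int S2 -> \forall y \ae PY,
  \int[P]_w phi (S1 w y - F y) = \int[P]_w phi (S2 w y - F y).
Proof. by apply: exp_le_eq; [exact: bounded_measurable_xi_y..|exact: xi_le_y]. Qed.

(** The mixed integral with [S2] in the first place and [S1] in the second lies between the two
    equal ones. So changing the first copy alone is already an equality, and for a fixed value of
    the second copy this is an equality of the kind met for xi. *)
Lemma Lambda_int_eq : Lambda_int S1 = Lambda_int S2 -> \forall y \ae PY,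
  \forall w2 \ae P, \int[P]_w1 phi (S1 w1 y - S1 w2 y) = \int[P]_w1 phi (S2 w1 y - S1 w2 y).
Proof.
have [_ m1 _] := rS1; have [_ m2 _] := rS2.
move/exp_le_eq => h.
have {}h := h (bounded_measurable_Lambda_y rS1) (bounded_measurable_Lambda_y rS2) Lambda_le_y.
apply: filterS h => y eqy.
have r1 := S101 y; have r2 := S201 y.
apply: (exp2_lel_eq cphi (m1 y) r1 (m2 y) r2 (m1 y) r1 (cx y)).
apply/le_anti/andP; split; first exact: (exp2_lel cphi P (m1 y) r1 (m2 y) r2 (m1 y) r1 (cx y)).
by rewrite eqy; exact: (exp2_ler cphi P (m1 y) r1 (m2 y) r2 (m2 y) r2 (cx y)).
Qed.

End compare.

Lemma xi_int_ae_eq S1 S2 : random_cdf Y S1 -> random_cdf Y S2 ->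
  (forall y, \forall w \ae P, S1 w y = S2 w y) ->
  xi_int S1 = xi_int S2 /\ Lambda_int S1 = Lambda_int S2.
Proof.
move=> rS1 rS2 S12; have [_ m1 _] := rS1; have [_ m2 _] := rS2.
have cx12 y : cx01 P (S1 ^~ y) P (S2 ^~ y).
  by apply: cx01_ae_eq => //; [exact: (random_cdf01 rS1)|exact: (random_cdf01 rS2)].
have cx21 y : cx01 P (S2 ^~ y) P (S1 ^~ y).
  apply: cx01_ae_eq => //; [exact: (random_cdf01 rS2)|exact: (random_cdf01 rS1)|].
  by apply: filterS (S12 y) => w ->.
split; apply/le_anti/andP; split.
- exact: (xi_int_le rS1 rS2 cx12).
- exact: (xi_int_le rS2 rS1 cx21).
- exact: (Lambda_int_le rS1 rS2 cx12).
- exact: (Lambda_int_le rS2 rS1 cx21).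
Qed.

Hypothesis sphi : strictly_convex_at0 `[-1, 1]%classic phi.
Hypothesis phi0 : phi 0 = 0.

Lemma xi_int_const : xi_int (fun=> F) = 0.
Proof.
rewrite -[RHS](exp_cst PY); apply: eq_Rintegral => y _.
by rewrite subrr phi0 exp_cst.
Qed.

Lemma Lambda_int_const : Lambda_int (fun=> F) = 0.
Proof.
rewrite -[RHS](exp_cst PY); apply: eq_Rintegral => y _.
by rewrite /exp2 subrr phi0 !exp_cst.
Qed.

Lemma xi_int_ge0 S : random_cdf Y S -> 0 <= xi_int S.
Proof.
move=> rS; rewrite -xi_int_const; apply: xi_int_le => //; first exact: random_cdf_const.
by move=> y; exact: cx01_const.
Qed.

Lemma Lambda_int_ge0 S : random_cdf Y S -> 0 <= Lambda_int S.
Proof.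
move=> rS; rewrite -Lambda_int_const; apply: Lambda_int_le => //; first exact: random_cdf_const.
by move=> y; exact: cx01_const.
Qed.

Lemma xi_int_eq0 S : random_cdf Y S -> xi_int S = 0 ->
  forall y, \forall w \ae P, S w y = F y.
Proof.
move=> rS xi0; have [cS mS eS] := rS; have rc := random_cdf_const Y.
apply: random_cdf_ae_eq => //.
have := xi_int_eq rc rS (fun y => cx01_const y rS).
rewrite xi0 xi_int_const => /(_ erefl); apply: filterS => y.
rewrite subrr phi0 exp_cst => E0.
have S01 := random_cdf01 rS y; have F01 := Fcdf01 Y y.
have bS := bounded_measurable_itv (mS y) S01; have bc := bounded_measurable_cst T (F y).
have := @exp_phi_le0 _ _ _ P phi cphi sphi phi0 (fun w => S w y - F y).
have mD : measurable_fun setT (fun w => S w y - F y) by exact: measurable_funB.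
have D11 w : -1 <= S w y - F y <= 1 by have := S01 w; lra.
have ED : \int[P]_w (S w y - F y) = 0 by rewrite expB// eS exp_cst subrr.
move=> /(_ mD D11 ED); rewrite -E0 lexx => /(_ isT).
by apply: filterS => w /eqP; rewrite subr_eq0 => /eqP.
Qed.

(** Replacing only the first copy by the constant F_Y y lowers the integral, so E phi (F_Y y - S_y)
    <= 0 and [exp_phi_le0] applies to a single variable. *)
Lemma Lambda_int_eq0 S : random_cdf Y S -> Lambda_int S = 0 ->
  forall y, \forall w \ae P, S w y = F y.
Proof.
move=> rS L0; have [cS mS eS] := rS; have rc := random_cdf_const Y.
apply: random_cdf_ae_eq => //.
have h : \forall y \ae PY, exp2 phi P (fun=> F y) P (fun=> F y) = exp2 phi P (S ^~ y) P (S ^~ y).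
  apply: exp_le_eq.
  - exact: (bounded_measurable_Lambda_y rc).
  - exact: (bounded_measurable_Lambda_y rS).
  - by move=> y; exact: (Lambda_le_y rc rS (fun y => cx01_const y rS)).
  - by rewrite -/(Lambda_int (fun=> F)) -/(Lambda_int S) L0 Lambda_int_const.
apply: filterS h => y E0.
have S01 := random_cdf01 rS y; have F01 := Fcdf01 Y y.
have bS := bounded_measurable_itv (mS y) S01; have bc := bounded_measurable_cst T (F y).
have := @exp_phi_le0 _ _ _ P phi cphi sphi phi0 (fun w => F y - S w y).
have mD : measurable_fun setT (fun w => F y - S w y) by exact: measurable_funB.
have D11 w : -1 <= F y - S w y <= 1 by have := S01 w; lra.
have ED : \int[P]_w (F y - S w y) = 0 by rewrite expB// eS exp_cst subrr.
have le0 : \int[P]_w phi (F y - S w y) <= 0.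
  have : exp2 phi P (fun=> F y) P (S ^~ y) <= exp2 phi P (S ^~ y) P (S ^~ y).
    have mc : measurable_fun setT (fun _ : T => F y) by exact: measurable_cst.
    exact: (exp2_lel cphi P mc (fun=> F01) (mS y) S01 (mS y) S01 (cx01_const y rS)).
  by rewrite -E0 /exp2 !exp_cst subrr phi0.
move=> /(_ mD D11 ED le0).
by apply: filterS => w /eqP; rewrite subr_eq0 => /eqP.
Qed.

Section full.
Context d' (T' : measurableType d') (X : {RV P >-> T'}).

Let rS := random_cdf_cond Y X.
Let rF := random_cdf_full Y.

(** The chord argument needs 0 < F_Y y < 1. Otherwise the mean 0 or 1 already makes the
    [0, 1]-valued variable constant. *)
Let extreme y : (0 < F y < 1 -> \forall w \ae P, cond_S Y X w y = 0 \/ cond_S Y X w y = 1) ->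
  \forall w \ae P, cond_S Y X w y = (Y w <= y)%R%:R.
Proof.
move=> mid; apply: cond_S_extreme; have [_ mS eS] := rS.
have S01 := random_cdf01 rS y; have bS := bounded_measurable_itv (mS y) S01.
have [F0 F1] := andP (Fcdf01 Y y).
have [F0'|F0'] := eqVneq (F y) 0.
  have : \forall w \ae P, cond_S Y X w y = 0.
    have ge0 w : 0 <= cond_S Y X w y by case/andP: (S01 w).
    by have E0 := eS y; rewrite F0' in E0; exact: (exp_eq0 bS ge0 E0).
  by apply: filterS => w; left.
have [F1'|F1'] := eqVneq (F y) 1; last by apply: mid; rewrite !lt_neqAle eq_sym F0' F0 F1' F1.
have bc := bounded_measurable_cst T (1 : R).
have : \forall w \ae P, 1 - cond_S Y X w y = 0.
  apply: exp_eq0; first exact: bounded_measurableB.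
    by move=> w; rewrite subr_ge0; case/andP: (S01 w).
  by rewrite expB// eS exp_cst F1' subrr.
by apply: filterS => w /eqP; rewrite subr_eq0 => /eqP <-; right.
Qed.

Let full01 w y : (Y w <= y)%R%:R = 0 :> R \/ (Y w <= y)%R%:R = 1 :> R.
Proof. by case: (Y w <= y); [right|left]. Qed.

Lemma xi_int_eq_full : xi_int (cond_S Y X) = xi_int full ->
  forall y, \forall w \ae P, cond_S Y X w y = (Y w <= y)%R%:R.
Proof.
move=> /(xi_int_eq rS rF (cx01_cond_full Y X)) h.
apply: (random_cdf_ae_eq rS rF); apply: filterS h => y phiE.
have [_ mS eS] := rS; have [_ mF eF] := rF.
apply: extreme => Fy.
by apply: (exp_chord_eq cphi sphi phi0 Fy (mS y) (random_cdf01 rS y) (mF y)) => //;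
   rewrite eS eF.
Qed.

(** Either some good [w2] has a value of U_y in []0, 1[], which serves as the shift [a] of the chord
    argument, or almost every value is 0 or 1, which is the claim itself. *)
Lemma Lambda_int_eq_full : Lambda_int (cond_S Y X) = Lambda_int full ->
  forall y, \forall w \ae P, cond_S Y X w y = (Y w <= y)%R%:R.
Proof.
move=> /(Lambda_int_eq rS rF (cx01_cond_full Y X)) h.
apply: (random_cdf_ae_eq rS rF); apply: filterS h => y phiE.
have [_ mS eS] := rS; have [_ mF eF] := rF.
apply: extreme => Fy.
have [[w2 [Sw2 phiw2]]|nw] := pselect (exists w2, 0 < cond_S Y X w2 y < 1 /\
   \int[P]_w1 phi (cond_S Y X w1 y - cond_S Y X w2 y) =
   \int[P]_w1 phi ((Y w1 <= y)%R%:R - cond_S Y X w2 y)).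
  by apply: (exp_chord_eq cphi sphi phi0 Sw2 (mS y) (random_cdf01 rS y) (mF y)) => //;
     rewrite eS eF.
apply: filterS phiE => w2 phiw2; have [S0 S1] := andP (random_cdf01 rS y w2).
have [|S0'] := eqVneq (cond_S Y X w2 y) 0; first by left.
have [|S1'] := eqVneq (cond_S Y X w2 y) 1; first by right.
by exfalso; apply: nw; exists w2; rewrite !lt_neqAle eq_sym S0' S0 S1' S1.
Qed.

End full.

Section finer.
Context d' (T' : measurableType d') (X : {RV P >-> T'}).
Context d'' (T'' : measurableType d'') (X' : {RV P >-> T''}) (h : T'' -> T').
Hypotheses (mh : measurable_fun setT h) (hX : forall w, h (X' w) = X w).
Hypothesis scphi : strictly_convex `[-1, 1]%classic phi.

Let rS := random_cdf_cond Y X.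
Let rS' := random_cdf_cond Y X'.

Let strict_shift a : 0 <= a <= 1 -> strictly_convex `[0, 1]%classic (fun s => phi (s - a)).
Proof.
move=> a01 x y t; rewrite /= !in_itv/= => x01 y01 xy t0 t1.
have -> : t * x + (1 - t) * y - a = t * (x - a) + (1 - t) * (y - a) by ring.
apply: scphi => //=; first by rewrite in_itv/=; lra.
  by rewrite in_itv/=; lra.
by apply: contra xy => /eqP h'; apply/eqP; lra.
Qed.

Lemma xi_int_eq_finer : xi_int (cond_S Y X) = xi_int (cond_S Y X') ->
  forall y, \forall w \ae P, cond_S Y X w y = cond_S Y X' w y.
Proof.
move=> /(xi_int_eq rS rS' (cx01_finer Y mh hX)) h1.
apply: (random_cdf_ae_eq rS rS'); apply: filterS h1 => y phiE.
exact: (finer_strict mh hX (convex_shift cphi (Fcdf01 Y y)) (strict_shift (Fcdf01 Y y)) phiE).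
Qed.

Lemma Lambda_int_eq_finer : Lambda_int (cond_S Y X) = Lambda_int (cond_S Y X') ->
  forall y, \forall w \ae P, cond_S Y X w y = cond_S Y X' w y.
Proof.
move=> /(Lambda_int_eq rS rS' (cx01_finer Y mh hX)) h1.
(* One good [w2] is enough, since the shift of phi by any value in [0, 1] is strictly convex. *)
apply: (random_cdf_ae_eq rS rS'); apply: filterS h1 => y /ae_exists[w2 phiE].
have S01 := random_cdf01 rS y w2.
exact: (finer_strict mh hX (convex_shift cphi S01) (strict_shift S01) phiE).
Qed.

End finer.

End coefficients.

(** * Independence, functional dependence, conditional independence *)

Lemma rat_le_eq {R : realType} (x y : R) :
  (forall r : rat, (x <= ratr r) = (y <= ratr r)) -> x = y.
Proof.
wlog xy : x y / x <= y.
  move=> H h; have [/H|/ltW/H h'] := leP x y; first exact.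
  by apply/esym/h'.
move=> h; apply/le_anti; rewrite xy/= leNgt; apply/negP => /rat_in_itvoo[r /itvP rxy].
by have := h r; rewrite [x <= _]ltW ?rxy// leNgt rxy.
Qed.

Section conditioning.
Context d (T : measurableType d) (R : realType) (P : probability T R).
Variable Y : {RV P >-> R}.
Local Notation F := (Fcdf Y).
Local Notation full := (fun w y => (Y w <= y)%R%:R : R).

(** Outside one null set the indicators at all rationals equal constants, so any two values of [Y]
    there have the same rational upper bounds. This yields the positivity of the normalizing
    constants. *)
Lemma degenerate_full : (forall y, \forall w \ae P, (Y w <= y)%R%:R = F y) -> degenerate Y.
Proof.
move=> YF; have h : \forall w \ae P, forall r : rat, (Y w <= ratr r)%R%:R = F (ratr r).
  by apply: ae_forall_countable => r; exact: YF.
have [w0 hw0] := ae_exists h; exists (Y w0).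
apply: filterS h => w hw; apply: rat_le_eq => r.
have : (Y w <= ratr r)%R%:R = (Y w0 <= ratr r)%R%:R :> R by rewrite hw hw0.
by case: (Y w <= _); case: (Y w0 <= _) => // /eqP; rewrite ?oner_eq0// eq_sym oner_eq0.
Qed.

Section given.
Context d' (T' : measurableType d') (X : {RV P >-> T'}).

Lemma cond_S_version y g : is_cond_prob X [set w | Y w <= y] g ->
  \forall w \ae P, cond_S Y X w y = g (X w).
Proof.
move=> gP; have [_ /(_ y) FP] := cond_cdfP Y X.
exact: (ae_distribution (cond_prob_unique (measurable_le Y y) FP gP)).
Qed.

(** Constancy of F_{Y|X} says that P (Y <= y, X in B) factorizes; for fixed [B], half-lines
    determine both sides as measures in [A]. *)
Lemma independent_cond_S : independent Y X <-> forall y, \forall w \ae P, cond_S Y X w y = F y.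
Proof.
have mX := measurable_funPT X; have bX B (mB : measurable B) :=
  bounded_measurable_comp mX (bounded_measurable_indic R mB).
have indX B w : \1_(X @^-1` B) w = \1_B (X w) :> R.
  by rewrite !indicE; congr (_%:R); apply/idP/idP; rewrite !inE.
have EX B : measurable B -> \int[P]_w \1_B (X w) = fine (P (X @^-1` B)).
  move=> mB; rewrite -exp_indic; last exact: measurable_funPTI.
  by apply: eq_Rintegral => w _; rewrite indX.
split=> [ind y|SF A B mA mB].
- apply: (@cond_S_version y (fun=> F y)); apply/is_cond_probP.
  + exact: measurable_le.
  + exact: measurable_cst.
  + by move=> _; exact: Fcdf01.
  + move=> B mB; rewrite exp_indicI//; last exact: measurable_le.
    under [RHS]eq_Rintegral do rewrite mulrC.
    rewrite expZ; last exact: bX.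
    have YE : [set w | Y w <= y] = Y @^-1` `]-oo, y].
      by apply/seteqP; split => w; rewrite /= in_itv.
    rewrite EX// FcdfE YE -fineM ?fin_num_measure//; last 2 first.
    - exact: measurable_funPTI.
    - exact: measurable_funPTI.
    by rewrite -ind.
- pose c := fine (P (X @^-1` B)).
  have c0 : 0 <= c by rewrite fine_ge0.
  have bc := bounded_measurable_cst T c.
  have main : \int[P]_w (\1_A (Y w) * \1_B (X w)) = \int[P]_w (\1_A (Y w) * c).
    apply: (exp_half_lines_eq (measurable_funPT Y) (measurable_funPT Y) (bX _ mB) bc) => //.
    + by rewrite EX// exp_cst.
    + move=> y; under [LHS]eq_Rintegral do rewrite mulrC.
      rewrite (cond_S_exp Y X y mB).
      have bS : bounded_measurable (cond_S Y X ^~ y).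
        have [_ mS _] := random_cdf_cond Y X.
        exact: (bounded_measurable_itv (mS y) (random_cdf01 (random_cdf_cond Y X) y)).
      rewrite (@exp_ae_eq _ _ _ _ _ (fun w => F y * \1_B (X w))); first last.
      * by apply: filterS (SF y) => w ->; rewrite mulrC.
      * exact: bounded_measurableM (bounded_measurable_cst T _) (bX _ mB).
      * exact: bounded_measurableM (bX _ mB) bS.
      rewrite expZ ?EX//; last exact: bX.
      under [RHS]eq_Rintegral do rewrite mulrC.
      by rewrite expZ ?exp_le_Fcdf 1?mulrC//; exact: bounded_measurable_le.
  have mYA : measurable (Y @^-1` A) by exact: measurable_funPTI.
  have mXB : measurable (X @^-1` B) by exact: measurable_funPTI.
  have indY w : \1_(Y @^-1` A) w = \1_A (Y w) :> R.
    by rewrite !indicE; congr (_%:R); apply/idP/idP; rewrite !inE.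
  have E1 : \int[P]_w (\1_A (Y w) * \1_B (X w)) = fine (P (Y @^-1` A `&` X @^-1` B)).
    rewrite -(exp_indicI X mYA mB); apply: eq_Rintegral => w _.
    by rewrite mulrC indY.
  have E2 : \int[P]_w (\1_A (Y w) * c) = fine (P (Y @^-1` A) * P (X @^-1` B)).
    rewrite fineM ?fin_num_measure//.
    under eq_Rintegral do rewrite mulrC.
    rewrite expZ; last first.
      exact: (bounded_measurable_comp (measurable_funPT Y) (bounded_measurable_indic R mA)).
    rewrite mulrC -(exp_indic P mYA); congr (_ * _).
  rewrite -[LHS]fineK ?fin_num_measure//; last exact: measurableI.
  rewrite -[RHS]fineK; last by rewrite fin_numM// fin_num_measure.
  by rewrite -E1 -E2 main.
Qed.

Lemma function_of_cond_S : function_of Y X <->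
  forall y, \forall w \ae P, cond_S Y X w y = (Y w <= y)%R%:R.
Proof.
split=> [[f mf Yf] y|SY].
- pose g x : R := (f x <= y)%R%:R.
  have mg : measurable_fun setT g by exact: (measurableT_comp (measurable_step y) mf).
  have gP : is_cond_prob X [set w | Y w <= y] g.
    apply/is_cond_probP => //; first exact: measurable_le.
      by move=> x; rewrite /g; case: (f x <= y); rewrite /= ?lexx ler01.
    move=> B mB; have bB := bounded_measurable_comp (measurable_funPT X) (bounded_measurable_indic R mB).
    apply: exp_ae_eq.
    + exact: bounded_measurableM bB (bounded_measurable_indic R (measurable_le Y y)).
    + apply: (bounded_measurableM bB).
      apply: (@bounded_measurable_itv _ _ _ _ 0 1).
        exact: (measurableT_comp mg (measurable_funPT X)).
      by move=> w; rewrite /g; case: (f _ <= y); rewrite /= ?lexx ler01.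
    + by apply: filterS Yf => w Yf; rewrite indic_le /g Yf.
  by apply: filterS2 (cond_S_version gP) Yf => w -> ->.
- have [cF FP] := cond_cdfP Y X.
  have h0 : 0 < 1 / 2 :> R by lra.
  have h1 : 1 / 2 < 1 :> R by lra.
  (* The conditional median. At almost every [X w] the conditional law is concentrated at [Y w], so
     any level in []0, 1[] recovers it. *)
  exists (fun x => cdf_quantile (cond_cdf Y X x) (1 / 2)).
    apply: measurable_fun_le_rays => a.
    rewrite (_ : [set x | _] = [set x | 1 / 2 <= cond_cdf Y X x a]); last first.
      by apply/seteqP; split => x; rewrite /= cdf_quantile_le.
    rewrite -[X in measurable X]setTI; apply: measurable_fun_ler => //.
    exact: measurable_cond_cdf.
  have h : \forall w \ae P, forall r : rat, cond_S Y X w (ratr r) = (Y w <= ratr r)%R%:R.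
    by apply: ae_forall_countable => r; exact: SY.
  apply: filterS h => w hw; apply: rat_le_eq => r.
  rewrite (cdf_quantile_le _ (cF _))// -/(cond_S Y X w (ratr r)) hw.
  by case: (Y w <= ratr r); rewrite ?mulr1n ?mulr0n; lra.
Qed.

End given.
End conditioning.

Section cond_independent.
Context d (T : measurableType d) (R : realType) (P : probability T R).
Context d' (T' : measurableType d') d'' (T'' : measurableType d'') d3 (T3 : measurableType d3).
Variables (Y : {RV P >-> R}) (X : {RV P >-> T'}) (Z : {RV P >-> T''}) (W : {RV P >-> T3}).
Variables (hX : T3 -> T') (hZ : T3 -> T'') (pair : T' * T'' -> T3).
Hypotheses (mhX : measurable_fun setT hX) (mhZ : measurable_fun setT hZ).
Hypotheses (mpair : measurable_fun setT pair).
Hypotheses (hXW : forall w, hX (W w) = X w) (hZW : forall w, hZ (W w) = Z w).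
Hypothesis pairW : forall w, pair (X w, Z w) = W w.

Let bI d0 (T0 : measurableType d0) (V : {RV P >-> T0}) B : measurable B ->
  bounded_measurable (fun w => \1_B (V w) : R).
Proof.
by move=> mB; exact: (bounded_measurable_comp (measurable_funPT V) (bounded_measurable_indic R mB)).
Qed.

Let indP d0 (T0 : measurableType d0) (V : T -> T0) B w : \1_(V @^-1` B) w = \1_B (V w) :> R.
Proof. by rewrite !indicE; congr (_%:R); apply/idP/idP; rewrite !inE. Qed.

Let ind2 A B w : \1_(Y @^-1` A `&` Z @^-1` B) w = \1_A (Y w) * \1_B (Z w) :> R.
Proof. by rewrite indicI /= !indP. Qed.

Let bSX y : bounded_measurable (cond_S Y X ^~ y).
Proof.
have rS := random_cdf_cond Y X; have [_ mS _] := rS.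
exact: bounded_measurable_itv (mS y) (random_cdf01 rS y).
Qed.

Let bc y : bounded_measurable (cond_cdf Y X ^~ y).
Proof. exact: bounded_measurable_itv (measurable_cond_cdf Y X y) (cond_cdf01 Y X y). Qed.

Lemma cond_S_pull_out d0 (T0 : measurableType d0) (V : {RV P >-> T0}) y (h : T0 -> R) :
  bounded_measurable h ->
  \int[P]_w (h (V w) * (Y w <= y)%R%:R) = \int[P]_w (h (V w) * cond_S Y V w y).
Proof.
move=> bh; have [_ /(_ y) FP] := cond_cdfP Y V.
have := cond_prob_exp (measurable_le Y y) FP bh.
by under eq_Rintegral do rewrite indic_le.
Qed.

Lemma cond_prob_bounded d0 (T0 : measurableType d0) (V : {RV P >-> T0}) E : measurable E ->
  bounded_measurable (cond_prob V E).
Proof. by move=> /(cond_probP V)[mg g01 _]; exact: bounded_measurable_itv mg g01. Qed.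

(** [W] stands for (X, Z). Given [W], the event Y <= y may be replaced by the weight F_{Y|W} =
    F_{Y|X}, a function of [X]; against such a weight the indicator of Z in B may be replaced by P
    (Z in B | X). Half-lines then generate all [A]. *)
Lemma cond_independent_of_cond_S :
  (forall y, \forall w \ae P, cond_S Y X w y = cond_S Y W w y) -> cond_independent Y Z X.
Proof.
move=> SE A B mA mB.
have mZB : measurable (Z @^-1` B) by exact: measurable_funPTI.
have mYA : measurable (Y @^-1` A) by exact: measurable_funPTI.
set pB := cond_prob X (Z @^-1` B); have bpB : bounded_measurable pB := cond_prob_bounded X mZB.
have pBP := cond_probP X mZB; have [_ pB01 _] := pBP.
have bpBX := bounded_measurable_comp (measurable_funPT X) bpB.
pose pA := cond_prob X (Y @^-1` A); have bpA : bounded_measurable pA := cond_prob_bounded X mYA.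
have pAP := cond_probP X mYA; have [_ pA01 _] := pAP.
have pullB (h : T' -> R) : bounded_measurable h ->
    \int[P]_w (h (X w) * \1_B (Z w)) = \int[P]_w (h (X w) * pB (X w)).
  move=> bh; rewrite -(cond_prob_exp mZB pBP bh).
  by apply: eq_Rintegral => w _; rewrite indP.
have main C : measurable C ->
    \int[P]_w (\1_A (Y w) * (\1_C (X w) * \1_B (Z w))) =
    \int[P]_w (\1_A (Y w) * (\1_C (X w) * pB (X w))).
  move=> mC; have bC := bI X mC; have bB := bI Z mB.
  have bC' := bounded_measurable_indic R mC.
  apply: (exp_half_lines_eq (measurable_funPT Y) (measurable_funPT Y)
    (bounded_measurableM bC bB) (bounded_measurableM bC bpBX)) => //.
  - by move=> w; rewrite mulr_ge0//; case/andP: (pB01 (X w)).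
  - exact: pullB.
  - move=> y; pose h v := \1_C (hX v) * \1_B (hZ v) : R.
    have bh : bounded_measurable h.
      apply: bounded_measurableM.
        exact: (bounded_measurable_comp mhX bC').
      exact: (bounded_measurable_comp mhZ (bounded_measurable_indic R mB)).
    have hW w : h (W w) = \1_C (X w) * \1_B (Z w) by rewrite /h hXW hZW.
    transitivity (\int[P]_w (h (W w) * cond_S Y W w y)).
      rewrite -(cond_S_pull_out W y bh); apply: eq_Rintegral => w _.
      by rewrite hW mulrC.
    transitivity (\int[P]_w (h (W w) * cond_S Y X w y)).
      apply: exp_ae_eq.
      - apply: (bounded_measurableM (bounded_measurable_comp (measurable_funPT W) bh)).
        have rS := random_cdf_cond Y W; have [_ mS _] := rS.
        exact: bounded_measurable_itv (mS y) (random_cdf01 rS y).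
      - exact: (bounded_measurableM (bounded_measurable_comp (measurable_funPT W) bh)).
      - by apply: filterS (SE y) => w ->.
    transitivity (\int[P]_w (\1_C (X w) * cond_cdf Y X (X w) y * \1_B (Z w))).
      by apply: eq_Rintegral => w _; rewrite hW /cond_S mulrAC.
    rewrite (pullB (fun x => \1_C x * cond_cdf Y X x y)); last exact: bounded_measurableM.
    transitivity (\int[P]_w (\1_C (X w) * pB (X w) * cond_S Y X w y)).
      by apply: eq_Rintegral => w _; rewrite /cond_S mulrAC.
    rewrite -(cond_S_pull_out X y (bounded_measurableM bC' bpB)).
    by apply: eq_Rintegral => w _; rewrite mulrC.
have mAB : measurable (Y @^-1` A `&` Z @^-1` B) by exact: measurableI.
have gP : is_cond_prob X (Y @^-1` A `&` Z @^-1` B) (fun x => pA x * pB x).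
  apply/is_cond_probP => //.
  - by apply: measurable_funM; [case: bpA|case: bpB].
  - by move=> x; have := pA01 x; have := pB01 x => /andP[? ?] /andP[? ?];
       rewrite mulr_ge0//= mulr_ile1.
  - move=> C mC; have bC' := bounded_measurable_indic R mC.
    transitivity (\int[P]_w (\1_A (Y w) * (\1_C (X w) * \1_B (Z w)))).
      by apply: eq_Rintegral => w _; rewrite ind2 mulrCA.
    rewrite main//.
    transitivity (\int[P]_w (\1_C (X w) * pB (X w) * \1_(Y @^-1` A) w)).
      by apply: eq_Rintegral => w _; rewrite indP mulrC.
    rewrite (cond_prob_exp mYA pAP (bounded_measurableM bC' bpB)).
    by apply: eq_Rintegral => w _; rewrite -mulrA [pB _ * _]mulrC.
exact: (ae_distribution (cond_prob_unique mAB (cond_probP X mAB) gP)).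
Qed.

(** F_{Y|X}, read as a function of [W], is a version of F_{Y|W}: conditional independence gives the
    defining identity on rectangles in (X, Z), these form a generating pi-system, and [pair] carries
    the result to [W]. *)
Lemma cond_S_of_cond_independent : cond_independent Y Z X ->
  forall y, \forall w \ae P, cond_S Y X w y = cond_S Y W w y.
Proof.
move=> ci y; have mE := measurable_le Y y.
have YE : Y @^-1` `]-oo, y] = [set w | Y w <= y].
  by apply/seteqP; split => w; rewrite /= in_itv.
have bF := bounded_measurable_le Y y.
have rS := random_cdf_cond Y X.
have rect B C : measurable B -> measurable C ->
    \int[P]_w (\1_C (X w) * \1_B (Z w) * (Y w <= y)%R%:R) =
    \int[P]_w (\1_C (X w) * \1_B (Z w) * cond_S Y X w y).
  move=> mB mC; have mZB : measurable (Z @^-1` B) by exact: measurable_funPTI.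
  have bC' := bounded_measurable_indic R mC.
  have mAB := measurableI _ _ mE mZB.
  have pBP := cond_probP X mZB; have bpB := cond_prob_bounded X mZB.
  transitivity (\int[P]_w (\1_C (X w) * \1_([set w | Y w <= y] `&` Z @^-1` B) w)).
    apply: eq_Rintegral => w _.
    by rewrite indicI /= indP indic_le -mulrA [\1_B _ * _]mulrC.
  rewrite (cond_prob_exp mAB (cond_probP X mAB) bC').
  transitivity (\int[P]_w (\1_C (X w) * cond_cdf Y X (X w) y * cond_prob X (Z @^-1` B) (X w))).
    apply: exp_ae_eq.
    - apply: bounded_measurableM; first exact: bI.
      exact: (bounded_measurable_comp (measurable_funPT X) (cond_prob_bounded X mAB)).
    - apply: bounded_measurableM; last exact: (bounded_measurable_comp (measurable_funPT X) bpB).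
      by apply: bounded_measurableM; [exact: bI|exact: bSX].
    have ciy := ci _ _ (measurable_itv `]-oo, y]) mB; rewrite YE in ciy.
    have Sy := cond_S_version (cond_probP X mE).
    apply: filterS2 ciy Sy => w -> Sw.
    by rewrite -/(cond_S Y X w y) Sw mulrA.
  rewrite -(cond_prob_exp mZB pBP (bounded_measurableM bC' (bc y))).
  by apply: eq_Rintegral => w _; rewrite indP /cond_S mulrAC.
have mXZ : measurable_fun setT (fun w => (X w, Z w)) by exact: measurable_fun_pair.
have S01 := random_cdf01 rS y.
have rectD D : measurable D ->
    \int[P]_w (\1_D (X w, Z w) * (Y w <= y)%R%:R) = \int[P]_w (\1_D (X w, Z w) * cond_S Y X w y).
  apply: (exp_pi_system_eq mXZ mXZ bF (bSX y) _ _ (measurable_prod_measurableType T' T'')) => //.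
  - by move=> w; case/andP: (S01 w).
  - move=> _ _ [A1 mA1 [B1 mB1 <-]] [A2 mA2 [B2 mB2 <-]].
    rewrite -setXI; exists (A1 `&` A2); first exact: measurableI.
    by exists (B1 `&` B2) => //; exact: measurableI.
  - by have [_ _ ->] := rS; rewrite exp_le_Fcdf.
  - move=> _ [C mC [B mB <-]].
    have indX w : \1_(C `*` B) (X w, Z w) = \1_C (X w) * \1_B (Z w) :> R.
      by rewrite !indicE in_setX -natrM mulnb.
    under eq_Rintegral do rewrite indX; under [RHS]eq_Rintegral do rewrite indX.
    exact: rect.
have gP : is_cond_prob W [set w | Y w <= y] (fun v => cond_cdf Y X (hX v) y).
  apply/is_cond_probP => //.
  - exact: (measurableT_comp (measurable_cond_cdf Y X y) mhX).
  - by move=> v; exact: cond_cdf01.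
  - move=> D mD; have mpD : measurable (pair @^-1` D) by rewrite -[X in measurable X]setTI; exact: mpair.
    have indD w : \1_D (W w) = \1_(pair @^-1` D) (X w, Z w) :> R.
      by rewrite !indicE -pairW; congr (_%:R); apply/idP/idP; rewrite !inE.
    transitivity (\int[P]_w (\1_(pair @^-1` D) (X w, Z w) * (Y w <= y)%R%:R)).
      by apply: eq_Rintegral => w _; rewrite indD indic_le.
    rewrite rectD//; apply: eq_Rintegral => w _.
    by rewrite indD hXW.
by apply: filterS (cond_S_version gP) => w ->; rewrite hXW.
Qed.

End cond_independent.

Section concatenation.
Context {R : realType} (p q : nat).

Definition tuple_left (t : (p + q).-tuple R) : p.-tuple R :=
  [tuple tnth t (lshift q i) | i < p].

Definition tuple_right (t : (p + q).-tuple R) : q.-tuple R :=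
  [tuple tnth t (rshift p i) | i < q].

Lemma measurable_tuple_left : measurable_fun setT tuple_left.
Proof.
apply/measurable_fun_tnthP => i.
rewrite (_ : _ \o _ = (@tnth _ R ^~ (lshift q i))); first exact: measurable_tnth.
by apply/funext => t /=; rewrite tnth_mktuple.
Qed.

Lemma measurable_tuple_right : measurable_fun setT tuple_right.
Proof.
apply/measurable_fun_tnthP => i.
rewrite (_ : _ \o _ = (@tnth _ R ^~ (rshift p i))); first exact: measurable_tnth.
by apply/funext => t /=; rewrite tnth_mktuple.
Qed.

Lemma measurable_cat_pair :
  measurable_fun setT (fun z : p.-tuple R * q.-tuple R => cat_tuple z.1 z.2).
Proof.
apply/measurable_fun_tnthP => i; rewrite -(splitK i).
case: (fintype.split i) => j /=.
- rewrite (_ : _ \o _ = (@tnth _ R ^~ j) \o fst).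
    exact: measurableT_comp (measurable_tnth j) _.
  by apply/funext => w /=; rewrite tnth_lshift.
- rewrite (_ : _ \o _ = (@tnth _ R ^~ j) \o snd).
    exact: measurableT_comp (measurable_tnth j) _.
  by apply/funext => w /=; rewrite tnth_rshift.
Qed.

Lemma tuple_left_cat (x : p.-tuple R) (z : q.-tuple R) : tuple_left (cat_tuple x z) = x.
Proof. by apply: eq_from_tnth => i; rewrite tnth_mktuple tnth_lshift. Qed.

Lemma tuple_right_cat (x : p.-tuple R) (z : q.-tuple R) : tuple_right (cat_tuple x z) = z.
Proof. by apply: eq_from_tnth => i; rewrite tnth_mktuple tnth_rshift. Qed.

End concatenation.

(** * Quantile transform and the conditional convex order *)

(** Besides the distribution function, countable sets are required to be null, so that the
    exceptional levels can be discarded. Lebesgue measure enters only through [uniform01_exists]. *)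
Definition uniform01 {R : realType} d (T : measurableType d) (U : probability T R)
    (V : T -> R) :=
  [/\ measurable_fun setT V,
      forall c, 0 <= c <= 1 -> \int[U]_v ((V v <= c)%R%:R) = c &
      forall A : set R, countable A -> \forall v \ae U, ~ A (V v)].

Lemma uniform01_exists (R : realType) :
  exists d (T : measurableType d) (U : probability T R) (V : T -> R), uniform01 U V.
Proof.
exists _, (measurableTypeR R), (uniform_prob (@ltr01 R)), id; split=> [|c /andP[c0 c1]|A cA].
- exact: measurable_id.
- transitivity (\int[uniform_prob (@ltr01 R)]_v (\1_`]-oo, c] v)).
    by apply: eq_Rintegral => v _; rewrite indicE mem_setE in_itv.
  rewrite exp_indic; last exact: measurable_itv.
  transitivity (fine (\int[lebesgue_measure]_(x in `]-oo, c]) (uniform_pdf 0 1 x)%:E)%E) => //.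
  rewrite integral_uniform_pdf.
  rewrite (_ : `]-oo, c]%classic `&` `[0, 1]%classic = `[0, c]%classic); last first.
    apply/seteqP; split => v; rewrite /= !in_itv/=.
      by case=> -> /andP[->].
    by move=> /andP[-> vc]; rewrite vc (le_trans vc).
  rewrite (eq_integral (fun=> 1%E)); last first.
    move=> v; rewrite inE/= in_itv/= => /andP[v0 vc].
    by rewrite /uniform_pdf v0 (le_trans vc)//= subr0 invr1.
  rewrite integral_cst// mul1e [X in fine X]lebesgue_measure_itv/= lte_fin.
  by move: c0; rewrite le_eqVlt => /predU1P[<-|c0]; rewrite ?ltxx// c0 /= subr0.
- exists A; split; first exact: countable_measurable.
  + have /null_content_dominatesP := dominates_uniform_prob (@ltr01 R); apply.
      exact: countable_measurable.
    exact: countable_lebesgue_measure0.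
  + by move=> v /= /contrapT.
Qed.

Section uniform_quantile.
Context {R : realType} d0 (T0 : measurableType d0) (U : probability T0 R) (V : T0 -> R).
Hypothesis uV : uniform01 U V.

Let mV : measurable_fun setT V. Proof. by case: uV. Qed.

Let bstep c : bounded_measurable (fun v => (V v <= c)%R%:R : R).
Proof.
split; first exact: (measurableT_comp (measurable_step c) mV).
by exists 1 => v; case: (V v <= c); rewrite ?normr1 ?normr0.
Qed.

Lemma uniform01_ae : \forall v \ae U, 0 < V v < 1.
Proof.
have [_ cdfV cV] := uV.
have bc : bounded_measurable (fun _ : T0 => 1 : R) by exact: bounded_measurable_cst.
have h0 : \forall v \ae U, ((V v <= 0)%R%:R : R) = 0.
  apply: (exp_eq0 (bstep 0)) => //.
  by rewrite cdfV ?lexx ?ler01.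
have h1 : \forall v \ae U, 1 - ((V v <= 1)%R%:R : R) = 0.
  apply: exp_eq0.
  - exact/bounded_measurableB/bstep.
  - by move=> v; case: (V v <= 1); rewrite ?subrr ?subr0.
  - have b1 := bstep 1; rewrite expB// exp_cst cdfV ?subrr//.
    by rewrite ler01 lexx.
have h2 := cV _ (countable1 1).
apply: filterS3 h0 h1 h2 => v /eqP v0 /eqP v1 /eqP v1'.
apply/andP; split.
  by rewrite ltNge; apply/negP => h; move: v0; rewrite h oner_eq0.
rewrite lt_neqAle v1'/= leNgt; apply/negP => h.
by move: v1; rewrite leNgt h subr0 oner_eq0.
Qed.

Context d (T : measurableType d) (P : probability T R) (Y : {RV P >-> R}).

(* Outside ]0, 1[ the infimum defining [quantile] is a junk value. *)
Definition quantile01 (v : R) : R := if (0 < v) && (v < 1) then quantile Y v else 0.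

Lemma measurable_quantile01 : measurable_fun setT quantile01.
Proof.
apply: measurable_fun_le_rays => a.
pose D := `]0, 1[%classic : set R; have mD : measurable D by exact: measurable_itv.
rewrite (_ : [set v | _] = (D `&` [set v | v <= Fcdf Y a]) `|` (~` D `&` [set v | 0 <= a])).
  apply: measurableU; apply: measurableI => //.
  - by rewrite -[X in measurable X]setTI; exact: measurable_fun_ler.
  - exact: measurableC.
  - have [a0|a0] := boolP (0 <= a).
      by rewrite (_ : [set _ | _] = setT)//; apply/seteqP; split.
    by rewrite (_ : [set _ | _] = set0)//; apply/seteqP; split.
have F_cdf := Fcdf_is_cdf Y.
apply/seteqP; split => v; rewrite /quantile01 /D /= in_itv/=.
- case: ifPn => [/andP[v0 v1]|nv] qa; last by right.
  by left; split => //; rewrite -(cdf_quantile_le _ F_cdf).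
- case=> [[/andP[v0 v1]]|[/negP/negbTE ->]//].
  by rewrite v0 v1/= quantileE (cdf_quantile_le _ F_cdf).
Qed.

(** The quantile transform: q_Y v <= y exactly if v <= F_Y y, so q_Y (V) and [Y] agree in law on
    half-lines. *)
Lemma exp_quantile01 (h : R -> R) : bounded_measurable h ->
  \int[distribution P Y]_y h y = \int[U]_v h (quantile01 (V v)).
Proof.
have [_ cdfV cV] := uV.
move=> bh; have b1 d1 (T1 : measurableType d1) : bounded_measurable (fun _ : T1 => 1 : R).
  exact: bounded_measurable_cst.
have mqV : measurable_fun setT (fun v => quantile01 (V v)).
  exact: (measurableT_comp measurable_quantile01 mV).
have main A : measurable A ->
    \int[distribution P Y]_y (\1_A y * 1) = \int[U]_v (\1_A (quantile01 (V v)) * 1).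
  apply: (exp_half_lines_eq (P1 := distribution P Y) (P2 := U) (Z1 := id)
    (Z2 := fun v => quantile01 (V v)) (f := fun=> 1) (g := fun=> 1)) => //.
  - by rewrite !exp_cst.
  - move=> y.
    have bs : bounded_measurable (fun x : R => (x <= y)%R%:R * 1 : R).
      apply: bounded_measurableM => //; split; first exact: measurable_step.
      by exists 1 => x; case: (x <= y); rewrite ?normr1 ?normr0.
    rewrite (exp_distribution Y bs).
    transitivity (Fcdf Y y).
      by rewrite -exp_le_Fcdf; apply: eq_Rintegral => w _; rewrite mulr1.
    rewrite -{1}(cdfV _ (Fcdf01 Y y)); apply: exp_ae_eq.
    + exact: bstep.
    + exact: (bounded_measurable_comp mqV bs).
    + apply: filterS uniform01_ae => v v01; rewrite /quantile01 v01 mulr1.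
      case/andP: v01 => v0 v1.
      by rewrite quantileE (cdf_quantile_le _ (Fcdf_is_cdf Y)).
have := pull_out (P1 := distribution P Y) (P2 := U) (Z1 := id)
    (Z2 := fun v => quantile01 (V v)) (f := fun=> 1) (g := fun=> 1) (@measurable_id _ _ setT) mqV
    (b1 _ _) (b1 _ _) main bh.
under eq_Rintegral do rewrite mulr1.
by under [X in _ = X -> _]eq_Rintegral do rewrite mulr1.
Qed.

End uniform_quantile.

Section convex_function.
Context {R : realType}.

Lemma convex_function_convex_on (a b : R) (f : R -> R) :
  convex_function (`[a, b]%classic : set R^o) f -> convex_on a b f.
Proof.
move=> cf x y t xab yab t01.
have /andP[t0 t1] := t01.
have := cf (Itv01 t0 t1) x y; rewrite !inE /= !in_itv/= => /(_ xab yab).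
by rewrite !convRE.
Qed.

Lemma convex_on_convex_function (f : R -> R) :
  (forall a b, convex_on a b f) -> convex_function (setT : set R^o) f.
Proof.
move=> cf t x y _ _; rewrite !convRE.
apply: (cf (Num.min x y) (Num.max x y)).
- by rewrite ge_min lexx le_max lexx.
- by rewrite ge_min lexx orbT le_max lexx orbT.
- by rewrite ge0 le1.
Qed.

(** Used with [c = 0] for the test function -id, and with [c = 1] to pass from P (Y >= q | X) to P
    (Y < q | X). *)
Lemma convex_on_affine (f : R -> R) (c : R) :
  (forall a b, convex_on a b f) -> forall a b, convex_on a b (fun x => f (c - x)).
Proof.
move=> cf a b x y t xab yab t01.
have -> : c - (t * x + (1 - t) * y) = t * (c - x) + (1 - t) * (c - y) by ring.
apply: (cf (Num.min (c - x) (c - y)) (Num.max (c - x) (c - y))) => //.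
- by rewrite ge_min lexx le_max lexx.
- by rewrite ge_min lexx orbT le_max lexx orbT.
Qed.

End convex_function.

Section levels.
Context d (T : measurableType d) (R : realType) (P : probability T R) (Y : {RV P >-> R}).
Implicit Types v : R.

(** This level and the next, P (Y <= q) and P (Y < q) at q = q_Y v, are the ends of the interval of
    levels that share the quantile [q]. *)
Definition level_above v := Fcdf Y (quantile Y v).

Definition level_below v := \int[P]_w ((Y w < quantile Y v)%R%:R : R).

Let cF := Fcdf_is_cdf Y.

Lemma level_below_le v : 0 < v -> v < 1 -> level_below v <= v.
Proof. exact: exp_lt_quantile. Qed.

Lemma level_above_ge v : 0 < v -> v < 1 -> v <= level_above v.
Proof. exact: (cdf_quantile_ge cF). Qed.

Lemma quantile_same_level v v' : 0 < v -> v <= v' -> v' < 1 -> v' <= level_above v ->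
  quantile Y v' = quantile Y v.
Proof.
move=> v0 vv' v'1 v'r; have v'0 := lt_le_trans v0 vv'; have v1 := le_lt_trans vv' v'1.
apply/le_anti/andP; split.
  by rewrite [leLHS]quantileE (cdf_quantile_le _ cF).
rewrite [leLHS]quantileE (cdf_quantile_le _ cF)//.
by apply: le_trans vv' _; exact: level_above_ge.
Qed.

Lemma quantile_lt_above v v' : 0 < v -> v < 1 -> v' < 1 -> level_above v < v' ->
  quantile Y v < quantile Y v'.
Proof.
move=> v0 v1 v'1 rv; have v'0 : 0 < v' by exact: (lt_trans (lt_le_trans v0 (level_above_ge v0 v1)) rv).
by rewrite ltNge [leLHS]quantileE (cdf_quantile_le _ cF)// -ltNge.
Qed.

Lemma level_above_le_below v v' : 0 < v -> v < 1 -> v' < 1 -> level_above v < v' ->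
  level_above v <= level_below v'.
Proof.
move=> v0 v1 v'1 rv; have qq := quantile_lt_above v0 v1 v'1 rv.
rewrite /level_above -exp_le_Fcdf; apply: exp_le.
- exact: bounded_measurable_le.
- exact: bounded_measurable_lt.
- by move=> w; rewrite ler_nat; case: (leP (Y w)) => // Yq; rewrite (le_lt_trans Yq).
Qed.

(** The levels at which equality of the levels below does not determine the level above: one
    variable may reach [v] at the left end of a gap in front of an atom, another only at the atom
    itself. *)
Definition jump_levels := [set v | [/\ 0 < v, v < 1, level_below v = v & v < level_above v]].

(* The intervals ]v, level_above v[ attached to these levels are disjoint. *)
Lemma countable_jump_levels : countable jump_levels.
Proof.
pose f v := get [set r : rat | v < ratr r /\ ratr r < level_above v].
have fP v : jump_levels v -> v < ratr (f v) /\ ratr (f v) < level_above v.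
  move=> [_ _ _ /rat_in_itvoo[r /itvP vr]].
  by apply: (@getPex _ [set r : rat | v < ratr r /\ ratr r < level_above v]); exists r; rewrite /= !vr.
have lt_f v u : jump_levels v -> jump_levels u -> v < u -> f v < f u.
  move=> Jv Ju vu; have [v0 v1 lv _] := Jv; have [u0 u1 lu _] := Ju.
  have [_ h2] := fP v Jv; have [h3 _] := fP u Ju.
  have ru : level_above v < u.
    rewrite ltNge; apply/negP => ur.
    have := quantile_same_level v0 (ltW vu) u1 ur => qE.
    by move: vu; rewrite -lu -[ltLHS]lv /level_below qE ltxx.
  by rewrite -(ltr_rat R); exact: lt_trans h2 (lt_trans ru h3).
apply/countable_injP; exists (fun v => pickle (f v)) => v u /set_mem Jv /set_mem Ju.
move/(pcan_inj pickleK) => fE; have [vu|uv|//] := ltgtP v u.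
  by have := lt_f _ _ Jv Ju vu; rewrite fE ltxx.
by have := lt_f _ _ Ju Jv uv; rewrite fE ltxx.
Qed.

End levels.

Lemma cond_probC d d' (T : measurableType d) (T' : measurableType d') (R : realType)
    (P : probability T R) (X : {RV P >-> T'}) (E : set T) (g : T' -> R) : measurable E ->
  is_cond_prob X E g -> is_cond_prob X (~` E) (fun x => 1 - g x).
Proof.
move=> mE gP; have [mg g01 _] := gP; apply/is_cond_probP.
- exact: measurableC.
- exact: measurable_funB.
- by move=> x; have := g01 x; lra.
- move=> B mB; have bB := bounded_measurable_indic R mB.
  have bBX := bounded_measurable_comp (measurable_funPT X) bB.
  have bE := bounded_measurable_indic R mE.
  have bg := bounded_measurable_itv mg g01.
  have bgX := bounded_measurable_comp (measurable_funPT X) bg.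
  transitivity (\int[P]_w (\1_B (X w) - \1_B (X w) * \1_E w)).
    apply: eq_Rintegral => w _; rewrite [\1_(~` E) _]indicE in_setC [\1_E _]indicE.
    by case: (w \in E) => /=; rewrite ?mulr1 ?mulr0 ?subrr ?subr0.
  transitivity (\int[P]_w (\1_B (X w) - \1_B (X w) * g (X w))).
    rewrite !expB//; [|exact: bounded_measurableM..].
    by rewrite (cond_prob_exp mE gP bB).
  by apply: eq_Rintegral => w _; ring.
Qed.

Section one_space.
Context d (T : measurableType d) (R : realType) (P : probability T R).
Context d' (T' : measurableType d') (Y : {RV P >-> R}) (X : {RV P >-> T'}).

Definition cond_ge v : T' -> R := cond_prob X [set w | quantile Y v <= Y w].

Lemma measurable_quantile_ge v : measurable [set w | quantile Y v <= Y w].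
Proof. by rewrite -[X in measurable X]setTI; exact: measurable_fun_ler. Qed.

Lemma cond_geP v : is_cond_prob X [set w | quantile Y v <= Y w] (cond_ge v).
Proof. exact/cond_probP/measurable_quantile_ge. Qed.

Lemma cond_ge01 v w : 0 <= cond_ge v (X w) <= 1.
Proof. by have [_ h _] := cond_geP v. Qed.

Lemma measurable_cond_ge v : measurable_fun setT (fun w => cond_ge v (X w)).
Proof. by have [m _ _] := cond_geP v; exact: (measurableT_comp m (measurable_funPT X)). Qed.

Lemma bounded_measurable_cond_ge v : bounded_measurable (fun w => cond_ge v (X w)).
Proof. exact: (bounded_measurable_itv (measurable_cond_ge v) (cond_ge01 v)). Qed.

Lemma exp_cond_ge v : \int[P]_w cond_ge v (X w) = 1 - level_below Y v.
Proof.
have := cond_prob_exp (measurable_quantile_ge v) (cond_geP v) (bounded_measurable_cst T' 1).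
under [X in _ = X -> _]eq_Rintegral do rewrite mul1r.
move=> <-; rewrite -{2}(exp_cst P 1) -expB; last 2 first.
- exact: bounded_measurable_cst.
- exact: bounded_measurable_lt.
apply: eq_Rintegral => w _; rewrite mul1r indicE (_ : (w \in _) = ~~ (Y w < quantile Y v)).
  by case: (Y w < _); rewrite ?subrr ?subr0.
by apply/idP/idP; rewrite inE /= leNgt.
Qed.

(** For q_Y v < q_Y v', almost surely P (Y <= q_Y v | X) <= P (Y < q_Y v' | X). The difference has
    mean [level_below Y v' - level_above Y v], at most [v' - level_above Y v], which bounds the L1
    distance. *)
Lemma cond_S_approx (psi : R -> R) (L v v' : R) : 0 < v -> v < 1 -> v' < 1 ->
  level_above Y v < v' -> (forall a b, convex_on a b psi) -> 0 <= L ->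
  (forall x y, 0 <= x <= 1 -> 0 <= y <= 1 -> `|psi x - psi y| <= L * `|x - y|) ->
  `|\int[P]_w psi (cond_S Y X w (quantile Y v)) - \int[P]_w psi (1 - cond_ge v' (X w))| <=
  L * (v' - level_above Y v).
Proof.
move=> v0 v1 v'1 rv cpsi L0 lip; set q := quantile Y v.
have qq := quantile_lt_above v0 v1 v'1 rv.
have rS := random_cdf_cond Y X; have [_ mS eS] := rS; have S01 := random_cdf01 rS q.
have bS := bounded_measurable_itv (mS q) S01.
have bc := bounded_measurable_cond_ge v'.
have b1c : bounded_measurable (fun w => 1 - cond_ge v' (X w)).
  exact: (bounded_measurableB (bounded_measurable_cst T 1) bc).
have c01 w : 0 <= 1 - cond_ge v' (X w) <= 1 by have := cond_ge01 v' w; lra.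
have bpS : bounded_measurable (fun w => psi (cond_S Y X w q)).
  exact: (bounded_measurable_convex (cpsi 0 1) (mS q) S01).
have bpc : bounded_measurable (fun w => psi (1 - cond_ge v' (X w))).
  by apply: (bounded_measurable_convex (cpsi 0 1)) c01; case: b1c.
have le_ae : \forall w \ae P, cond_S Y X w q <= 1 - cond_ge v' (X w).
  have [_ /(_ q) FP] := cond_cdfP Y X.
  have sub : [set w | Y w <= q] `<=` ~` [set w | quantile Y v' <= Y w].
    by move=> w /= Yq; apply/negP; rewrite -ltNge; exact: le_lt_trans qq.
  have mge := measurable_quantile_ge v'.
  exact: (ae_distribution (cond_prob_mono (measurable_le Y q) (measurableC mge) sub FP
    (cond_probC mge (cond_geP v')))).
rewrite -expB//; apply: le_trans (exp_norm P (bounded_measurableB bpS bpc)) _.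
have bd := bounded_measurableB b1c bS.
apply: (@le_trans _ _ (\int[P]_w (L * ((1 - cond_ge v' (X w)) - cond_S Y X w q)))).
  apply: exp_ae_le.
  - have [m [M hM]] := bounded_measurableB bpS bpc.
    split; first exact: measurableT_comp.
    by exists M => w; rewrite normr_id.
  - exact: bounded_measurableM (bounded_measurable_cst T L) bd.
  - apply: filterS le_ae => w lew; apply: le_trans (lip _ _ (S01 w) (c01 w)) _.
    by rewrite distrC ger0_norm// subr_ge0.
rewrite expZ// expB// expB//; last exact: bounded_measurable_cst.
rewrite exp_cst exp_cond_ge eS -/(level_above Y v) ler_wpM2l//.
have v'0 : 0 < v' by exact: (lt_trans (lt_le_trans v0 (level_above_ge Y v0 v1)) rv).
by have := level_below_le Y v'0 v'1; lra.
Qed.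

End one_space.

(** * Extending the convex order and transferring it along quantiles *)

Section cx01_extension.
Context {R : realType} d1 (T1 : measurableType d1) d2 (T2 : measurableType d2).
Context (P1 : probability T1 R) (S1 : T1 -> R) (P2 : probability T2 R) (S2 : T2 -> R).
Hypotheses (mS1 : measurable_fun setT S1) (S101 : forall w, 0 <= S1 w <= 1).
Hypotheses (mS2 : measurable_fun setT S2) (S201 : forall w, 0 <= S2 w <= 1).

(** The approximations satisfy [g n >= psi] and are eventually equal to psi at each point, so E
    psi(S1) <= E g_n(S1) <= E g_n(S2), and the last term tends to E psi(S2). *)
Lemma cx01_of_convex :
  (forall psi : R -> R, (forall a b, convex_on a b psi) ->
    \int[P1]_w psi (S1 w) <= \int[P2]_w psi (S2 w)) -> cx01 P1 S1 P2 S2.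
Proof.
move=> cx psi cpsi; pose e n : R := n.+3%:R^-1.
have e0 n : 0 < e n by rewrite invr_gt0.
have e1 n : e n < 1 / 2 by rewrite div1r ltf_pV2 ?posrE// ltr_nat.
have /choice[g gP] n := convex_on01_approx cpsi (e0 n) (e1 n).
have cg n : forall a b, convex_on a b (g n) by have [] := gP n.
have [M psiM] := convex_on_bounded cpsi.
have gM n x : 0 <= x <= 1 -> `|g n x| <= M + `|Num.max (psi 0) (psi 1)|.
  move=> x01; have [_ _ g0 g1 ge] := gP n; have := convex_on_ub (cg n 0 1) x01.
  rewrite g0 g1; set m := Num.max _ _ => gm; have := ge x x01; have := psiM x x01.
  rewrite !ler_norml => /andP[h1 h2] h3; have := ler_norm m; have := normr_ge0 m.
  have : 0 <= M by apply: le_trans (psiM x x01).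
  by lra.
have bpsi1 := bounded_measurable_convex cpsi mS1 S101.
have bpsi2 := bounded_measurable_convex cpsi mS2 S201.
have bg1 n := bounded_measurable_convex (cg n 0 1) mS1 S101.
have bg2 n := bounded_measurable_convex (cg n 0 1) mS2 S201.
apply: (@exp_ge_lim _ _ _ _ (fun n w => g n (S2 w)) _ (M + `|Num.max (psi 0) (psi 1)|)).
- by move=> n; case: (bg2 n).
- by move=> n w; exact: gM.
- by case: bpsi2.
- move=> w; have /andP[s0 s1] := S201 w.
  move: s0; rewrite le_eqVlt => /predU1P[<-|s0].
    by exists 0%N => n _; have [] := gP n.
  move: s1; rewrite le_eqVlt => /predU1P[->|s1].
    by exists 0%N => n _; have [] := gP n.
  pose m := Num.min (S2 w) (1 - S2 w).
  have m0 : 0 < m by rewrite lt_min s0 subr_gt0.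
  exists (Num.truncn m^-1) => n Nn; have [_ gE _ _ _] := gP n; apply: gE.
  have : e n < m.
    rewrite /e invf_plt ?posrE//; apply: lt_le_trans (truncnS_gt _) _.
    by rewrite ler_nat ltnS (leq_trans Nn)// leqW// leqW.
  by rewrite lt_min => /andP[h1 h2]; rewrite (ltW h1)/= lerBrDr -lerBrDl ltW.
- move=> n; apply: le_trans (cx _ (cg n)); apply: exp_le => // w.
  by have [_ _ _ _] := gP n; apply.
Qed.

(** On {0, 1} every psi coincides with an affine function, so only the mean counts. *)
Lemma cx01_bernoulli : (forall w, S1 w = 0 \/ S1 w = 1) -> (forall w, S2 w = 0 \/ S2 w = 1) ->
  \int[P1]_w S1 w = \int[P2]_w S2 w -> cx01 P1 S1 P2 S2.
Proof.
move=> S1b S2b S12 psi cpsi.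
have aff d (T : measurableType d) (P : probability T R) (S : T -> R) :
    bounded_measurable S -> (forall w, S w = 0 \/ S w = 1) ->
    \int[P]_w psi (S w) = (psi 1 - psi 0) * \int[P]_w S w + psi 0.
  move=> bS Sb; rewrite -{2}(exp_cst P (psi 0)) -expZ// -expD.
  - by apply: eq_Rintegral => w _; case: (Sb w) => ->; ring.
  - exact: bounded_measurableM (bounded_measurable_cst T _) bS.
  - exact: bounded_measurable_cst.
by rewrite !aff ?S12//; [exact: bounded_measurable_itv mS2 S201|exact: bounded_measurable_itv mS1 S101].
Qed.

End cx01_extension.

Section two_spaces.
Context {R : realType} d1 (T1 : measurableType d1) d2 (T2 : measurableType d2).
Context (P1 : probability T1 R) (P2 : probability T2 R).
Variables (Y1 : {RV P1 >-> R}) (Y2 : {RV P2 >-> R}).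
Local Notation regular v :=
  [/\ 0 < v, v < 1, ~ jump_levels Y1 v & ~ jump_levels Y2 v].

Section transfer.
Variable phi : R -> R.
Hypothesis cphi : convex_on (-1) 1 phi.
Variables (S1 : T1 -> R -> R) (S2 : T2 -> R -> R).
Hypotheses (rS1 : random_cdf Y1 S1) (rS2 : random_cdf Y2 S2).
Hypothesis above : forall v, regular v -> level_above Y1 v = level_above Y2 v.
Hypothesis cx : forall v, regular v ->
  cx01 P1 (S1 ^~ (quantile Y1 v)) P2 (S2 ^~ (quantile Y2 v)).

Let regular_ae d (T : measurableType d) (U : probability T R) (V : T -> R) :
  uniform01 U V -> \forall u \ae U, regular (V u).
Proof.
move=> uV; have [_ _ cV] := uV.
have h1 := cV _ (countable_jump_levels Y1); have h2 := cV _ (countable_jump_levels Y2).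
by apply: filterS3 (uniform01_ae uV) h1 h2 => u /andP[].
Qed.

(** Integrals over the different laws of [Y1] and [Y2] become integrals over one uniform level,
    where they are compared pointwise. The hypothesis [above] makes the shift F_Y (q_Y v) common to
    both. *)
Lemma xi_int_transfer : xi_int phi Y1 S1 <= xi_int phi Y2 S2.
Proof.
have [d [T [U [V uV]]]] := uniform01_exists R; have [mV _ _] := uV.
have b1 := bounded_measurable_xi_y cphi rS1; have b2 := bounded_measurable_xi_y cphi rS2.
rewrite /xi_int (exp_quantile01 uV Y1 b1) (exp_quantile01 uV Y2 b2).
apply: exp_ae_le.
- exact: (bounded_measurable_comp (measurableT_comp (measurable_quantile01 Y1) mV) b1).
- exact: (bounded_measurable_comp (measurableT_comp (measurable_quantile01 Y2) mV) b2).
apply: filterS (regular_ae uV) => u ru; have [v0 v1 _ _] := ru.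
rewrite /quantile01 v0 v1 /= -/(level_above Y1 (V u)) -/(level_above Y2 (V u)) -(above ru).
exact: (cx ru (convex_shift cphi (Fcdf01 Y1 (quantile Y1 (V u))))).
Qed.

Lemma Lambda_int_transfer : Lambda_int phi Y1 S1 <= Lambda_int phi Y2 S2.
Proof.
have [d [T [U [V uV]]]] := uniform01_exists R; have [mV _ _] := uV.
have b1 := bounded_measurable_Lambda_y cphi rS1; have b2 := bounded_measurable_Lambda_y cphi rS2.
rewrite /Lambda_int (exp_quantile01 uV Y1 b1) (exp_quantile01 uV Y2 b2).
apply: exp_ae_le.
- exact: (bounded_measurable_comp (measurableT_comp (measurable_quantile01 Y1) mV) b1).
- exact: (bounded_measurable_comp (measurableT_comp (measurable_quantile01 Y2) mV) b2).
apply: filterS (regular_ae uV) => u ru; have [v0 v1 _ _] := ru.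
rewrite /quantile01 v0 v1 /=; have [_ m1 _] := rS1; have [_ m2 _] := rS2.
exact: (exp2_le cphi (m1 _) (random_cdf01 rS1 _) (m2 _) (random_cdf01 rS2 _) (cx ru)).
Qed.

End transfer.

Section full.
Hypothesis above : forall v, regular v -> level_above Y1 v = level_above Y2 v.

Lemma cx01_full v : regular v ->
  cx01 P1 (fun w => (Y1 w <= quantile Y1 v)%R%:R) P2 (fun w => (Y2 w <= quantile Y2 v)%R%:R).
Proof.
move=> rv; have b01 (b : bool) : 0 <= (b%:R : R) <= 1 by case: b; rewrite ?lexx ler01.
apply: cx01_bernoulli.
- by have [] := bounded_measurable_le Y1 (quantile Y1 v).
- by move=> w.
- by have [] := bounded_measurable_le Y2 (quantile Y2 v).
- by move=> w.
- by move=> w; case: (Y1 w <= _); [right|left].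
- by move=> w; case: (Y2 w <= _); [right|left].
- by rewrite !exp_le_Fcdf; exact: above.
Qed.

End full.
End two_spaces.

Section conditional_convex_order.
Context {R : realType} d1 (T1 : measurableType d1) d2 (T2 : measurableType d2).
Context (P1 : probability T1 R) (P2 : probability T2 R) (p1 p2 : nat).
Variables (Y1 : {RV P1 >-> R}) (X1 : {RV P1 >-> p1.-tuple R}).
Variables (Y2 : {RV P2 >-> R}) (X2 : {RV P2 >-> p2.-tuple R}).
Hypothesis ccx : le_ccx Y1 X1 Y2 X2.
Local Notation regular v :=
  [/\ 0 < v, v < 1, ~ jump_levels Y1 v & ~ jump_levels Y2 v].

Lemma ccx_cond_ge (psi : R -> R) v : 0 < v -> v < 1 -> (forall a b, convex_on a b psi) ->
  \int[P1]_w psi (cond_ge Y1 X1 v (X1 w)) <= \int[P2]_w psi (cond_ge Y2 X2 v (X2 w)).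
Proof.
move=> v0 v1 cpsi; have := ccx v0 v1 (convex_on_convex_function cpsi).
rewrite unlock => h.
have b1 := bounded_measurable_convex (cpsi 0 1) (measurable_cond_ge Y1 X1 v) (cond_ge01 Y1 X1 v).
have b2 := bounded_measurable_convex (cpsi 0 1) (measurable_cond_ge Y2 X2 v) (cond_ge01 Y2 X2 v).
by rewrite -lee_fin -!exp_EFin.
Qed.

Lemma ccx_level_below v : 0 < v -> v < 1 -> level_below Y1 v = level_below Y2 v.
Proof.
move=> v0 v1.
have h1 : forall a b : R, convex_on a b id by move=> a b x y t.
have := ccx_cond_ge v0 v1 h1; rewrite !exp_cond_ge => le1.
have := ccx_cond_ge v0 v1 (convex_on_affine 0 h1); rewrite /=.
have bc1 := bounded_measurable_cst T1 (0 : R); have bc2 := bounded_measurable_cst T2 (0 : R).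
have b1 := bounded_measurable_cond_ge Y1 X1 v; have b2 := bounded_measurable_cond_ge Y2 X2 v.
by rewrite !expB// !exp_cst !exp_cond_ge; lra.
Qed.

Lemma ccx_level_above v : regular v -> level_above Y1 v = level_above Y2 v.
Proof.
move=> [v0 v1 J1 J2].
(* Write l and r for the levels below and above. If r_Y(v) < r_Z(v), then for v'
   in between q_Z(v') = q_Z(v), hence r_Y(v) <= l_Y(v') = l_Z(v') = l_Z(v) <= v <= r_Y(v)
   and v is a jump level of Z. *)
have half d (T : measurableType d) (P : probability T R) (Y : {RV P >-> R})
    e (T' : measurableType e) (Q : probability T' R) (Z : {RV Q >-> R}) :
    (forall v, 0 < v -> v < 1 -> level_below Y v = level_below Z v) ->
    ~ jump_levels Z v -> level_above Z v <= level_above Y v.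
  move=> below JZ; rewrite leNgt; apply/negP => lt_above.
  have zv := level_above_ge Z v0 v1; have yv := level_above_ge Y v0 v1.
  have Z1 : level_above Z v <= 1 by case/andP: (Fcdf01 Z (quantile Z v)).
  pose v' := (level_above Y v + level_above Z v) / 2.
  have yv' : level_above Y v < v' by rewrite /v'; lra.
  have v'z : v' < level_above Z v by rewrite /v'; lra.
  have v'0 : 0 < v' by lra.
  have v'1 : v' < 1 by lra.
  have qE : quantile Z v' = quantile Z v.
    by apply: quantile_same_level => //; [lra|exact: ltW].
  have lE : level_below Z v' = level_below Z v by rewrite /level_below qE.
  have := level_above_le_below v0 v1 v'1 yv'; rewrite below// lE.
  have := level_below_le Z v0 v1 => h1 h2.
  by apply: JZ; split => //; lra.
have below := ccx_level_below.
by apply/le_anti/andP; split; apply: half => // u u0 u1; rewrite below.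
Qed.

Lemma ccx_cx01 v : regular v -> cx01 P1 (cond_S Y1 X1 ^~ (quantile Y1 v))
  P2 (cond_S Y2 X2 ^~ (quantile Y2 v)).
Proof.
move=> rv; have aE := ccx_level_above rv; have [v0 v1 _ _] := rv.
have rS1 := random_cdf_cond Y1 X1; have rS2 := random_cdf_cond Y2 X2.
have [_ m1 e1] := rS1; have [_ m2 e2] := rS2.
have S101 := random_cdf01 rS1 (quantile Y1 v); have S201 := random_cdf01 rS2 (quantile Y2 v).
apply: (cx01_of_convex (m1 _) S101 (m2 _) S201) => psi cpsi.
have bS1 := bounded_measurable_itv (m1 _) S101; have bS2 := bounded_measurable_itv (m2 _) S201.
have r1 : level_above Y1 v <= 1 by case/andP: (Fcdf01 Y1 (quantile Y1 v)).
(* If the level above is 1, there is no room for a larger [v']; but then both conditional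
   probabilities have mean 1, so they equal 1 almost surely. *)
move: r1; rewrite le_eqVlt => /predU1P[r1|r1].
  have one d (T : measurableType d) (P : probability T R) (S : T -> R) :
      measurable_fun setT S -> (forall w, 0 <= S w <= 1) -> \int[P]_w S w = 1 ->
      \int[P]_w psi (S w) = psi 1.
    move=> mS S01 ES; have bS := bounded_measurable_itv mS S01.
    rewrite -[RHS](exp_cst P); apply: exp_ae_eq.
    - exact: (bounded_measurable_convex (cpsi 0 1) mS S01).
    - exact: bounded_measurable_cst.
    - have S1 : \forall w \ae P, S w = 1.
        apply: exp_le_eq => //; first exact: bounded_measurable_cst.
          by move=> w; case/andP: (S01 w).
        by rewrite exp_cst.
      by apply: filterS S1 => w ->.
  rewrite (one _ _ _ _ (m1 _) S101) ?(one _ _ _ _ (m2 _) S201)//.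
  - by rewrite e2 -[LHS]/(level_above Y2 v) -aE.
  - by rewrite e1.
have [L L0 lip] := convex_lipschitz01 cpsi.
apply/ler_addgt0Pr => e e0.
(* The first bound keeps [v' < 1]. The second makes the two approximation errors, each at most
   [L s], add up to at most [e]; the [+ 1] covers [L = 0]. *)
pose s := Num.min (1 - level_above Y1 v) (e / (2 * L + 1)) / 2.
have L1 : 0 < 2 * L + 1 by lra.
have s0 : 0 < s by rewrite /s divr_gt0// lt_min subr_gt0 r1 divr_gt0.
have sr : s < 1 - level_above Y1 v.
  have : s * 2 <= 1 - level_above Y1 v by rewrite /s divfK// ge_min lexx.
  lra.
have sL : 2 * L * s <= e.
  have : s * 2 <= e / (2 * L + 1) by rewrite /s divfK// ge_min lexx orbT.
  rewrite ler_pdivlMr// => h.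
  have : 0 <= L * s by rewrite mulr_ge0// ltW.
  nra.
pose v' := level_above Y1 v + s.
have rv1 : level_above Y1 v < v' by rewrite /v' ltrDl.
have rv2 : level_above Y2 v < v' by rewrite -aE.
have v'1 : v' < 1 by rewrite /v'; lra.
have v'0 : 0 < v' by apply: le_lt_trans rv1; case/andP: (Fcdf01 Y1 (quantile Y1 v)).
have a1 := cond_S_approx X1 v0 v1 v'1 rv1 cpsi L0 lip.
have a2 := cond_S_approx X2 v0 v1 v'1 rv2 cpsi L0 lip.
(* The approximants are [1 - cond_ge], hence the order is tested with the reflected function psi (1
   - x). *)
have := ccx_cond_ge v'0 v'1 (convex_on_affine 1 cpsi).
move: a1 a2; rewrite -aE (_ : v' - level_above Y1 v = s); last by rewrite /v'; ring.
rewrite !ler_norml; lra.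
Qed.

Lemma ccx_xi (phi : R -> R) : convex_on (-1) 1 phi ->
  xi_int phi Y1 (cond_S Y1 X1) <= xi_int phi Y2 (cond_S Y2 X2) /\
  Lambda_int phi Y1 (cond_S Y1 X1) <= Lambda_int phi Y2 (cond_S Y2 X2).
Proof.
move=> cphi; have rS1 := random_cdf_cond Y1 X1; have rS2 := random_cdf_cond Y2 X2.
split.
- exact: (xi_int_transfer cphi rS1 rS2 ccx_level_above ccx_cx01).
- exact: (Lambda_int_transfer cphi rS1 rS2 ccx_cx01).
Qed.

(** At q_Y v both indicators are Bernoulli with the same parameter, so the transfer works in both
    directions and the normalizing constants coincide. *)
Lemma ccx_full (phi : R -> R) (F1 := fun w y => (Y1 w <= y)%R%:R : R)
    (F2 := fun w y => (Y2 w <= y)%R%:R : R) : convex_on (-1) 1 phi ->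
  xi_int phi Y1 F1 = xi_int phi Y2 F2 /\ Lambda_int phi Y1 F1 = Lambda_int phi Y2 F2.
Proof.
move=> cphi; have rF1 := random_cdf_full Y1; have rF2 := random_cdf_full Y2.
have a12 := ccx_level_above.
have a21 v : [/\ 0 < v, v < 1, ~ jump_levels Y2 v & ~ jump_levels Y1 v] ->
    level_above Y2 v = level_above Y1 v.
  by move=> [v0 v1 J2 J1]; rewrite a12.
split; apply/le_anti/andP; split.
- exact: (xi_int_transfer cphi rF1 rF2 a12 (cx01_full a12)).
- exact: (xi_int_transfer cphi rF2 rF1 a21 (cx01_full a21)).
- exact: (Lambda_int_transfer cphi rF1 rF2 (cx01_full a12)).
- exact: (Lambda_int_transfer cphi rF2 rF1 (cx01_full a21)).
Qed.

End conditional_convex_order.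

(** * The coefficients *)

Section ratio.
Context {R : realType}.
Implicit Types c x y : R.

Lemma ratio_range c x : 0 < c -> 0 <= x -> x <= c -> 0 <= c^-1 * x <= 1.
Proof.
by move=> c0 x0 xc; rewrite mulr_ge0 ?invr_ge0 ?(ltW c0)//= ler_pdivrMl// mulr1.
Qed.

Lemma ratio_le c x y : 0 < c -> x <= y -> c^-1 * x <= c^-1 * y.
Proof. by move=> c0 xy; rewrite ler_pM2l// invr_gt0. Qed.

Lemma ratio_eq c x y : 0 < c -> c^-1 * x = c^-1 * y <-> x = y.
Proof.
move=> c0; split=> [|->//].
by move/(congr1 ( *%R c)); rewrite !mulVKf ?gt_eqF.
Qed.

Lemma ratio_eq0 c x : 0 < c -> c^-1 * x = 0 <-> x = 0.
Proof. by move=> c0; rewrite -[X in _ = X <-> _](mulr0 c^-1); exact: ratio_eq. Qed.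

Lemma ratio_eq1 c x : 0 < c -> c^-1 * x = 1 <-> x = c.
Proof.
by move=> c0; rewrite -[X in _ = X <-> _](mulVf (lt0r_neq0 c0)); exact: ratio_eq.
Qed.

End ratio.

Section normalization.
Context {R : realType} (phi : R -> R).
Hypothesis cphi : convex_on (-1) 1 phi.
Hypothesis sphi : strictly_convex_at0 `[-1, 1]%classic phi.
Hypothesis phi0 : phi 0 = 0.
Context d (T : measurableType d) (P : probability T R) (Y : {RV P >-> R}).
Hypothesis ndY : ~ degenerate Y.
Local Notation full := (fun w y => (Y w <= y)%R%:R : R).

Let rF : random_cdf Y full := random_cdf_full Y.

(** If the constant vanished, the indicator of Y <= y would equal F_Y y almost surely for every [y],
    and [Y] would be degenerate. *)
Lemma xi_int_full_gt0 : 0 < xi_int phi Y full.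
Proof.
rewrite lt_neqAle (xi_int_ge0 cphi phi0 rF) andbT eq_sym; apply/eqP => xi0.
exact/ndY/degenerate_full/(xi_int_eq0 cphi sphi phi0 rF xi0).
Qed.

Lemma Lambda_int_full_gt0 : 0 < Lambda_int phi Y full.
Proof.
rewrite lt_neqAle (Lambda_int_ge0 cphi phi0 rF) andbT eq_sym; apply/eqP => L0.
exact/ndY/degenerate_full/(Lambda_int_eq0 cphi sphi phi0 rF L0).
Qed.

Context p (X : {RV P >-> p.-tuple R}).

Let rS : random_cdf Y (cond_S Y X) := random_cdf_cond Y X.

Lemma xi_range : 0 <= xi phi Y X <= 1.
Proof.
rewrite (xiE cphi); apply: (ratio_range xi_int_full_gt0 (xi_int_ge0 cphi phi0 rS)).
exact: (xi_int_le cphi rS rF (cx01_cond_full Y X)).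
Qed.

Lemma Lambda_range : 0 <= Lambda phi Y X <= 1.
Proof.
rewrite (LambdaE cphi); apply: (ratio_range Lambda_int_full_gt0 (Lambda_int_ge0 cphi phi0 rS)).
exact: (Lambda_int_le cphi rS rF (cx01_cond_full Y X)).
Qed.

Lemma xi_eq0 : xi phi Y X = 0 <-> independent Y X.
Proof.
rewrite (xiE cphi); apply: iff_trans (ratio_eq0 _ xi_int_full_gt0) _.
apply: iff_trans _ (iff_sym (independent_cond_S Y X)); split=> [xE|SF].
  exact: (xi_int_eq0 cphi sphi phi0 rS xE).
have [e _] := xi_int_ae_eq cphi rS (random_cdf_const Y) SF.
exact: (etrans e (xi_int_const Y phi0)).
Qed.

Lemma Lambda_eq0 : Lambda phi Y X = 0 <-> independent Y X.
Proof.
rewrite (LambdaE cphi); apply: iff_trans (ratio_eq0 _ Lambda_int_full_gt0) _.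
apply: iff_trans _ (iff_sym (independent_cond_S Y X)); split=> [xE|SF].
  exact: (Lambda_int_eq0 cphi sphi phi0 rS xE).
have [_ e] := xi_int_ae_eq cphi rS (random_cdf_const Y) SF.
exact: (etrans e (Lambda_int_const Y phi0)).
Qed.

Lemma xi_eq1 : xi phi Y X = 1 <-> function_of Y X.
Proof.
rewrite (xiE cphi); apply: iff_trans (ratio_eq1 _ xi_int_full_gt0) _.
apply: iff_trans _ (iff_sym (function_of_cond_S Y X)); split=> [xE|SF].
  exact: (xi_int_eq_full cphi sphi phi0 xE).
by have [e _] := xi_int_ae_eq cphi rS rF SF.
Qed.

Lemma Lambda_eq1 : Lambda phi Y X = 1 <-> function_of Y X.
Proof.
rewrite (LambdaE cphi); apply: iff_trans (ratio_eq1 _ Lambda_int_full_gt0) _.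
apply: iff_trans _ (iff_sym (function_of_cond_S Y X)); split=> [xE|SF].
  exact: (Lambda_int_eq_full cphi sphi phi0 xE).
by have [_ e] := xi_int_ae_eq cphi rS rF SF.
Qed.

Section information.
Context q (Z : {RV P >-> q.-tuple R}).

Let W := rv_cat X Z.
Let rW : random_cdf Y (cond_S Y W) := random_cdf_cond Y W.
Let left_cat w : tuple_left (W w) = X w.
Proof. exact: tuple_left_cat. Qed.
Let right_cat w : tuple_right (W w) = Z w.
Proof. exact: tuple_right_cat. Qed.
Let cx := cx01_finer Y (@measurable_tuple_left R p q) left_cat.

Lemma xi_cat_le : xi phi Y X <= xi phi Y W.
Proof.
rewrite !(xiE cphi); apply: (ratio_le xi_int_full_gt0).
exact: (xi_int_le cphi rS rW cx).
Qed.

Lemma Lambda_cat_le : Lambda phi Y X <= Lambda phi Y W.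
Proof.
rewrite !(LambdaE cphi); apply: (ratio_le Lambda_int_full_gt0).
exact: (Lambda_int_le cphi rS rW cx).
Qed.

Hypothesis scphi : strictly_convex `[-1, 1]%classic phi.

Lemma xi_cat_eq : xi phi Y X = xi phi Y W <->
  forall y, \forall w \ae P, cond_S Y X w y = cond_S Y W w y.
Proof.
rewrite !(xiE cphi); apply: iff_trans (ratio_eq _ _ xi_int_full_gt0) _; split=> [xE|SE].
  exact: (xi_int_eq_finer cphi (@measurable_tuple_left R p q) left_cat scphi xE).
by have [e _] := xi_int_ae_eq cphi rS rW SE.
Qed.

Lemma Lambda_cat_eq : Lambda phi Y X = Lambda phi Y W <->
  forall y, \forall w \ae P, cond_S Y X w y = cond_S Y W w y.
Proof.
rewrite !(LambdaE cphi); apply: iff_trans (ratio_eq _ _ Lambda_int_full_gt0) _; split=> [xE|SE].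
  exact: (Lambda_int_eq_finer cphi (@measurable_tuple_left R p q) left_cat scphi xE).
by have [_ e] := xi_int_ae_eq cphi rS rW SE.
Qed.

Lemma cond_S_cat_eq : (forall y, \forall w \ae P, cond_S Y X w y = cond_S Y W w y) <->
  cond_independent Y Z X.
Proof.
split; first exact: (cond_independent_of_cond_S (@measurable_tuple_left R p q)
  (@measurable_tuple_right R p q) left_cat right_cat).
apply: (cond_S_of_cond_independent (@measurable_tuple_left R p q) (@measurable_cat_pair R p q) left_cat).
by move=> w.
Qed.

End information.
End normalization.

Theorem theorem4p1 (R : realType) (phi : R -> R)
    (phi_convex : convex_function (`[-1, 1]%classic : set R^o) phi)
    (phi_strict0 : strictly_convex_at0 `[-1, 1] phi)
    (phi0 : phi 0 = 0) :
  (* monotonicity in the conditional convex order *)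
  (forall (d : measure_display) (T : measurableType d) (P : probability T R)
      (d' : measure_display) (T' : measurableType d') (P' : probability T' R)
      (p p' : nat)
      (Y : {RV P >-> R}) (X : {RV P >-> p.-tuple R})
      (Y' : {RV P' >-> R}) (X' : {RV P' >-> p'.-tuple R}),
    ~ degenerate Y -> ~ degenerate Y' -> le_ccx Y X Y' X' ->
    xi phi Y X <= xi phi Y' X' /\ Lambda phi Y X <= Lambda phi Y' X')
  /\
  (* (i) range *)
  (forall (d : measure_display) (T : measurableType d) (P : probability T R)
      (p : nat) (Y : {RV P >-> R}) (X : {RV P >-> p.-tuple R}),
    ~ degenerate Y ->
    0 <= xi phi Y X <= 1 /\ 0 <= Lambda phi Y X <= 1)
  /\
  (* (ii) zero-independence and max-functionality *)
  (forall (d : measure_display) (T : measurableType d) (P : probability T R)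
      (p : nat) (Y : {RV P >-> R}) (X : {RV P >-> p.-tuple R}),
    ~ degenerate Y ->
    [/\ xi phi Y X = 0 <-> independent Y X,
        Lambda phi Y X = 0 <-> independent Y X,
        xi phi Y X = 1 <-> function_of Y X &
        Lambda phi Y X = 1 <-> function_of Y X])
  /\
  (* (iii) information monotonicity *)
  (forall (d : measure_display) (T : measurableType d) (P : probability T R)
      (p q : nat) (Y : {RV P >-> R})
      (X : {RV P >-> p.-tuple R}) (Z : {RV P >-> q.-tuple R}),
    ~ degenerate Y ->
    xi phi Y X <= xi phi Y (rv_cat X Z) /\
    Lambda phi Y X <= Lambda phi Y (rv_cat X Z))
  /\
  (* (iv) equality in (iii) *)
  (strictly_convex `[-1, 1] phi ->
   forall (d : measure_display) (T : measurableType d) (P : probability T R)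
      (p q : nat) (Y : {RV P >-> R})
      (X : {RV P >-> p.-tuple R}) (Z : {RV P >-> q.-tuple R}),
    ~ degenerate Y ->
    (Lambda phi Y X = Lambda phi Y (rv_cat X Z) <->
     xi phi Y X = xi phi Y (rv_cat X Z)) /\
    (xi phi Y X = xi phi Y (rv_cat X Z) <-> cond_independent Y Z X)).
Proof.
have cphi := convex_function_convex_on phi_convex.
split; [|split; [|split; [|split]]].
- move=> d T P d' T' P' p p' Y X Y' X' ndY ndY' ccx.
  have [le_xi le_Lambda] := ccx_xi ccx cphi; have [xiF LambdaF] := ccx_full ccx cphi.
  (* With the normalizing constants identified, only the numerators remain to be compared. *)
  rewrite !(xiE cphi) !(LambdaE cphi) -xiF -LambdaF.
  split.
  + exact: (ratio_le (xi_int_full_gt0 cphi phi_strict0 phi0 ndY) le_xi).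
  + exact: (ratio_le (Lambda_int_full_gt0 cphi phi_strict0 phi0 ndY) le_Lambda).
- move=> d T P p Y X ndY; split; first exact: xi_range.
  exact: Lambda_range.
- move=> d T P p Y X ndY; split.
  + exact: xi_eq0.
  + exact: Lambda_eq0.
  + exact: xi_eq1.
  + exact: Lambda_eq1.
- move=> d T P p q Y X Z ndY; split; first exact: xi_cat_le.
  exact: Lambda_cat_le.
- move=> scphi d T P p q Y X Z ndY.
  have xE := xi_cat_eq cphi phi_strict0 phi0 ndY X Z scphi.
  have LE := Lambda_cat_eq cphi phi_strict0 phi0 ndY X Z scphi.
  split; first exact: (iff_trans LE (iff_sym xE)).
  exact: (iff_trans xE (cond_S_cat_eq Y X Z)).
Qed.
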